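(* Let $\mathfrak g$ be either $G(3)$ or $F(4)$ (over $\mathbb C$). Let $\Xi$ be any of the systems of simple roots of $\mathfrak g$ listed in the context, let $N$ be its index set ($N=\{1,2,3\}$ for $G(3)$, $N=\{1,2,3,4\}$ for $F(4)$), and let $S\subseteq N$ be nonempty. Let $\mathfrak g=\bigoplus_{k=-\mu}^{\mu}\mathfrak g_k$ be the associated grading, $\mathfrak m^{\Xi}_S=\bigoplus_{k<0}\mathfrak g_k$ and $\mathfrak g^{\Xi,S}_0$ the degree-zero part. (a) If $(\Xi,S)$ is not one of the exceptional pairs listed below, then the Tanaka–Weisfeiler prolongation satisfies $\operatorname{pr}(\mathfrak m^{\Xi}_S)=\mathfrak g$ (i.e. the natural graded embedding $\mathfrak g\hookrightarrow \operatorname{pr}(\mathfrak m^\Xi_S)$ is an isomorphism). (b) If $(\Xi,S)$ is one of the exceptional pairs, then $\operatorname{pr}(\mathfrak m^{\Xi}_S)$ is infinite-dimensional, while $\operatorname{pr}(\mathfrak m^{\Xi}_S,\mathfrak g^{\Xi,S}_0)=\mathfrak g$. The exceptional pairs are: for $G(3)$: $(\mathrm I,\{1\})$, $(\mathrm{III},\{1\})$, $(\mathrm{IV},\{1\})$ (the odd and the mixed contact gradings); for $F(4)$: $(\mathrm I,\{1\})$; $(\mathrm I,\{4\}),(\mathrm{II},\{4\}),(\mathrm{III},\{1\}),(\mathrm{IV},\{1\}),(\mathrm V,\{1\})$ (the depth-one grading); $(\mathrm{III},\{3\}),(\mathrm{IV},\{4\}),(\mathrm V,\{4\}),(\mathr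m{VI},\{4\})$.
   Context: $G(3)$ is the exceptional complex simple Lie superalgebra of superdimension $(17|14)$ with Cartan subalgebra $\mathfrak h\subset\mathfrak g_{\bar 0}$, $\dim\mathfrak h=3$; $\mathfrak h^*$ is spanned by $\delta,\varepsilon_1,\varepsilon_2,\varepsilon_3$ subject only to $\varepsilon_1+\varepsilon_2+\varepsilon_3=0$. Even roots: $\pm2\delta,\pm\varepsilon_i,\varepsilon_i-\varepsilon_j$ ($i\neq j$); odd roots: $\pm\delta,\pm\delta\pm\varepsilon_i$; root spaces are one-dimensional. Systems of simple roots $\Pi_\Xi=(\alpha_1,\alpha_2,\alpha_3)$: I: $(\delta-\varepsilon_1-\varepsilon_2,\ \varepsilon_1,\ \varepsilon_2-\varepsilon_1)$; II: $(\varepsilon_1+\varepsilon_2-\delta,\ \delta-\varepsilon_2,\ \varepsilon_2-\varepsilon_1)$; III: $(\varepsilon_2-\delta,\ \delta-\varepsilon_1,\ \varepsilon_1)$; IV: $(\varepsilon_2-\varepsilon_1,\ \varepsilon_1-\delta,\ \delta)$. $F(4)$ is the exceptional complex simple Lie superalgebra of superdimension $(24|16)$ with Cartan subalgebra $\mathfrak h\subset\mathfrak g_{\bar0}$, $\dim\mathfrak h=4$, $\mathfrak h^*$ having basis $\delta,\varepsilon_1,\varepsilon_2,\varepsilon_3$. Even roots: $\pm\delta,\pm\varepsilon_i,\pm\varepsilon_i\pm\varepsilon_j$ ($i<j$); odd roots: $\tfrac12(\pm\delta\pm\varepsilon_1\pm\varepsilon_2\pm\varepsilon_3)$; root spaces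 one-dimensional. Systems of simple roots $\Pi_\Xi=(\alpha_1,\alpha_2,\alpha_3,\alpha_4)$: I: $(\tfrac12(\delta-\varepsilon_1-\varepsilon_2-\varepsilon_3),\varepsilon_3,\varepsilon_2-\varepsilon_3,\varepsilon_1-\varepsilon_2)$; II: $(\tfrac12(-\delta+\varepsilon_1+\varepsilon_2+\varepsilon_3),\tfrac12(\delta-\varepsilon_1-\varepsilon_2+\varepsilon_3),\varepsilon_2-\varepsilon_3,\varepsilon_1-\varepsilon_2)$; III: $(\varepsilon_1-\varepsilon_2,\tfrac12(\delta-\varepsilon_1+\varepsilon_2-\varepsilon_3),\tfrac12(-\delta+\varepsilon_1+\varepsilon_2-\varepsilon_3),\varepsilon_3)$; IV: $(\tfrac12(\delta+\varepsilon_1-\varepsilon_2-\varepsilon_3),\tfrac12(\delta-\varepsilon_1+\varepsilon_2+\varepsilon_3),\tfrac12(-\delta+\varepsilon_1-\varepsilon_2+\varepsilon_3),\varepsilon_2-\varepsilon_3)$; V: $(\delta,\tfrac12(-\delta+\varepsilon_1-\varepsilon_2-\varepsilon_3),\varepsilon_3,\varepsilon_2-\varepsilon_3)$; VI: $(\delta,\tfrac12(-\delta-\varepsilon_1+\varepsilon_2+\varepsilon_3),\varepsilon_1-\varepsilon_2,\varepsilon_2-\varepsilon_3)$. Grading: for a fixed $\Xi$ every root is $\alpha=\sum_i m_i\alpha_i$ with integers $m_i$ all $\ge0$ or all $\le0$. For nonempty $S\subseteq N$, the root space of $\alpha$ is put in degree $\sum_{i\in S}m_i$ and $\mathfrak h$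 in degree $0$; this gives a $\mathbb Z$-grading $\mathfrak g=\bigoplus_{k=-\mu}^{\mu}\mathfrak g_k$ (the grading of the parabolic $\mathfrak p^\Xi_S=\bigoplus_{k\ge0}\mathfrak g_k$), and $\mathfrak m^\Xi_S=\bigoplus_{k<0}\mathfrak g_k$ is generated by $\mathfrak g_{-1}$. Tanaka–Weisfeiler prolongation: for a negatively graded Lie superalgebra $\mathfrak m=\bigoplus_{k=-\mu}^{-1}\mathfrak g_k$, $\operatorname{pr}(\mathfrak m)=\bigoplus_{k\ge-\mu}\mathfrak g_k$ is the maximal $\mathbb Z$-graded Lie superalgebra whose negative part is $\mathfrak m$ and which is transitive (if $X\in\mathfrak g_k$, $k\ge0$, and $[X,\mathfrak g_{-1}]=0$ then $X=0$). For a subalgebra $\mathfrak g_0$ of the grade-preserving derivations of $\mathfrak m$, $\operatorname{pr}(\mathfrak m,\mathfrak g_0)$ is defined in the same way but with degree-zero part required to be $\mathfrak g_0$. *)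

(* Defs.v *)
(* Lie superalgebras over a field K; G(3), F(4) characterised by
   their root data; Z-gradings from simple root systems; Tanaka--Weisfeiler
   prolongation defined as the maximal transitive graded Lie superalgebra. *)
From HB Require Import structures.
From mathcomp Require Import all_boot all_order all_algebra.
From mathcomp Require Import complex reals.

Set Implicit Arguments.
Unset Strict Implicit.
Unset Printing Implicit Defensive.

Import GRing.Theory Num.Theory.
Local Open Scope ring_scope.

Section Defs.
Variable K : fieldType.

Record LSA := MkLSA {
  lsa_V :> vectType K;
  lsa_br : lsa_V -> lsa_V -> lsa_V;
  lsa_par : bool -> {vspace lsa_V} (* false = even part, true = odd part *) }.

Definition sgn (p q : bool) : K := (-1) ^+ (p && q).

Definition IsLSA (g : LSA) : Prop :=
  let br := @lsa_br g in let par := lsa_par g in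
  [/\ (forall a (x y z : g), br (a *: x + y) z = a *: br x z + br y z) /\
      (forall a (x y z : g), br z (a *: x + y) = a *: br z x + br z y),
      (par false + par true = fullv)%VS /\ (par false :&: par true = 0)%VS,
      (forall p q (x y : g), x \in par p -> y \in par q -> br x y \in par (addb p q)),
      (forall p q (x y : g), x \in par p -> y \in par q -> br x y = - (sgn p q *: br y x))
    & (forall p q (x y z : g), x \in par p -> y \in par q ->
         br x (br y z) = br (br x y) z + sgn p q *: br y (br x z))].

Definition IsSimpleLSA (g : LSA) : Prop :=
  (exists x y : g, lsa_br x y != 0) /\
  forall I : {vspace g},
    (I = (I :&: lsa_par g false) + (I :&: lsa_par g true))%VS ->
    (forall x y : g, y \in I -> lsa_br x y \in I) ->
    I = 0%VS \/ I = fullv.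

(* a weight a*delta + b*eps1 + c*eps2 + d*eps3 is encoded as (a,b,c,d) *)
Definition wt := (rat * rat * rat * rat)%type.
Definition W (a b c d : rat) : wt := (a, b, c, d).
Definition W0 : wt := W 0 0 0 0.

Definition weval (V : vectType K) (d e1 e2 e3 : V -> K) (w : wt) (H : V) : K :=
  ratr w.1.1.1 * d H + ratr w.1.1.2 * e1 H + ratr w.1.2 * e2 H + ratr w.2 * e3 H.

Definition lin_on (V : vectType K) (h : {vspace V}) (f : V -> K) : Prop :=
  forall a (x y : V), x \in h -> y \in h -> f (a *: x + y) = a * f x + f y.

Definition rootspace (g : LSA) (h : {vspace g}) (f : g -> K) (x : g) : Prop :=
  forall H, H \in h -> lsa_br H x = f H *: x.

Definition RootData (g : LSA) (h : {vspace g}) (ev : wt -> g -> K)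
    (Phi : seq (wt * bool)) : Prop :=
  [/\ (h <= lsa_par g false)%VS,
      (forall x y : g, x \in h -> y \in h -> lsa_br x y = 0),
      (forall r, r \in Phi -> exists e : g,
          [/\ e != 0, e \in lsa_par g r.2 &
              forall x, rootspace h (ev r.1) x <-> exists c : K, x = c *: e])
    & (forall v : g, exists (H : g) (xs : wt * bool -> g),
          [/\ H \in h, (forall r, r \in Phi -> rootspace h (ev r.1) (xs r))
            & v = H + \sum_(r <- Phi) xs r])].

Definition rdeg (g : LSA) (h : {vspace g}) (ev : wt -> g -> K) (n : nat)
    (sr : 'I_n -> wt) (S : {set 'I_n}) (a : wt) (k : int) : Prop :=
  exists m : 'I_n -> int,
    (forall H, H \in h -> ev a H = \sum_(i < n) (m i)%:~R * ev (sr i) H) /\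
    \sum_(i in S) m i = k.

Definition gpiece (g : LSA) (h : {vspace g}) (ev : wt -> g -> K)
    (Phi : seq (wt * bool)) (n : nat) (sr : 'I_n -> wt) (S : {set 'I_n})
    (k : int) (p : bool) (x : g) : Prop :=
  exists (H : g) (xs : wt * bool -> g),
    [/\ H \in h, ((k != 0) || p -> H = 0),
        (forall r, r \in Phi -> rootspace h (ev r.1) (xs r) /\
             (xs r != 0 -> r.2 = p /\ rdeg h ev sr S r.1 k))
      & x = H + \sum_(r <- Phi) xs r].

Record gLSA := MkG {
  gl_V :> lmodType K;
  gl_br : gl_V -> gl_V -> gl_V;
  gl_hom : int -> bool -> gl_V -> Prop (* homogeneous of degree k and parity p *) }.

Definition IsGLSA (L : gLSA) : Prop :=
  let br := @gl_br L in let hom := @gl_hom L in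
  [/\ (forall a (x y z : L), br (a *: x + y) z = a *: br x z + br y z) /\
      (forall a (x y z : L), br z (a *: x + y) = a *: br z x + br z y),
      (forall k p, hom k p 0) /\
      (forall k p a (x y : L), hom k p x -> hom k p y -> hom k p (a *: x + y)) /\
      (forall v : L, exists s : seq (int * bool * L),
          (forall t, t \in s -> hom t.1.1 t.1.2 t.2) /\ v = \sum_(t <- s) t.2),
      (forall s : seq (int * bool * L), uniq (map fst s) ->
          (forall t, t \in s -> hom t.1.1 t.1.2 t.2) ->
          \sum_(t <- s) t.2 = 0 -> forall t, t \in s -> t.2 = 0) /\
      (forall k l p q (x y : L), hom k p x -> hom l q y -> hom (k + l) (addb p q) (br x y)),
      (forall k l p q (x y : L), hom k p x -> hom l q y -> br x y = - (sgn p q *: br y x))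
    & (forall k l p q (x y z : L), hom k p x -> hom l q y ->
         br x (br y z) = br (br x y) z + sgn p q *: br y (br x z))].

Definition Transitive (L : gLSA) : Prop :=
  forall k p (x : L), 0 <= k -> gl_hom k p x ->
    (forall q (y : L), gl_hom (-1) q y -> gl_br x y = 0) -> x = 0.

Definition NegIso (G L : gLSA) (phi : G -> L) : Prop :=
  [/\ (forall a (x y : G), phi (a *: x + y) = a *: phi x + phi y),
      (forall k p (x : G), k < 0 -> gl_hom k p x -> gl_hom k p (phi x)),
      (forall k p (y : L), k < 0 -> gl_hom k p y -> exists x : G, gl_hom k p x /\ phi x = y),
      (forall k p (x : G), k < 0 -> gl_hom k p x -> phi x = 0 -> x = 0)
    & (forall k l p q (x y : G), k < 0 -> l < 0 -> gl_hom k p x -> gl_hom l q y ->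
         phi (gl_br x y) = gl_br (phi x) (phi y))].

Definition Embed (L P : gLSA) (psi : L -> P) : Prop :=
  [/\ (forall a (x y : L), psi (a *: x + y) = a *: psi x + psi y),
      (forall k p (x : L), gl_hom k p x -> gl_hom k p (psi x)),
      (forall x : L, psi x = 0 -> x = 0)
    & (forall x y : L, psi (gl_br x y) = gl_br (psi x) (psi y))].

Definition Compat (G L P : gLSA) (phiL : G -> L) (phiP : G -> P) (psi : L -> P) : Prop :=
  forall k p (x : G), k < 0 -> gl_hom k p x -> psi (phiL x) = phiP x.

(* P (with phi : m ~= P_{<0}) is pr(m), m = negative part of G *)
Definition IsPr (G P : gLSA) (phi : G -> P) : Prop :=
  [/\ IsGLSA P, Transitive P, NegIso phi &
      forall (L : gLSA) (phiL : G -> L), IsGLSA L -> Transitive L -> NegIso phiL ->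
        exists psi : L -> P, Embed psi /\ Compat phiL phi psi].

Definition Deg0 (G L : gLSA) (phi : G -> L) : Prop :=
  (forall p (y : L), gl_hom 0 p y -> exists z : G, gl_hom 0 p z /\
     forall k q (x : G), k < 0 -> gl_hom k q x -> gl_br y (phi x) = phi (gl_br z x)) /\
  (forall p (z : G), gl_hom 0 p z -> exists y : L, gl_hom 0 p y /\
     forall k q (x : G), k < 0 -> gl_hom k q x -> gl_br y (phi x) = phi (gl_br z x)).

Definition IsPr0 (G P : gLSA) (phi : G -> P) : Prop :=
  [/\ IsGLSA P, Transitive P, NegIso phi, Deg0 phi &
      forall (L : gLSA) (phiL : G -> L), IsGLSA L -> Transitive L -> NegIso phiL ->
        Deg0 phiL ->
        exists psi : L -> P, Embed psi /\ Compat phiL phi psi].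

Definition InfDim (L : gLSA) : Prop :=
  forall n : nat, exists v : 'I_n -> L,
    forall c : 'I_n -> K, \sum_(i < n) c i *: v i = 0 -> forall i, c i = 0.

Definition gradedG (g : LSA) (h : {vspace g}) (ev : wt -> g -> K)
    (Phi : seq (wt * bool)) (n : nat) (sr : 'I_n -> wt) (S : {set 'I_n}) : gLSA :=
  @MkG g (@lsa_br g) (gpiece h ev Phi sr S).

Definition G3roots : seq (wt * bool) :=
  [seq (w, false) | w <- [:: W 2 0 0 0; W (-2) 0 0 0;
     W 0 1 0 0; W 0 0 1 0; W 0 0 0 1; W 0 (-1) 0 0; W 0 0 (-1) 0; W 0 0 0 (-1);
     W 0 1 (-1) 0; W 0 (-1) 1 0; W 0 1 0 (-1); W 0 (-1) 0 1; W 0 0 1 (-1); W 0 0 (-1) 1]]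
  ++ [seq (w, true) | w <- [:: W 1 0 0 0; W (-1) 0 0 0;
     W 1 1 0 0; W 1 (-1) 0 0; W (-1) 1 0 0; W (-1) (-1) 0 0;
     W 1 0 1 0; W 1 0 (-1) 0; W (-1) 0 1 0; W (-1) 0 (-1) 0;
     W 1 0 0 1; W 1 0 0 (-1); W (-1) 0 0 1; W (-1) 0 0 (-1)]].

Definition G3data (g : LSA) (h : {vspace g}) (d e1 e2 e3 : g -> K) : Prop :=
  [/\ IsLSA g /\ IsSimpleLSA g,
      \dim (lsa_par g false) = 17%N /\ \dim (lsa_par g true) = 14%N,
      \dim h = 3%N /\ [/\ lin_on h d, lin_on h e1, lin_on h e2 & lin_on h e3],
      (forall H, H \in h -> e1 H + e2 H + e3 H = 0) /\
      (forall a b c : K, (forall H, H \in h -> a * d H + b * e1 H + c * e2 H = 0) ->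
          [/\ a = 0, b = 0 & c = 0])
    & RootData h (weval d e1 e2 e3) G3roots].

Definition hf : rat := 2^-1.
Definition sg2 : seq rat := [:: 1; -1].

Definition F4roots : seq (wt * bool) :=
  [seq (w, false) | w <- [:: W 1 0 0 0; W (-1) 0 0 0;
     W 0 1 0 0; W 0 0 1 0; W 0 0 0 1; W 0 (-1) 0 0; W 0 0 (-1) 0; W 0 0 0 (-1);
     W 0 1 1 0; W 0 1 (-1) 0; W 0 (-1) 1 0; W 0 (-1) (-1) 0;
     W 0 1 0 1; W 0 1 0 (-1); W 0 (-1) 0 1; W 0 (-1) 0 (-1);
     W 0 0 1 1; W 0 0 1 (-1); W 0 0 (-1) 1; W 0 0 (-1) (-1)]]
  ++ [seq (w, true) | w <- flatten (flatten (flatten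
       [seq [seq [seq [seq W (a * hf) (b * hf) (c * hf) (d * hf) | d <- sg2]
         | c <- sg2] | b <- sg2] | a <- sg2]))].

Definition F4data (g : LSA) (h : {vspace g}) (d e1 e2 e3 : g -> K) : Prop :=
  [/\ IsLSA g /\ IsSimpleLSA g,
      \dim (lsa_par g false) = 24%N /\ \dim (lsa_par g true) = 16%N,
      \dim h = 4%N /\ [/\ lin_on h d, lin_on h e1, lin_on h e2 & lin_on h e3],
      (forall a b c e : K,
          (forall H, H \in h -> a * d H + b * e1 H + c * e2 H + e * e3 H = 0) ->
          [/\ a = 0, b = 0, c = 0 & e = 0])
    & RootData h (weval d e1 e2 e3) F4roots].

End Defs.

Inductive g3sys := G3I | G3II | G3III | G3IV.
Inductive f4sys := F4I | F4II | F4III | F4IV | F4V | F4VI.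

Definition g3simple (X : g3sys) : 'I_3 -> wt := fun i => nth W0
  match X with
  | G3I   => [:: W 1 (-1) (-1) 0; W 0 1 0 0; W 0 (-1) 1 0]
  | G3II  => [:: W (-1) 1 1 0; W 1 0 (-1) 0; W 0 (-1) 1 0]
  | G3III => [:: W (-1) 0 1 0; W 1 (-1) 0 0; W 0 1 0 0]
  | G3IV  => [:: W 0 (-1) 1 0; W (-1) 1 0 0; W 1 0 0 0]
  end i.

Definition f4simple (X : f4sys) : 'I_4 -> wt := fun i => nth W0
  match X with
  | F4I   => [:: W hf (- hf) (- hf) (- hf); W 0 0 0 1; W 0 0 1 (-1); W 0 1 (-1) 0]
  | F4II  => [:: W (- hf) hf hf hf; W hf (- hf) (- hf) hf; W 0 0 1 (-1); W 0 1 (-1) 0]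
  | F4III => [:: W 0 1 (-1) 0; W hf (- hf) hf (- hf); W (- hf) hf hf (- hf); W 0 0 0 1]
  | F4IV  => [:: W hf hf (- hf) (- hf); W hf (- hf) hf hf; W (- hf) hf (- hf) hf;
                 W 0 0 1 (-1)]
  | F4V   => [:: W 1 0 0 0; W (- hf) hf (- hf) (- hf); W 0 0 0 1; W 0 0 1 (-1)]
  | F4VI  => [:: W 1 0 0 0; W (- hf) (- hf) hf hf; W 0 1 (-1) 0; W 0 0 1 (-1)]
  end i.

(* exceptional pairs (Xi, S); index i of the paper is the ordinal i-1 *)
Definition g3exc (X : g3sys) (S : {set 'I_3}) : bool :=
  match X with
  | G3II => false
  | _ => S == [set ord0]
  end.

Definition f4exc (X : f4sys) (S : {set 'I_4}) : bool :=
  match X with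
  | F4I   => (S == [set ord0]) || (S == [set ord_max])
  | F4II  => S == [set ord_max]
  | F4III => (S == [set ord0]) || (S == [set inord 2])
  | F4IV  => (S == [set ord0]) || (S == [set ord_max])
  | F4V   => (S == [set ord0]) || (S == [set ord_max])
  | F4VI  => S == [set ord_max]
  end.

(* Main.v *)
(* The root data determine the algebra: rescaling root vectors, the Jacobi identities and
   simplicity force a basis with prescribed integer structure constants.  All that remains is
   therefore a finite amount of linear algebra over the integers.

   By transitivity, an element of degree [d >= 0] of a transitive graded superalgebra with negative
   part [m] is determined by its action on [m], which is a derivation of degree [d] of [m] into the
   part already constructed.  So [g] is the prolongation as soon as [H^1(m, g)_d = 0] for all
   [d >= 0], and it is the prolongation relative to its degree-zero part as soon as this holds for
   [d >= 1].  The Cartan subalgebra acts on cochains, so the cohomology splits by weight into small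
   linear systems with integer coefficients, whose nondegeneracy is decided by elimination.

   For the exceptional gradings the full prolongation is realised by functions [seq I -> G] giving
   the iterated brackets of an element with a basis of [m].  If [m] contains a suitable pair of
   even vectors of degree -1, the Hamiltonian fields of the powers of an even coordinate are
   independent elements of unbounded degree.  In the two odd contact gradings a cubic form in the
   odd coordinates together with [sl_2] generates unboundedly many degrees. *)

(* The competitors in the definition of the prolongation are arbitrary algebras, so an embedding of
   them cannot be given by a formula. It is obtained from a relation: [x] and [X] correspond when
   all their iterated brackets with [m] that reach negative degree agree. Transitivity makes this
   the graph of an injective morphism, and the finite and the infinite case only have to find a
   partner for every homogeneous [x]. No model of G(3) or F(4) is at hand, only an algebra with the
   right roots. The table of structure constants is therefore not shown to define a Lie
   superalgebra; it is derived entry by entry. A priori some [[e_i, e_{-i}]] might vanish, and this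
   is where simplicity enters. All tables refer to system I. Another system only changes the degrees
   given to these simple roots, so one basis serves for every pair (Xi, S). Cohomology is not
   computed as a quotient: gauge conditions single out one cocycle in each class, and vanishing
   becomes the injectivity of an integral linear system. *)
Require Import Defs.
From HB Require Import structures.
From Stdlib Require Import ZArith.
From mathcomp Require Import all_boot all_order all_algebra.
From mathcomp Require Import boolp functions complex reals.
From mathcomp Require Import zify ssrZ ring.

Set Implicit Arguments.
Unset Strict Implicit.
Unset Printing Implicit Defensive.

Import Order.TTheory GRing.Theory Num.Theory.
Local Open Scope ring_scope.

(* A reflexive normaliser for linear combinations in a module: [lmod] reduces an
   equality of vectors to the equality of the coefficients of each atom. *)
Section LinearCombinations.
Variables (K : comNzRingType) (V : lmodType K).

Inductive lexp := LVar of nat | LZero | LAdd of lexp & lexp | LOpp of lexp | LScale of K & lexp.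

Fixpoint leval (env : seq V) (e : lexp) : V := match e with
  | LVar n => nth 0 env n
  | LZero => 0
  | LAdd e f => leval env e + leval env f
  | LOpp e => - leval env e
  | LScale c e => c *: leval env e
  end.

Fixpoint lcoef (e : lexp) (i : nat) : K := match e with
  | LVar n => if n == i then 1 else 0
  | LZero => 0
  | LAdd e f => lcoef e i + lcoef f i
  | LOpp e => - lcoef e i
  | LScale c e => c * lcoef e i
  end.

Fixpoint lcoef_eq (e f : lexp) (n : nat) : Prop :=
  if n is m.+1 then lcoef e m = lcoef f m /\ lcoef_eq e f m else True.

Lemma leval_coef env e : leval env e = \sum_(i < size env) lcoef e i *: nth 0 env i.
Proof.
elim: e => [n||e IHe f IHf|e IH|c e IH] /=.
- have [h|h] := ltnP n (size env).
    rewrite (bigD1 (Ordinal h)) //= eqxx scale1r big1 ?addr0 // => i ne.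
    by rewrite ifN ?scale0r // eq_sym; apply: contraNneq ne => e; apply/eqP/val_inj.
  rewrite nth_default // big1 // => i _; rewrite ifN ?scale0r //.
  by apply: contraTneq h => ->; rewrite -ltnNge.
- by rewrite big1 // => i _; rewrite scale0r.
- by rewrite IHe IHf -big_split; apply: eq_bigr => i _; rewrite scalerDl.
- by rewrite IH -sumrN; apply: eq_bigr => i _; rewrite scaleNr.
- by rewrite IH scaler_sumr; apply: eq_bigr => i _; rewrite scalerA.
Qed.

Lemma leval_eq env e f : lcoef_eq e f (size env) -> leval env e = leval env f.
Proof.
move=> h; rewrite !leval_coef; apply: eq_bigr => i _; congr (_ *: _).
move: (size env) h (val i) (ltn_ord i) => n; elim: n => [//|n IH] /= [h1 h2] j.
by rewrite ltnS leq_eqVlt => /predU1P[->//|]; apply: IH.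
Qed.
End LinearCombinations.

Ltac lmod_mem x env :=
  lazymatch env with
  | nil => constr:(false)
  | cons x _ => constr:(true)
  | cons _ ?e => lmod_mem x e
  end.
Ltac lmod_index x env :=
  lazymatch env with
  | cons x _ => constr:(O)
  | cons _ ?e => let n := lmod_index x e in constr:(S n)
  end.
Ltac lmod_atoms t env :=
  lazymatch t with
  | GRing.zero => env
  | GRing.add ?x ?y => let env := lmod_atoms x env in lmod_atoms y env
  | GRing.opp ?x => lmod_atoms x env
  | GRing.scale _ ?x => lmod_atoms x env
  | _ => let m := lmod_mem t env in
         lazymatch m with true => env | false => constr:(cons t env) end
  end.
Ltac lmod_reify K t env :=
  lazymatch t with
  | GRing.zero => constr:(LZero K)
  | GRing.add ?x ?y =>
      let a := lmod_reify K x env in let b := lmod_reify K y env in constr:(LAdd a b)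
  | GRing.opp ?x => let a := lmod_reify K x env in constr:(LOpp a)
  | GRing.scale ?c ?x => let a := lmod_reify K x env in constr:(@LScale K c a)
  | _ => let n := lmod_index t env in constr:(LVar K n)
  end.
(** The [change] checks the reified terms against the goal by conversion, so the reification itself
    is untrusted. *)
Ltac lmod_with K V :=
  lazymatch goal with
  | |- @eq ?T ?x ?y =>
    let env := lmod_atoms x (@nil (GRing.Lmodule.sort V)) in
    let env := lmod_atoms y env in
    let a := lmod_reify K x env in
    let b := lmod_reify K y env in
    change (@leval K V env a = @leval K V env b);
    apply: leval_eq; rewrite /=; repeat split; try ring
  end.

(** * Derivations and the maximal transitive algebra *)

Section GradedTheory.
Variables (K : fieldType) (L : gLSA K).
Hypothesis hL : IsGLSA L.

Lemma glsa_brPl a (x y z : L) : gl_br (a *: x + y) z = a *: gl_br x z + gl_br y z.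
Proof. by case: hL => [[]]. Qed.
Lemma glsa_brPr a (x y z : L) : gl_br z (a *: x + y) = a *: gl_br z x + gl_br z y.
Proof. by case: hL => [[]]. Qed.
Lemma glsa_brDl (x y z : L) : gl_br (x + y) z = gl_br x z + gl_br y z.
Proof. by rewrite -[x]scale1r glsa_brPl !scale1r. Qed.
Lemma glsa_brDr (x y z : L) : gl_br z (x + y) = gl_br z x + gl_br z y.
Proof. by rewrite -[x]scale1r glsa_brPr !scale1r. Qed.
Lemma glsa_br0l (z : L) : gl_br 0 z = 0.
Proof. by apply: (addrI (gl_br 0 z)); rewrite -glsa_brDl !addr0. Qed.
Lemma glsa_br0r (z : L) : gl_br z 0 = 0.
Proof. by apply: (addrI (gl_br z 0)); rewrite -glsa_brDr !addr0. Qed.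
Lemma glsa_brZl a (x z : L) : gl_br (a *: x) z = a *: gl_br x z.
Proof. by rewrite -[a *: x]addr0 glsa_brPl glsa_br0l addr0. Qed.
Lemma glsa_brZr a (x z : L) : gl_br z (a *: x) = a *: gl_br z x.
Proof. by rewrite -[a *: x]addr0 glsa_brPr glsa_br0r addr0. Qed.
Lemma glsa_brNl (x z : L) : gl_br (- x) z = - gl_br x z.
Proof. by rewrite -scaleN1r glsa_brZl scaleN1r. Qed.
Lemma glsa_br_suml (J : Type) (r : seq J) (Q : pred J) (f : J -> L) z :
  gl_br (\sum_(j <- r | Q j) f j) z = \sum_(j <- r | Q j) gl_br (f j) z.
Proof. by apply: (big_morph (fun x => gl_br x z)) => [x y|]; rewrite ?glsa_brDl ?glsa_br0l. Qed.
Lemma glsa_br_sumr (J : Type) (r : seq J) (Q : pred J) (f : J -> L) z :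
  gl_br z (\sum_(j <- r | Q j) f j) = \sum_(j <- r | Q j) gl_br z (f j).
Proof. by apply: (big_morph (fun x => gl_br z x)) => [x y|]; rewrite ?glsa_brDr ?glsa_br0r. Qed.

Lemma glsa_hom0 k p : gl_hom k p (0 : L). Proof. by case: hL => _ [h _]. Qed.
Lemma glsa_homP k p a (x y : L) :
  gl_hom k p x -> gl_hom k p y -> gl_hom k p (a *: x + y).
Proof. by case: hL => _ [_ [h _]] _ _ _; apply: h. Qed.
Lemma glsa_homD k p (x y : L) : gl_hom k p x -> gl_hom k p y -> gl_hom k p (x + y).
Proof. by move=> hx hy; rewrite -[x]scale1r; apply: glsa_homP. Qed.
Lemma glsa_homZ k p a (x : L) : gl_hom k p x -> gl_hom k p (a *: x).
Proof. by move=> hx; rewrite -[_ *: _]addr0; apply: glsa_homP => //; apply: glsa_hom0. Qed.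
Lemma glsa_homN k p (x : L) : gl_hom k p x -> gl_hom k p (- x).
Proof. by move=> hx; rewrite -scaleN1r; apply: glsa_homZ. Qed.
Lemma glsa_hom_sum k p (J : eqType) (r : seq J) (f : J -> L) :
  (forall j, j \in r -> gl_hom k p (f j)) -> gl_hom k p (\sum_(j <- r) f j).
Proof.
elim: r => [|j r IH] h; first by rewrite big_nil; apply: glsa_hom0.
rewrite big_cons; apply: glsa_homD; first by apply: h; rewrite mem_head.
by apply: IH => i ir; apply: h; rewrite inE ir orbT.
Qed.
Lemma glsa_decomp (v : L) : exists s : seq (int * bool * L),
  (forall t, t \in s -> gl_hom t.1.1 t.1.2 t.2) /\ v = \sum_(t <- s) t.2.
Proof. by case: hL => _ [_ [_ h]]. Qed.
Lemma glsa_indep (s : seq (int * bool * L)) : uniq (map fst s) ->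
  (forall t, t \in s -> gl_hom t.1.1 t.1.2 t.2) ->
  \sum_(t <- s) t.2 = 0 -> forall t, t \in s -> t.2 = 0.
Proof. by case: hL => _ _ [h _] _ _; apply: h. Qed.
Lemma glsa_br_hom k l p q (x y : L) :
  gl_hom k p x -> gl_hom l q y -> gl_hom (k + l) (addb p q) (gl_br x y).
Proof. by case: hL => _ _ [_ h] _ _; apply: h. Qed.
Lemma glsa_anti k l p q (x y : L) : gl_hom k p x -> gl_hom l q y ->
  gl_br x y = - (sgn K p q *: gl_br y x).
Proof. by case: hL => _ _ _ h _; apply: h. Qed.
Lemma glsa_jacobi k l p q (x y z : L) : gl_hom k p x -> gl_hom l q y ->
  gl_br x (gl_br y z) = gl_br (gl_br x y) z + sgn K p q *: gl_br y (gl_br x z).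
Proof. by case: hL => _ _ _ _ h; apply: h. Qed.
(** Elements will act on [m] by brackets from the right, so the Jacobi identity is wanted as a
    Leibniz rule for the right bracket with [z]. *)
Lemma glsa_jacobi_r k l m p q r (x y z : L) :
  gl_hom k p x -> gl_hom l q y -> gl_hom m r z ->
  gl_br (gl_br x y) z = gl_br x (gl_br y z) + sgn K q r *: gl_br (gl_br x z) y.
Proof.
move=> hx hy hz; rewrite (glsa_jacobi z hx hy).
rewrite [gl_br y _](glsa_anti hy (glsa_br_hom hx hz)) scalerN scalerA.
have -> : sgn K p q * sgn K q (p (+) r) = sgn K q r.
  by rewrite /sgn -signr_addb; case: p q r {hx hy hz} => [] [] [].
by rewrite addrNK.
Qed.
End GradedTheory.

Lemma sgnC (K : fieldType) p q : sgn K p q = sgn K q p.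
Proof. by rewrite /sgn andbC. Qed.
Lemma sgnM (K : fieldType) p q : sgn K p q * sgn K p q = 1.
Proof. by rewrite /sgn -signr_addb addbb. Qed.
Lemma sgn_addl (K : fieldType) p q r : sgn K (p (+) q) r = sgn K p r * sgn K q r.
Proof. by rewrite /sgn -signr_addb; case: p q r => [] [] []. Qed.
Lemma sgn_addr (K : fieldType) p q r : sgn K r (p (+) q) = sgn K r p * sgn K r q.
Proof. by rewrite !(sgnC _ r) sgn_addl. Qed.

(* [cf] gives the coordinates of the projection to the negative part. *)
Definition NegBasis (K : fieldType) (G : gLSA K) (I : finType) (b : I -> G)
    (dg : I -> int) (pr : I -> bool) (cf : I -> G -> K) : Prop :=
  [/\ forall i, dg i < 0,
      forall i, gl_hom (dg i) (pr i) (b i),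
      forall i a x y, cf i (a *: x + y) = a * cf i x + cf i y,
      forall k p y i, gl_hom k p y -> (dg i, pr i) != (k, p) -> cf i y = 0
    & forall k p y, k < 0 -> gl_hom k p y -> y = \sum_i cf i y *: b i].

(** Negative degrees are all base cases: the guard [0 <= k] withholds the induction hypothesis
    there, and from degree 0 on the degrees are well ordered. *)
Lemma neg_ind (Q : int -> Prop) :
  (forall k, (forall l, l < k -> 0 <= k -> Q l) -> Q k) -> forall k, Q k.
Proof.
move=> h; have hneg k : k < 0 -> Q k by move=> k0; apply: h => l _ k1; lia.
have hn n : forall k, k < n%:Z -> Q k.
  elim: n => [|n IH] k kn; first exact: hneg.
  by apply: h => l lk _; apply: IH; lia.
by move=> k; apply: (hn (`|k|.+1)); lia.
Qed.

(** * Comparison of transitive algebras with the same negative part *)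

Section Embedding.
Variables (K : fieldType) (G : gLSA K) (I : finType) (b : I -> G)
  (dg : I -> int) (pr : I -> bool) (cf : I -> G -> K).
Hypothesis hG : IsGLSA G.
Hypothesis hb : NegBasis b dg pr cf.

Definition degsum (ys : seq I) : int := \sum_(i <- ys) dg i.
Definition parsum (ys : seq I) : bool := \big[addb/false]_(i <- ys) pr i.

Let dg_neg i : dg i < 0. Proof. by case: hb. Qed.
Let b_hom i : gl_hom (dg i) (pr i) (b i). Proof. by case: hb. Qed.
Let b_span k p y : k < 0 -> gl_hom k p y -> y = \sum_i cf i y *: b i.
Proof. by case: hb => _ _ _ _; apply. Qed.
Let cf0 k p y i : gl_hom k p y -> (dg i, pr i) != (k, p) -> cf i y = 0.
Proof. by case: hb => _ _ _ h _; apply: h. Qed.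

Lemma dgs_cons i ys : degsum (i :: ys) = dg i + degsum ys.
Proof. by rewrite /degsum big_cons. Qed.
Lemma prs_cons i ys : parsum (i :: ys) = pr i (+) parsum ys.
Proof. by rewrite /parsum big_cons. Qed.
Lemma dgs_nil : degsum [::] = 0. Proof. by rewrite /degsum big_nil. Qed.
Lemma prs_nil : parsum [::] = false. Proof. by rewrite /parsum big_nil. Qed.

Definition iter_act (L : gLSA K) (phi : G -> L) (x : L) (ys : seq I) : L :=
  foldl (fun x i => gl_br x (phi (b i))) x ys.

Lemma act_lin (L : gLSA K) (phi : G -> L) (hL : IsGLSA L) a x y ys :
  iter_act phi (a *: x + y) ys = a *: iter_act phi x ys + iter_act phi y ys.
Proof. by elim: ys x y => [//|i ys IH] x y /=; rewrite (glsa_brPl hL) IH. Qed.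

Lemma act0 (L : gLSA K) (phi : G -> L) (hL : IsGLSA L) ys : iter_act phi 0 ys = 0.
Proof. by elim: ys => [//|i ys IH] /=; rewrite (glsa_br0l hL) IH. Qed.

(** Equality of Taylor coefficients: every iterated bracket that lands in negative degree comes from
    one and the same element of [m]. In nonnegative degree nothing is compared directly, so the
    relation makes sense between two abstract algebras. *)
Definition Rel (L P : gLSA K) (phL : G -> L) (phP : G -> P) k p (x : L) (X : P) :=
  forall ys, k + degsum ys < 0 -> exists z : G,
    [/\ gl_hom (k + degsum ys) (p (+) parsum ys) z, iter_act phL x ys = phL z & iter_act phP X ys = phP z].

Section Relation.
Variables (L P : gLSA K) (phL : G -> L) (phP : G -> P).
Hypotheses (hL : IsGLSA L) (hP : IsGLSA P) (nL : NegIso phL) (nP : NegIso phP).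
Local Notation R := (Rel phL phP).

Lemma negiso_lin (M : gLSA K) (ph : G -> M) (nM : NegIso ph) a x y :
  ph (a *: x + y) = a *: ph x + ph y.
Proof. by case: nM. Qed.

Lemma negiso0 (M : gLSA K) (ph : G -> M) (nM : NegIso ph) : ph 0 = 0.
Proof. by have := negiso_lin nM (-1) 0 0; rewrite addr0 scaler0 scaleN1r addNr. Qed.

Lemma negisoZ (M : gLSA K) (ph : G -> M) (nM : NegIso ph) a x : ph (a *: x) = a *: ph x.
Proof. by rewrite -[a *: x]addr0 (negiso_lin nM) (negiso0 nM) addr0. Qed.

Lemma negiso_sum (M : gLSA K) (ph : G -> M) (nM : NegIso ph) (J : Type) (r : seq J) (f : J -> G) :
  ph (\sum_(j <- r) f j) = \sum_(j <- r) ph (f j).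
Proof.
apply: (big_morph ph) => [x y|]; last exact: negiso0.
by rewrite -[x]scale1r (negiso_lin nM) !scale1r.
Qed.

Lemma negiso_span (M : gLSA K) (ph : G -> M) (nM : NegIso ph) k p y :
  k < 0 -> gl_hom k p y -> ph y = \sum_i cf i y *: ph (b i).
Proof.
move=> k0 hy; rewrite {1}(b_span k0 hy) (negiso_sum nM).
by apply: eq_bigr => i _; rewrite (negisoZ nM).
Qed.

Lemma phb_hom (M : gLSA K) (ph : G -> M) (nM : NegIso ph) i : gl_hom (dg i) (pr i) (ph (b i)).
Proof. by case: nM => _ h _ _ _; apply: h. Qed.

Lemma rel_step k p x X i :
  R k p x X -> R (k + dg i) (p (+) pr i) (gl_br x (phL (b i))) (gl_br X (phP (b i))).
Proof.
move=> h ys; rewrite -addrA -dgs_cons => hd.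
by have [z] := h (i :: ys) hd; rewrite prs_cons addbA => hz; exists z.
Qed.

(** The empty word is no constraint when [0 <= k], so only the first brackets have to be matched. *)
Lemma rel_intro k p x X : 0 <= k ->
  (forall i, R (k + dg i) (p (+) pr i) (gl_br x (phL (b i))) (gl_br X (phP (b i)))) ->
  R k p x X.
Proof.
move=> k0 h [|i ys]; first by rewrite dgs_nil; lia.
rewrite dgs_cons prs_cons addrA => hd.
by have [z] := h i ys hd; rewrite -addbA => hz; exists z.
Qed.

Lemma rel_lin k p a x X y Y : R k p x X -> R k p y Y -> R k p (a *: x + y) (a *: X + Y).
Proof.
move=> hx hy ys hd; have [z [hz e1 e2]] := hx ys hd; have [t [ht e3 e4]] := hy ys hd.
exists (a *: z + t); rewrite !act_lin // e1 e2 e3 e4 (negiso_lin nL) (negiso_lin nP).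
by split=> //; apply: glsa_homP.
Qed.

Lemma rel0 k p : R k p 0 0.
Proof.
move=> ys _; exists 0; rewrite !act0 // (negiso0 nL) (negiso0 nP); split=> //.
exact: glsa_hom0.
Qed.

Lemma relZ k p a x X : R k p x X -> R k p (a *: x) (a *: X).
Proof. by move=> h; rewrite -[a *: x]addr0 -[a *: X]addr0; apply: rel_lin => //; apply: rel0. Qed.

Lemma relD k p x X y Y : R k p x X -> R k p y Y -> R k p (x + y) (X + Y).
Proof. by move=> h1 h2; rewrite -[x]scale1r -[X]scale1r; apply: rel_lin. Qed.

Lemma relN k p x X : R k p x X -> R k p (- x) (- X).
Proof. by move=> h; rewrite -!scaleN1r; apply: relZ. Qed.

Lemma rel_sum k p (J : eqType) (r : seq J) (f : J -> L) (g : J -> P) :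
  (forall j, j \in r -> R k p (f j) (g j)) ->
  R k p (\sum_(j <- r) f j) (\sum_(j <- r) g j).
Proof.
elim: r => [|j r IH] h; first by rewrite !big_nil; apply: rel0.
rewrite !big_cons; apply: relD; first by apply: h; rewrite mem_head.
by apply: IH => i ir; apply: h; rewrite inE ir orbT.
Qed.

Lemma rel_neg k p z : k < 0 -> gl_hom k p z -> R k p (phL z) (phP z).
Proof.
move=> k0 hz ys hd; elim: ys k p z k0 hz hd => [|i ys IH] k p z k0 hz hd.
  by exists z; rewrite dgs_nil prs_nil addr0 addbF.
have hzi : gl_hom (k + dg i) (p (+) pr i) (gl_br z (b i)) by apply: glsa_br_hom.
have h2 : k + dg i < 0 by have := dg_neg i; lia.
have [|t] := IH _ _ _ h2 hzi; first by rewrite -addrA -dgs_cons.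
rewrite -addrA -addbA -dgs_cons -prs_cons => -[ht e1 e2]; exists t.
case: nL => _ _ _ _ bL; case: nP => _ _ _ _ bP.
by rewrite /= -(bL _ _ _ _ _ _ k0 (dg_neg i) hz (b_hom i)) -(bP _ _ _ _ _ _ k0 (dg_neg i) hz (b_hom i)).
Qed.

Lemma rel_negE k p x X : k < 0 -> R k p x X ->
  exists z, [/\ gl_hom k p z, x = phL z & X = phP z].
Proof. by move=> k0 /(_ [::]); rewrite dgs_nil prs_nil addr0 addbF; apply. Qed.

(** Negative degree is the injectivity of [phL]. In degree at least 0 transitivity leaves only
    brackets with degree -1; these are combinations of brackets with the [b i], which are again
    related to 0 and have lower degree. *)
Lemma rel_injP (tP : Transitive P) k p X : gl_hom k p X -> R k p 0 X -> X = 0.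
Proof.
elim/neg_ind: k p X => k IH p X hX r0.
have [k0|k0] := ltP k 0.
  have [z [hz e1 ->]] := rel_negE k0 r0.
  case: nL => _ _ _ inj _; rewrite (inj _ _ _ k0 hz) //; exact: negiso0.
apply: (tP k p) => // q y hy; case: (nP) => _ _ sur _ _.
have [|y' [hy' <-]] := sur _ _ _ _ hy; first by [].
rewrite (negiso_span nP _ hy') // (glsa_br_sumr hP) big1 // => i _.
rewrite (glsa_brZr hP); have [e|ne] := eqVneq (dg i, pr i) (-1, q); last first.
  by rewrite (cf0 hy' ne) scale0r.
rewrite (IH (k + dg i) _ k0 (p (+) pr i) (gl_br X (phP (b i)))) ?scaler0 //.
- by have := dg_neg i; lia.
- by apply: (glsa_br_hom hP) => //; apply: phb_hom.
- by have := rel_step (i := i) r0; rewrite (glsa_br0l hL).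
Qed.
End Relation.

Lemma relC (L P : gLSA K) (phL : G -> L) (phP : G -> P) k p x X :
  Rel phL phP k p x X -> Rel phP phL k p X x.
Proof. by move=> h ys /h [z [h1 h2 h3]]; exists z. Qed.

Section RelationUniqueness.
Variables (L P : gLSA K) (phL : G -> L) (phP : G -> P).
Hypotheses (hL : IsGLSA L) (hP : IsGLSA P) (nL : NegIso phL) (nP : NegIso phP).
Hypotheses (tL : Transitive L) (tP : Transitive P).
Local Notation R := (Rel phL phP).

Lemma rel_uniq k p x X X' : gl_hom k p X -> gl_hom k p X' ->
  R k p x X -> R k p x X' -> X = X'.
Proof.
move=> h h' r r'; apply/eqP; rewrite -subr_eq0; apply/eqP.
apply: (@rel_injP L P phL phP hL hP nL nP tP k p).
  by apply: glsa_homD => //; apply: glsa_homN.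
by rewrite -[0](subrr x); apply: relD => //; apply: relN.
Qed.

Lemma rel_br_neg k l p q x X z : l < 0 -> gl_hom l q z -> R k p x X ->
  R (k + l) (p (+) q) (gl_br x (phL z)) (gl_br X (phP z)).
Proof.
move=> l0 hz rx; rewrite (negiso_span nL l0 hz) (negiso_span nP l0 hz).
rewrite (glsa_br_sumr hL) (glsa_br_sumr hP); apply: rel_sum => // i _.
rewrite (glsa_brZr hL) (glsa_brZr hP); have [[<- <-]|ne] := eqVneq (dg i, pr i) (l, q).
  by apply: relZ => //; apply: rel_step.
by rewrite (cf0 hz ne) !scale0r; apply: rel0.
Qed.

(** The empty word is compared only when [k + l < 0], and then one of the two factors lies in [m].
    Longer words are shortened with the Leibniz rule. *)
Lemma rel_br k l p q x X y Y :
  gl_hom k p x -> gl_hom k p X -> gl_hom l q y -> gl_hom l q Y ->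
  R k p x X -> R l q y Y -> R (k + l) (p (+) q) (gl_br x y) (gl_br X Y).
Proof.
move=> hx hX hy hY rx ry ys; elim: ys k l p q x X y Y hx hX hy hY rx ry
  => [|i ys IH] k l p q x X y Y hx hX hy hY rx ry hd.
  rewrite dgs_nil prs_nil addr0 addbF in hd *.
  have [l0|l0] := ltP l 0.
    have [z [hz -> ->]] := rel_negE l0 ry.
    by apply: (rel_negE hd); apply: rel_br_neg.
  have k0 : k < 0 by lia.
  rewrite (glsa_anti hL hx hy) (glsa_anti hP hX hY).
  have [z [hz -> ->]] := rel_negE k0 rx.
  apply: (rel_negE hd); apply: relN => //; apply: relZ => //.
  by rewrite addrC addbC; apply: rel_br_neg.
rewrite dgs_cons prs_cons /=.
have hbL := phb_hom nL i; have hbP := phb_hom nP i.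
rewrite (glsa_jacobi_r hL hx hy hbL) (glsa_jacobi_r hP hX hY hbP).
have hd1 : k + (l + dg i) + degsum ys < 0 by move: hd; rewrite dgs_cons; lia.
have hd2 : (k + dg i) + l + degsum ys < 0 by lia.
have [z1 [h1 e1 e1']] := IH _ _ _ _ _ _ _ _ hx hX (glsa_br_hom hL hy hbL)
  (glsa_br_hom hP hY hbP) rx (rel_step (i := i) ry) hd1.
have [z2 [h2 e2 e2']] := IH _ _ _ _ _ _ _ _ (glsa_br_hom hL hx hbL)
  (glsa_br_hom hP hX hbP) hy hY (rel_step (i := i) rx) ry hd2.
exists (sgn K q (pr i) *: z2 + z1).
rewrite !(addrC (gl_br _ (gl_br _ _))) !act_lin // e1 e2 e1' e2'.
rewrite (negiso_lin nL) (negiso_lin nP); split=> //.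
have -> : k + l + (dg i + degsum ys) = k + (l + dg i) + degsum ys by lia.
have -> : (p (+) q) (+) (pr i (+) parsum ys) = (p (+) (q (+) pr i)) (+) parsum ys.
  by rewrite !addbA.
apply: (glsa_homP hG) => //.
have -> : k + (l + dg i) + degsum ys = k + dg i + l + degsum ys by lia.
by rewrite (_ : p (+) (q (+) pr i) = (p (+) pr i) (+) q) // -addbA (addbC q).
Qed.

Definition RelList (s : seq (int * bool * (L * P))) : Prop :=
  forall t, t \in s -> [/\ gl_hom t.1.1 t.1.2 t.2.1, gl_hom t.1.1 t.1.2 t.2.2 &
                          R t.1.1 t.1.2 t.2.1 t.2.2].

(** Independence of homogeneous components requires distinct bidegrees, while adding related pairs
    concatenates lists that may share some; terms of equal bidegree are collected here. *)
Lemma rellist_merge s : RelList s -> exists s', [/\ RelList s', uniq (map fst s'),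
  \sum_(t <- s') t.2.1 = \sum_(t <- s) t.2.1 & \sum_(t <- s') t.2.2 = \sum_(t <- s) t.2.2].
Proof.
move=> hs; pose ks := undup (map fst s).
pose mk k := (k, (\sum_(t <- s | t.1 == k) t.2.1, \sum_(t <- s | t.1 == k) t.2.2)).
exists (map mk ks); split.
- move=> _ /mapP[[k p] _ ->] /=.
  elim: s {ks mk} hs => [|t s IH] hs.
    by rewrite !big_nil; split; [exact: glsa_hom0|exact: glsa_hom0|exact: rel0].
  have [] := IH; first by move=> u us; apply: hs; rewrite inE us orbT.
  rewrite !big_cons; case: eqP => // e h1 h2 h3.
  have := hs t; rewrite mem_head e => -[] // h4 h5 h6.
  by split; [exact: glsa_homD|exact: glsa_homD|exact: relD].
- by rewrite -map_comp map_id_in // undup_uniq.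
- rewrite big_map /= (exchange_big_dep predT) //= [LHS]big_seq [RHS]big_seq.
  apply: eq_bigr => t ts; rewrite -big_filter (@eq_filter _ _ (pred1 t.1)); last first.
    by move=> k /=; rewrite eq_sym.
  by rewrite filter_pred1_uniq ?undup_uniq // ?mem_undup ?map_f // big_seq1.
- rewrite big_map /= (exchange_big_dep predT) //= [LHS]big_seq [RHS]big_seq.
  apply: eq_bigr => t ts; rewrite -big_filter (@eq_filter _ _ (pred1 t.1)); last first.
    by move=> k /=; rewrite eq_sym.
  by rewrite filter_pred1_uniq ?undup_uniq // ?mem_undup ?map_f // big_seq1.
Qed.

Definition RelG x X := exists s, [/\ RelList s, \sum_(t <- s) t.2.1 = x & \sum_(t <- s) t.2.2 = X].

(** One direction makes the relation single-valued, the other makes the resulting map injective.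
    Each uses transitivity of the algebra in which the element has to vanish. *)
Lemma relG_inj x X : RelG x X -> (x == 0) = (X == 0).
Proof.
move=> [s [/rellist_merge [s' [hs' us e1 e2]]]]; rewrite -e1 -e2 => <- <- {s e1 e2}.
have red (M : gLSA K) (f : L * P -> M) : IsGLSA M ->
    (forall t, t \in s' -> gl_hom t.1.1 t.1.2 (f t.2)) ->
    \sum_(t <- s') f t.2 = 0 -> forall t, t \in s' -> f t.2 = 0.
  move=> hM hf s0 t ts.
  apply: (@glsa_indep _ M hM [seq (t.1, f t.2) | t <- s'] _ _ _ (t.1, f t.2)).
  - by rewrite -map_comp (eq_map (_ : _ =1 fst)).
  - by move=> _ /mapP[u us' ->] /=; apply: hf.
  - by rewrite big_map.
  - by apply/mapP; exists t.
apply/eqP/eqP => e.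
  rewrite big_seq big1 // => t ts; have [h1 h2 h3] := hs' t ts.
  apply: (@rel_injP L P phL phP hL hP nL nP tP _ _ _ h2).
  suff <- : t.2.1 = 0 by [].
  by apply: (@red L fst) => // u /hs' [].
rewrite big_seq big1 // => t ts; have [h1 h2 h3] := hs' t ts.
apply: (@rel_injP P L phP phL hP hL nP nL tL _ _ _ h1); apply: relC.
suff <- : t.2.2 = 0 by [].
by apply: (@red P snd) => // u /hs' [].
Qed.

Lemma relG_lin a x X y Y : RelG x X -> RelG y Y -> RelG (a *: x + y) (a *: X + Y).
Proof.
move=> [s [hs <- <-]] [u [hu <- <-]].
exists ([seq (t.1, (a *: t.2.1, a *: t.2.2)) | t <- s] ++ u); split.
- move=> t; rewrite mem_cat => /orP[/mapP[v /hs [h1 h2 h3] ->]|/hu //] /=.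
  by split; [exact: glsa_homZ|exact: glsa_homZ|exact: relZ].
- by rewrite big_cat big_map /= scaler_sumr.
- by rewrite big_cat big_map /= scaler_sumr.
Qed.

Lemma relG_uniq x X X' : RelG x X -> RelG x X' -> X = X'.
Proof.
move=> h1 h2; have := relG_inj (relG_lin (-1) h1 h2).
by rewrite !scaleN1r addNr eqxx addrC subr_eq0 => /esym /eqP.
Qed.

Lemma relG_br x X y Y : RelG x X -> RelG y Y -> RelG (gl_br x y) (gl_br X Y).
Proof.
move=> [s [hs <- <-]] [u [hu <- <-]].
exists [seq (t.1.1 + v.1.1, t.1.2 (+) v.1.2, (gl_br t.2.1 v.2.1, gl_br t.2.2 v.2.2))
   | t <- s, v <- u]; split.
- move=> _ /allpairsP[[t v] /= [/hs [h1 h2 h3] /hu [h4 h5 h6] ->]] /=.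
  by split; [exact: glsa_br_hom|exact: glsa_br_hom|exact: rel_br].
- rewrite big_allpairs_dep /= (glsa_br_suml hL); apply: eq_bigr => t _.
  by rewrite (glsa_br_sumr hL).
- rewrite big_allpairs_dep /= (glsa_br_suml hP); apply: eq_bigr => t _.
  by rewrite (glsa_br_sumr hP).
Qed.

(** Totality on homogeneous elements is all that the relation still lacks. Linearity, brackets,
    injectivity and compatibility hold because [RelG] is single-valued and closed under the
    operations. *)
Lemma embed_of_rel :
  (forall k p x, gl_hom k p x -> exists X, gl_hom k p X /\ R k p x X) ->
  exists psi : L -> P, Embed psi /\ Compat phL phP psi.
Proof.
move=> hex; have relG1 k p x X : gl_hom k p x -> gl_hom k p X -> R k p x X -> RelG x X.
  move=> h1 h2 h3; exists [:: (k, p, (x, X))]; rewrite !big_seq1; split=> // t.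
  by rewrite inE => /eqP ->.
have tot x : exists X, RelG x X.
  have [s [hs ->]] := glsa_decomp hL x; elim: s hs => [|t s IH] hs.
    by exists 0, [::]; rewrite !big_nil; split.
  have [|X rX] := IH; first by move=> u us; apply: hs; rewrite inE us orbT.
  have ht := hs _ (mem_head _ _); have [Y [hY rY]] := hex _ _ _ ht.
  exists (1 *: Y + X); rewrite big_cons -[t.2]scale1r; apply: relG_lin => //.
  exact: relG1 rY.
pose psi x := projT1 (cid (tot x)).
have psiP x : RelG x (psi x) by rewrite /psi; case: cid.
exists psi; split; last first.
  move=> k p x k0 hx; apply: (relG_uniq (psiP _)).
  case: (nL) => _ h1 _ _ _; case: (nP) => _ h2 _ _ _.
  by apply: (relG1 k p); [exact: h1|exact: h2|exact: rel_neg].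
split.
- by move=> a x y; apply: (relG_uniq (psiP _)); apply: relG_lin.
- move=> k p x hx; have [X [hX rX]] := hex _ _ _ hx.
  by rewrite (relG_uniq (psiP x) (relG1 _ _ _ _ hx hX rX)).
- by move=> x /eqP; rewrite -(relG_inj (psiP x)) => /eqP.
- by move=> x y; apply: (relG_uniq (psiP _)); apply: relG_br.
Qed.
End RelationUniqueness.

(** Vanishing of [H^1(m, G)] in degree [d]. [Z] lists the values of a cochain on the basis of [m],
    and the cocycle condition has [[b i, b j]] expanded in that basis. *)
Definition DerInner (d : int) : Prop := forall p (Z : I -> G),
  (forall i, gl_hom (d + dg i) (p (+) pr i) (Z i)) ->
  (forall i j, \sum_l cf l (gl_br (b i) (b j)) *: Z l =
     gl_br (Z i) (b j) + sgn K p (pr i) *: gl_br (b i) (Z j)) ->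
  exists X, gl_hom d p X /\ forall i, Z i = gl_br X (b i).

Lemma negiso_id : @NegIso K G G id.
Proof. by split=> // k p y _ hy; exists y. Qed.

Section Maximal.
Hypothesis tG : Transitive G.
Variables (L : gLSA K) (phL : G -> L).
Hypotheses (hL : IsGLSA L) (nL : NegIso phL) (tL : Transitive L).

Lemma rel_of_inner k p x : 0 <= k -> DerInner k -> gl_hom k p x ->
  (forall i, exists X, gl_hom (k + dg i) (p (+) pr i) X /\
     Rel phL id (k + dg i) (p (+) pr i) (gl_br x (phL (b i))) X) ->
  exists X, gl_hom k p X /\ Rel phL id k p x X.
Proof.
move=> k0 inner hx hex; have nG := negiso_id.
pose Z i := projT1 (cid (hex i)).
have hZ i : gl_hom (k + dg i) (p (+) pr i) (Z i) by rewrite /Z; case: cid => ? [].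
have rZ i : Rel phL id (k + dg i) (p (+) pr i) (gl_br x (phL (b i))) (Z i).
  by rewrite /Z; case: cid => ? [].
have [X [hX eX]] : exists X, gl_hom k p X /\ forall i, Z i = gl_br X (b i).
  apply: inner => // i j.
  have hbi := phb_hom nL i; have hbj := phb_hom nL j.
  have hij : gl_hom (dg i + dg j) (pr i (+) pr j) (gl_br (b i) (b j)) by apply: glsa_br_hom.
  have neg : dg i + dg j < 0 by have := dg_neg i; have := dg_neg j; lia.
  have eS : k + dg i + dg j = k + (dg i + dg j) by lia.
  have eS' : dg i + (k + dg j) = k + (dg i + dg j) by lia.
  have eT : (p (+) pr i) (+) pr j = p (+) (pr i (+) pr j) by rewrite addbA.
  have eT' : pr i (+) (p (+) pr j) = p (+) (pr i (+) pr j) by rewrite addbCA.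
  (* Both sides of the cocycle identity are partners of the single element [[x, [b i, b j]]] of [L]:
     the left side by linearity, the right side by the Jacobi identity in [L]. Partners in [G] are
     unique. *)
  apply: (@rel_uniq L G phL id hL hG nL nG tG (k + (dg i + dg j)) (p (+) (pr i (+) pr j))
    (gl_br x (phL (gl_br (b i) (b j))))).
  - apply: glsa_hom_sum => // l _; have [[<- <-]|ne] := eqVneq (dg l, pr l) (dg i + dg j, pr i (+) pr j).
      exact: glsa_homZ.
    by rewrite (cf0 hij ne) scale0r; apply: glsa_hom0.
  - apply: glsa_homD => //; first by rewrite -eS -eT; apply: glsa_br_hom.
    by apply: glsa_homZ => //; rewrite -eS' -eT'; apply: glsa_br_hom.
  - rewrite (negiso_span nL neg hij) (glsa_br_sumr hL); apply: rel_sum => // l _.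
    rewrite (glsa_brZr hL).
    have [[<- <-]|ne] := eqVneq (dg l, pr l) (dg i + dg j, pr i (+) pr j).
      exact: relZ.
    by rewrite (cf0 hij ne) !scale0r; apply: rel0.
  - have -> : phL (gl_br (b i) (b j)) = gl_br (phL (b i)) (phL (b j)).
      by case: (nL) => _ _ _ _ h; apply: (h _ _ _ _ _ _ (dg_neg i) (dg_neg j)).
    rewrite (glsa_jacobi hL _ hx hbi); apply: relD => //.
      by rewrite -eS -eT; apply: rel_step.
    apply: relZ => //; rewrite -eS' -eT'.
    apply: rel_br => //; first exact: (glsa_br_hom hL).
    by apply: rel_neg.
exists X; split=> //; apply: rel_intro => // i; rewrite -eX; exact: rZ.
Qed.
End Maximal.

Lemma IsPr_of_inner : Transitive G -> (forall d, 0 <= d -> DerInner d) -> @IsPr K G G id.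
Proof.
move=> tG inner; have nG := negiso_id; split=> // L phL hL tL nL.
apply: embed_of_rel => //; elim/neg_ind => k IH p x hx.
have [k0|k0] := ltP k 0.
  case: (nL) => _ _ sur _ _; have [z [hz <-]] := sur _ _ _ k0 hx.
  by exists z; split=> //; apply: rel_neg.
apply: rel_of_inner => //; first exact: inner.
move=> i; apply: IH => //; first by have := dg_neg i; lia.
by apply: glsa_br_hom => //; apply: phb_hom.
Qed.

Lemma IsPr0_of_inner : Transitive G -> (forall d, 0 < d -> DerInner d) -> @IsPr0 K G G id.
Proof.
move=> tG inner; have nG := negiso_id; split=> //.
  by split=> p y hy; exists y.
move=> L phL hL tL nL [d0 _].
apply: embed_of_rel => //; elim/neg_ind => k IH p x hx.
have [k0|k0] := ltP k 0.
  case: (nL) => _ _ sur _ _; have [z [hz <-]] := sur _ _ _ k0 hx.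
  by exists z; split=> //; apply: rel_neg.
(* In degree 0 [Deg0] supplies the partner, so cohomology enters only from degree 1 on. *)
have [e|k1] := eqVneq k 0.
  subst k; have [z [hz ez]] := d0 _ _ hx; exists z; split=> //; apply: rel_intro => // i.
  rewrite (ez _ _ _ (dg_neg i) (b_hom i)); apply: rel_neg => //.
    by rewrite add0r.
  exact: glsa_br_hom.
apply: rel_of_inner => //; first by apply: inner; lia.
move=> i; apply: IH => //; first by have := dg_neg i; lia.
by apply: glsa_br_hom => //; apply: phb_hom.
Qed.
End Embedding.

(** * The prolongation as an algebra of iterated brackets *)

Section Submodule.
Variables (K : fieldType) (V : lmodType K) (S : V -> Prop).
Hypotheses (S0 : S 0) (Slin : forall a x y, S x -> S y -> S (a *: x + y)).

(* The closure proofs are arguments so that the canonical structure can use them. *)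
Definition submod_pred of S 0 & (forall a x y, S x -> S y -> S (a *: x + y)) : {pred V} :=
  fun x => `[< S x >].

Fact submod_pred_closed : submod_closed (submod_pred S0 Slin).
Proof.
split=> [|a x y]; first exact/asboolP.
by rewrite /submod_pred !unfold_in => /asboolP hx /asboolP hy; apply/asboolP; apply: Slin.
Qed.
HB.instance Definition _ :=
  GRing.isSubmodClosed.Build K V (submod_pred S0 Slin) submod_pred_closed.

Definition submod := {x | x \in submod_pred S0 Slin}.
HB.instance Definition _ := SubChoice.on submod.
HB.instance Definition _ := [SubChoice_isSubLmodule of submod by <:].

Lemma submodP (x : submod) : S (val x).
Proof. by have := valP x; rewrite unfold_in => /asboolP. Qed.
Lemma submod_mem x : S x -> x \in submod_pred S0 Slin.
Proof. by move=> h; apply/asboolP. Qed.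
Definition Submod x (Sx : S x) : submod := exist _ x (submod_mem Sx).
End Submodule.

Section Prolongation.
Variables (K : fieldType) (G : gLSA K) (I : finType) (b : I -> G)
  (dg : I -> int) (pr : I -> bool) (cf : I -> G -> K).

Local Ltac lmod := lmod_with K (gl_V G).
Local Notation dgs := (degsum dg).
Local Notation prs := (parsum pr).
Local Notation sgn := (sgn K).

Definition sh (F : seq I -> G) (i : I) : seq I -> G := fun ys => F (i :: ys).

Definition app (F : seq I -> G) (y : G) : G := \sum_i cf i y *: F [:: i].

(** The properties of the iterated brackets of an element of degree [k] with the letters of a word,
    truncated to [m]. The third says that these are ordinary brackets once [m] has been entered, the
    last that [F] factors through the enveloping algebra of [m]. *)
Definition homE (k : int) (p : bool) (F : seq I -> G) : Prop := forall ys,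
  [/\ gl_hom (k + dgs ys) (p (+) prs ys) (F ys),
      0 <= k + dgs ys -> F ys = 0,
      k + dgs ys < 0 -> forall i, F (rcons ys i) = gl_br (F ys) (b i)
    & forall i j zs, F (ys ++ i :: j :: zs) - sgn (pr i) (pr j) *: F (ys ++ j :: i :: zs)
        = \sum_l cf l (gl_br (b i) (b j)) *: F (ys ++ l :: zs)].

(** Letters are distributed over the two factors by the Leibniz rule. At the empty word the first
    term is the bracket if [F'] lies in [m] and the second if [F] does; when both do, it has been
    counted twice and is subtracted once. *)
Fixpoint brE (p q : bool) (F F' : seq I -> G) (ys : seq I) : G :=
  if ys is i :: zs then
    brE p (q (+) pr i) F (sh F' i) zs + sgn q (pr i) *: brE (p (+) pr i) q (sh F i) F' zs
  else app F (F' [::]) - sgn p q *: app F' (F [::]) - gl_br (F [::]) (F' [::]).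

Hypothesis hG : IsGLSA G.
Hypothesis hb : NegBasis b dg pr cf.

Let dg_neg i : dg i < 0. Proof. by case: hb. Qed.
Let b_hom i : gl_hom (dg i) (pr i) (b i). Proof. by case: hb. Qed.
Let b_span k p y : k < 0 -> gl_hom k p y -> y = \sum_i cf i y *: b i.
Proof. by case: hb => _ _ _ _; apply. Qed.
Let cf0 k p y i : gl_hom k p y -> (dg i, pr i) != (k, p) -> cf i y = 0.
Proof. by case: hb => _ _ _ h _; apply: h. Qed.
Let cfP i a x y : cf i (a *: x + y) = a * cf i x + cf i y.
Proof. by case: hb. Qed.

Lemma cf_zero i : cf i 0 = 0.
Proof. by have := cfP i (-1) 0 0; rewrite scaler0 addr0 mulN1r addNr. Qed.
Lemma cf_sum i (J : Type) (r : seq J) (c : J -> K) (f : J -> G) :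
  cf i (\sum_(j <- r) c j *: f j) = \sum_(j <- r) c j * cf i (f j).
Proof.
elim: r => [|j r IH]; first by rewrite !big_nil cf_zero.
by rewrite !big_cons cfP IH.
Qed.

Lemma app_linl a F F' y : app (fun ys => a *: F ys + F' ys) y = a *: app F y + app F' y.
Proof.
rewrite /app scaler_sumr -big_split; apply: eq_bigr => i _ /=.
by rewrite scalerDr !scalerA mulrC.
Qed.
Lemma app_linr a F y z : app F (a *: y + z) = a *: app F y + app F z.
Proof.
rewrite /app scaler_sumr -big_split; apply: eq_bigr => i _ /=.
by rewrite cfP scalerDl scalerA.
Qed.

Lemma brE_linl p q a F F1 F' ys :
  brE p q (fun ys => a *: F ys + F1 ys) F' ys = a *: brE p q F F' ys + brE p q F1 F' ys.
Proof.
elim: ys p q F F1 F' => [|i ys IH] p q F F1 F' /=.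
  by rewrite app_linl app_linr (glsa_brPl hG); lmod.
have -> : sh (fun ys => a *: F ys + F1 ys) i = (fun ys => a *: sh F i ys + sh F1 i ys) by [].
by rewrite !IH; lmod.
Qed.

Lemma brE_linr p q a F F' F1 ys :
  brE p q F (fun ys => a *: F' ys + F1 ys) ys = a *: brE p q F F' ys + brE p q F F1 ys.
Proof.
elim: ys p q F F1 F' => [|i ys IH] p q F F1 F' /=.
  by rewrite app_linl app_linr (glsa_brPr hG); lmod.
have -> : sh (fun ys => a *: F' ys + F1 ys) i = (fun ys => a *: sh F' i ys + sh F1 i ys) by [].
by rewrite !IH; lmod.
Qed.

Lemma brE0l p q F' ys : brE p q (fun _ => 0) F' ys = 0.
Proof.
apply: (addrI (brE p q (fun _ => 0) F' ys)); rewrite addr0 -{2}[brE p q (fun _ => 0) F' ys]scale1r.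
rewrite addrC -brE_linl; congr brE; apply/funext => zs.
by rewrite scaler0 addr0.
Qed.
Lemma brE0r p q F ys : brE p q F (fun _ => 0) ys = 0.
Proof.
apply: (addrI (brE p q F (fun _ => 0) ys)); rewrite addr0 -{2}[brE p q F (fun _ => 0) ys]scale1r.
rewrite addrC -brE_linr; congr brE; apply/funext => zs.
by rewrite scaler0 addr0.
Qed.

Lemma brE_suml p q (J : Type) (r : seq J) (c : J -> K) (F : J -> seq I -> G) F' ys :
  brE p q (fun ys => \sum_(j <- r) c j *: F j ys) F' ys =
  \sum_(j <- r) c j *: brE p q (F j) F' ys.
Proof.
elim: r => [|j r IH].
  by rewrite big_nil -[RHS](brE0l p q F' ys); congr brE; apply/funext => zs; rewrite big_nil.
rewrite big_cons -IH -brE_linl; congr brE; apply/funext => zs; by rewrite big_cons.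
Qed.
Lemma brE_sumr p q (J : Type) (r : seq J) (c : J -> K) F (F' : J -> seq I -> G) ys :
  brE p q F (fun ys => \sum_(j <- r) c j *: F' j ys) ys =
  \sum_(j <- r) c j *: brE p q F (F' j) ys.
Proof.
elim: r => [|j r IH].
  by rewrite big_nil -[RHS](brE0r p q F ys); congr brE; apply/funext => zs; rewrite big_nil.
rewrite big_cons -IH -brE_linr; congr brE; apply/funext => zs; by rewrite big_cons.
Qed.

Lemma brEZl p q a F F' ys : brE p q (fun ys => a *: F ys) F' ys = a *: brE p q F F' ys.
Proof.
have := brE_suml p q [:: tt] (fun=> a) (fun=> F) F' ys; rewrite big_seq1 => <-.
by congr brE; apply/funext => zs; rewrite big_seq1.
Qed.
Lemma brEZr p q a F F' ys : brE p q F (fun ys => a *: F' ys) ys = a *: brE p q F F' ys.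
Proof.
have := brE_sumr p q [:: tt] (fun=> a) F (fun=> F') ys; rewrite big_seq1 => <-.
by congr brE; apply/funext => zs; rewrite big_seq1.
Qed.

Lemma homE_sh k p F i : homE k p F -> homE (k + dg i) (p (+) pr i) (sh F i).
Proof.
move=> h ys; have [] := h (i :: ys); rewrite dgs_cons prs_cons addrA addbA => h1 h2 h3 h4.
by split.
Qed.
Lemma homE_hom k p F : homE k p F -> gl_hom k p (F [::]).
Proof. by move=> /(_ [::]) []; rewrite dgs_nil prs_nil addr0 addbF. Qed.
Lemma homE_ge0 k p F : homE k p F -> 0 <= k -> F [::] = 0.
Proof. by move=> /(_ [::]) [_]; rewrite dgs_nil addr0. Qed.

Lemma homE_lin k p a F F' : homE k p F -> homE k p F' ->
  homE k p (fun ys => a *: F ys + F' ys).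
Proof.
move=> hF hF' ys; have [h1 h2 h3 h4] := hF ys; have [h1' h2' h3' h4'] := hF' ys; split.
- exact: glsa_homP.
- by move=> d; rewrite h2 // h2' // scaler0 addr0.
- by move=> d i; rewrite h3 // h3' // (glsa_brPl hG).
- move=> i j zs; rewrite scalerDr opprD addrACA h4' scalerA mulrC -scalerA -scalerBr h4.
  rewrite scaler_sumr -big_split; apply: eq_bigr => l _ /=.
  by rewrite scalerDr !scalerA mulrC.
Qed.
Lemma homE0 k p : homE k p (fun=> 0).
Proof.
move=> ys; split=> //; first exact: glsa_hom0.
- by move=> _ i; rewrite (glsa_br0l hG).
- by move=> i j zs; rewrite scaler0 subr0 big1 // => l _; rewrite scaler0.
Qed.
Lemma app_hom k l p q F y : homE k p F -> gl_hom l q y -> gl_hom (k + l) (p (+) q) (app F y).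
Proof.
move=> hF hy; apply: (glsa_hom_sum hG) => i _.
have [[<- <-]|ne] := eqVneq (dg i, pr i) (l, q).
  by apply: (glsa_homZ hG); apply: homE_hom (homE_sh i hF).
by rewrite (cf0 hy ne) scale0r; apply: glsa_hom0.
Qed.
Lemma app_ge0 k l p q F y : homE k p F -> gl_hom l q y -> 0 <= k + l -> app F y = 0.
Proof.
move=> hF hy kl; apply: big1 => i _; have [[e _]|ne] := eqVneq (dg i, pr i) (l, q).
  by rewrite -[F [:: i]]/(sh F i [::]) (homE_ge0 (homE_sh i hF)) ?scaler0 // e.
by rewrite (cf0 hy ne) scale0r.
Qed.

Lemma brE_hom k l p q F F' ys : homE k p F -> homE l q F' ->
  gl_hom (k + l + dgs ys) (p (+) q (+) prs ys) (brE p q F F' ys).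
Proof.
elim: ys k l p q F F' => [|i ys IH] k l p q F F' hF hF' /=.
  have h1 := homE_hom hF; have h2 := homE_hom hF'.
  rewrite dgs_nil prs_nil addr0 addbF; apply: (glsa_homD hG); last first.
    by apply: (glsa_homN hG); apply: glsa_br_hom.
  apply: (glsa_homD hG); first exact: app_hom.
  apply: (glsa_homN hG); apply: (glsa_homZ hG); rewrite addrC addbC; exact: app_hom.
rewrite dgs_cons prs_cons; apply: (glsa_homD hG).
  have := IH _ _ _ _ _ _ hF (homE_sh i hF').
  by rewrite !addrA !addbA.
apply: (glsa_homZ hG); have := IH _ _ _ _ _ _ (homE_sh i hF) hF'.
have -> : k + dg i + l + dgs ys = k + l + (dg i + dgs ys) by lia.
by rewrite -!addbA (addbCA (pr i)).
Qed.

Lemma brE_ge0 k l p q F F' ys : homE k p F -> homE l q F' ->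
  0 <= k + l + dgs ys -> brE p q F F' ys = 0.
Proof.
elim: ys k l p q F F' => [|i ys IH] k l p q F F' hF hF' /=.
  have h1 := homE_hom hF; have h2 := homE_hom hF'.
  rewrite dgs_nil addr0 => d.
  rewrite (app_ge0 hF h2) // (app_ge0 hF' h1); last by rewrite addrC.
  rewrite scaler0 subr0 sub0r; have [k0|k0] := ltP k 0.
    by rewrite (homE_ge0 hF') ?(glsa_br0r hG) ?oppr0 //; lia.
  by rewrite (homE_ge0 hF) ?(glsa_br0l hG) ?oppr0.
rewrite dgs_cons => d.
rewrite (IH _ _ _ _ _ _ hF (homE_sh i hF')); last by lia.
by rewrite (IH _ _ _ _ _ _ (homE_sh i hF) hF') ?scaler0 ?addr0 //; lia.
Qed.

(** The commutation relation of [F] exchanges a letter of the factor in [m] with the first letter of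
    the word, and the correction [[b m, b i]] is the bracket of that factor with [b i]. Every
    identity with a factor in [m] thereby becomes one about shifts. *)
Lemma brE_negr k l p q F F' ys : l < 0 -> homE k p F -> homE l q F' ->
  brE p q F F' ys = \sum_i cf i (F' [::]) *: F (i :: ys).
Proof.
elim: ys k l p q F F' => [|i ys IH] k l p q F F' l0 hF hF' /=.
  have h1 := homE_hom hF; have h2 := homE_hom hF'.
  rewrite -/(app F (F' [::])) -addrA -opprD; apply/eqP; rewrite -subr_eq0 addrAC subrr add0r oppr_eq0.
  rewrite [gl_br _ _](glsa_anti hG h1 h2).
  have e i : F' [:: i] = gl_br (F' [::]) (b i).
    by have [_ _ h _] := hF' [::]; rewrite -h // dgs_nil addr0.
  have [k0|k0] := ltP k 0; last first.
    rewrite (homE_ge0 hF k0) (glsa_br0r hG) scaler0 oppr0 addr0 /app big1 ?scaler0 //.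
    by move=> j _; rewrite cf_zero scale0r.
  rewrite {2}(b_span k0 h1) (glsa_br_sumr hG) subr_eq0; apply/eqP; congr (_ *: _).
  by apply: eq_bigr => j _; rewrite e (glsa_brZr hG).
have l1 : l + dg i < 0 by have := dg_neg i; lia.
have h2 := homE_hom hF'.
rewrite (IH _ _ _ _ _ _ l1 hF (homE_sh i hF')) (IH _ _ _ _ _ _ l0 (homE_sh i hF) hF').
have -> : sh F' i [::] = gl_br (F' [::]) (b i).
  by have [_ _ h _] := hF' [::]; rewrite -h // dgs_nil addr0.
have ecf j : cf j (gl_br (F' [::]) (b i)) =
    \sum_m cf m (F' [::]) * cf j (gl_br (b m) (b i)).
  rewrite {1}(b_span l0 h2) (glsa_br_suml hG).
  by under eq_bigr => m _ do rewrite (glsa_brZl hG); rewrite cf_sum.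
under [X in X + _ = _]eq_bigr => j _ do rewrite ecf scaler_suml.
rewrite exchange_big scaler_sumr -big_split; apply: eq_bigr => m _ /=.
have [[_ <-]|ne] := eqVneq (dg m, pr m) (l, q); last first.
  by rewrite (cf0 h2 ne) !scale0r scaler0 addr0 big1 // => j _; rewrite mul0r scale0r.
under eq_bigr => j _ do rewrite -scalerA.
have [_ _ _ h4] := hF [::].
rewrite -scaler_sumr -(h4 m i ys) /= scalerBr /sh !scalerA [sgn _ _ * _]mulrC.
by rewrite subrK.
Qed.

Lemma brE_anti k l p q F F' ys : homE k p F -> homE l q F' ->
  brE p q F F' ys = - (sgn p q *: brE q p F' F ys).
Proof.
elim: ys k l p q F F' => [|i ys IH] k l p q F F' hF hF' /=.
  have h1 := homE_hom hF; have h2 := homE_hom hF'.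
  rewrite [gl_br (F' _) _](glsa_anti hG h2 h1) !scalerBr !scalerN !scalerA (sgnC _ q p) sgnM !scale1r.
  by rewrite opprK opprD opprB; congr (_ - _).
rewrite (IH _ _ _ _ _ _ hF (homE_sh i hF')) (IH _ _ _ _ _ _ (homE_sh i hF) hF').
rewrite scalerDr opprD addrC; congr (_ + _).
  rewrite scalerN scalerA; congr (- (_ *: _)).
  by rewrite sgn_addl (sgnC _ (pr i)) mulrCA sgnM mulr1.
by rewrite scalerA sgn_addr.
Qed.

Lemma brE_rcons k l p q F F' ys : homE k p F -> homE l q F' -> k + l + dgs ys < 0 ->
  forall i, brE p q F F' (rcons ys i) = gl_br (brE p q F F' ys) (b i).
Proof.
elim: ys k l p q F F' => [|j ys IH] k l p q F F' hF hF' d i.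
  rewrite dgs_nil addr0 in d.
  have base k' l' p' q' F1 F2 : homE k' p' F1 -> homE l' q' F2 -> k' + l' < 0 -> l' < 0 ->
      brE p' q' F1 F2 [:: i] = gl_br (brE p' q' F1 F2 [::]) (b i).
    move=> h1 h2 kl' l0; rewrite !(brE_negr _ l0 h1 h2) (glsa_br_suml hG).
    apply: eq_bigr => m _; rewrite (glsa_brZl hG).
    have [[e _]|ne] := eqVneq (dg m, pr m) (l', q'); last first.
      by rewrite (cf0 (homE_hom h2) ne) !scale0r.
    have [_ _ h3 _] := h1 [:: m]; rewrite -h3 //.
    by rewrite /dgs big_seq1 e.
  have [l0|l0] := ltP l 0; first exact: base.
  (* Since [k + l < 0], the first factor is negative here; antisymmetry moves it to the second
     place. *)
  rewrite !(brE_anti _ hF hF') (glsa_brNl hG) (glsa_brZl hG); congr (- (_ *: _)).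
  by apply: base => //; lia.
rewrite dgs_cons in d.
rewrite /= (IH _ _ _ _ _ _ hF (homE_sh j hF')); last by lia.
rewrite (IH _ _ _ _ _ _ (homE_sh j hF) hF'); last by lia.
by rewrite (glsa_brDl hG) (glsa_brZl hG).
Qed.

Lemma sh_rel k p F i j : homE k p F ->
  (fun ys => sh (sh F i) j ys) =
  (fun ys => sgn (pr i) (pr j) *: sh (sh F j) i ys +
             \sum_l cf l (gl_br (b i) (b j)) *: sh F l ys).
Proof.
move=> hF; apply/funext => ys; have [_ _ _ h] := hF [::].
by have /= <- := h i j ys; rewrite addrC subrK.
Qed.

Lemma brE_rel k l p q F F' : homE k p F -> homE l q F' ->
  forall ys i j zs,
  brE p q F F' (ys ++ i :: j :: zs) - sgn (pr i) (pr j) *: brE p q F F' (ys ++ j :: i :: zs)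
    = \sum_l cf l (gl_br (b i) (b j)) *: brE p q F F' (ys ++ l :: zs).
Proof.
move=> hF hF' ys; elim: ys k l p q F F' hF hF' => [|m ys IH] k l p q F F' hF hF' i j zs; last first.
  rewrite /= scalerDr opprD addrACA (IH _ _ _ _ _ _ hF (homE_sh m hF')).
  rewrite scalerA (mulrC (sgn (pr i) _)) -scalerA -scalerBr (IH _ _ _ _ _ _ (homE_sh m hF) hF').
  rewrite scaler_sumr -big_split; apply: eq_bigr => c _ /=.
  by rewrite scalerDr !scalerA mulrC.
have hij : gl_hom (dg i + dg j) (pr i (+) pr j) (gl_br (b i) (b j)) by apply: glsa_br_hom.
rewrite /=.
rewrite [sh (sh F' i) j](sh_rel i j hF') [sh (sh F i) j](sh_rel i j hF).
rewrite brE_linr brE_linl brE_sumr brE_suml.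
have -> : \sum_c cf c (gl_br (b i) (b j)) *: (brE p (q (+) pr c) F (sh F' c) zs +
    sgn q (pr c) *: brE (p (+) pr c) q (sh F c) F' zs) =
  \sum_c cf c (gl_br (b i) (b j)) *: brE p (q (+) pr i (+) pr j) F (sh F' c) zs +
  sgn q (pr i (+) pr j) *: \sum_c cf c (gl_br (b i) (b j)) *:
    brE (p (+) pr i (+) pr j) q (sh F c) F' zs.
  rewrite scaler_sumr -big_split; apply: eq_bigr => c _ /=.
  have [[_ ->]|ne] := eqVneq (dg c, pr c) (dg i + dg j, pr i (+) pr j).
    by rewrite scalerDr !scalerA !addbA mulrC.
  by rewrite (cf0 hij ne) !scale0r scaler0 addr0.
have e1 : q (+) pr j (+) pr i = q (+) pr i (+) pr j by rewrite -!addbA (addbC (pr i)).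
have e2 : p (+) pr j (+) pr i = p (+) pr i (+) pr j by rewrite -!addbA (addbC (pr i)).
rewrite e1 e2 !sgn_addl !sgn_addr.
(* [C] and [D] split the two letters between the factors, [A] and [B] keep them on one factor in the
   swapped order. All four cancel and the corrections [S1] and [S2] remain; the parities affect only
   signs. *)
set A := brE p _ F (sh (sh F' j) i) zs; set B := brE _ q (sh (sh F j) i) F' zs.
set C := brE _ _ (sh F j) (sh F' i) zs; set D := brE _ _ (sh F i) (sh F' j) zs.
set S1 := \sum_c _; set S2 := \sum_c _.
move: A B C D S1 S2; rewrite /sgn; move: (pr i) (pr j) => x y A B C D S1 S2.
by case: x; case: y; case: q {hF' e1} => /=; lmod.
Qed.

Lemma homE_brE k l p q F F' : homE k p F -> homE l q F' ->
  homE (k + l) (p (+) q) (brE p q F F').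
Proof.
move=> hF hF' ys; split; first exact: brE_hom.
- exact: brE_ge0.
- exact: brE_rcons.
- exact: (brE_rel hF hF').
Qed.

(** With the third factor in [m] the brackets with it are shifts, and the identity is the defining
    recursion of [brE] on a nonempty word. *)
Lemma brE_jacobi_neg k l m p q r F F' F'' ys : m < 0 ->
  homE k p F -> homE l q F' -> homE m r F'' ->
  brE p (q (+) r) F (brE q r F' F'') ys =
  brE (p (+) q) r (brE p q F F') F'' ys + sgn p q *: brE q (p (+) r) F' (brE p r F F'') ys.
Proof.
move=> m0 hF hF' hF''.
have -> : brE q r F' F'' = fun ys => \sum_i cf i (F'' [::]) *: sh F' i ys.
  by apply/funext => zs; rewrite (brE_negr _ m0 hF' hF'').
have -> : brE p r F F'' = fun ys => \sum_i cf i (F'' [::]) *: sh F i ys.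
  by apply/funext => zs; rewrite (brE_negr _ m0 hF hF'').
rewrite (brE_negr _ m0 (homE_brE hF hF') hF'') !brE_sumr scaler_sumr -big_split.
apply: eq_bigr => i _ /=; have [[_ e]|ne] := eqVneq (dg i, pr i) (m, r); last first.
  by rewrite (cf0 (homE_hom hF'') ne) !scale0r scaler0 addr0.
rewrite -e (brE_anti _ hF' (homE_sh i hF)) /=; move: (pr i) => x; rewrite /Defs.sgn.
by case: p {hF}; case: q {hF'}; case: x => /=; lmod.
Qed.

(** Shifts act as derivations, so words can be peeled down to the empty one. There a factor in [m]
    is brought to the third place by antisymmetry, and if no factor is in [m], all terms have
    nonnegative degree and vanish. *)
Lemma brE_jacobi k l m p q r F F' F'' ys :
  homE k p F -> homE l q F' -> homE m r F'' ->
  brE p (q (+) r) F (brE q r F' F'') ys =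
  brE (p (+) q) r (brE p q F F') F'' ys + sgn p q *: brE q (p (+) r) F' (brE p r F F'') ys.
Proof.
elim: ys k l m p q r F F' F'' => [|i ys IH] k l m p q r F F' F'' hF hF' hF''.
  have [m0|m0] := ltP m 0; first exact: (brE_jacobi_neg _ m0 hF hF' hF'').
  have antiF p1 q1 r1 k1 l1 m1 F1 F2 F3 : homE k1 p1 F1 -> homE l1 q1 F2 -> homE m1 r1 F3 ->
      (brE p1 (q1 (+) r1) F1 (brE q1 r1 F2 F3) [::] =
         - (sgn q1 r1 *: brE p1 (r1 (+) q1) F1 (brE r1 q1 F3 F2) [::])) /\
      (brE p1 (q1 (+) r1) F1 (brE q1 r1 F2 F3) [::] =
         - (sgn p1 (q1 (+) r1) *: brE (q1 (+) r1) p1 (brE q1 r1 F2 F3) F1 [::])).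
    move=> h1 h2 h3; split; last by rewrite (brE_anti _ h1 (homE_brE h2 h3)).
    have -> : brE q1 r1 F2 F3 = fun ys => (- sgn q1 r1) *: brE r1 q1 F3 F2 ys.
      by apply/funext => zs; rewrite (brE_anti _ h2 h3) scaleNr.
    by rewrite brEZr scaleNr (addbC q1).
  have [l0|l0] := ltP l 0.
    have [-> _] := antiF _ _ _ _ _ _ _ _ _ hF hF' hF''.
    rewrite (brE_jacobi_neg _ l0 hF hF'' hF').
    have [_ ->] := antiF _ _ _ _ _ _ _ _ _ hF' hF hF''.
    have [_ ->] := antiF _ _ _ _ _ _ _ _ _ hF'' hF hF'.
    by rewrite /Defs.sgn; case: p {hF}; case: q {hF'}; case: r {hF''} => /=; lmod.
  have [k0|k0] := ltP k 0.
    have [_ ->] := antiF _ _ _ _ _ _ _ _ _ hF hF' hF''.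
    have := brE_jacobi_neg [::] k0 hF' hF'' hF.
    have [-> _] := antiF _ _ _ _ _ _ _ _ _ hF' hF'' hF.
    have [-> _] := antiF _ _ _ _ _ _ _ _ _ hF'' hF' hF.
    have [_ ->] := antiF _ _ _ _ _ _ _ _ _ hF'' hF hF'.
    move=> /esym /(canRL (addrK _)) ->; rewrite /Defs.sgn.
    by case: p {hF}; case: q {hF'}; case: r {hF''} => /=; lmod.
  rewrite (brE_ge0 hF (homE_brE hF' hF'')) ?(brE_ge0 (homE_brE hF hF') hF'')
    ?(brE_ge0 hF' (homE_brE hF hF'')) ?scaler0 ?addr0 // dgs_nil; lia.
have h1 := homE_sh i hF; have h2 := homE_sh i hF'; have h3 := homE_sh i hF''.
have shb q0 r0 A B : sh (brE q0 r0 A B) i = fun ys =>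
    1 *: brE q0 (r0 (+) pr i) A (sh B i) ys + sgn r0 (pr i) *: brE (q0 (+) pr i) r0 (sh A i) B ys.
  by apply/funext => zs; rewrite scale1r.
rewrite /= !shb !(brE_linr, brE_linl) !(brEZr, brEZl).
have e1 := IH _ _ _ _ _ _ _ _ _ hF hF' h3.
have e2 := IH _ _ _ _ _ _ _ _ _ hF h2 hF''.
have e3 := IH _ _ _ _ _ _ _ _ _ h1 hF' hF''.
move: e1 e2 e3; move: (pr i) => x; rewrite /Defs.sgn.
by case: p {hF h1}; case: q {hF' h2}; case: r {hF'' h3}; case: x => /= -> -> ->; lmod.
Qed.

(** The bracket depends on the parities of its arguments, which a function on words does not
    remember; elements are therefore pairs of functions indexed by parity. *)
Definition inj (p : bool) (F : seq I -> G) : bool -> seq I -> G :=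
  fun r ys => if r == p then F ys else 0.

Definition homP k p (A : bool -> seq I -> G) := exists2 F, homE k p F & A = inj p F.

Definition brP (A B : bool -> seq I -> G) : bool -> seq I -> G := fun r ys =>
  brE false r (A false) (B r) ys + brE true (~~ r) (A true) (B (~~ r)) ys.

Lemma injE p F : inj p F p = F.
Proof. by apply/funext => ys; rewrite /inj eqxx. Qed.
Lemma inj_negE p F : inj p F (~~ p) = fun=> 0.
Proof. by apply/funext => ys; rewrite /inj; case: p. Qed.
Lemma inj_lin a p F F' : inj p (fun ys => a *: F ys + F' ys) = a *: inj p F + inj p F'.
Proof.
apply/funext => r; apply/funext => ys; rewrite !fctE /inj.
by case: eqP => // _; rewrite scaler0 addr0.
Qed.
Lemma inj0 p : inj p (fun=> 0) = 0.
Proof. by apply/funext => r; apply/funext => ys; rewrite /inj; case: eqP. Qed.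

Lemma brP_inj p q F F' : brP (inj p F) (inj q F') = inj (p (+) q) (brE p q F F').
Proof.
apply/funext => r; apply/funext => ys; rewrite /brP.
have e1 := injE false F; have e2 := injE true F; have e3 := inj_negE false F.
have e4 := inj_negE true F; have e5 := injE false F'; have e6 := injE true F'.
have e7 := inj_negE false F'; have e8 := inj_negE true F'.
move: e3 e4 e7 e8 => /= e3 e4 e7 e8.
by case: p; case: q; case: r; rewrite /= ?(e1, e2, e3, e4, e5, e6, e7, e8, brE0l, brE0r) /inj /=
  ?addr0 ?add0r.
Qed.

Lemma brP_linl a A B C : brP (a *: A + B) C = a *: brP A C + brP B C.
Proof.
apply/funext => r; apply/funext => ys; rewrite /brP !fctE.
have h q t : brE q t ((a *: A + B) q) (C t) ys = a *: brE q t (A q) (C t) ys + brE q t (B q) (C t) ys.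
  exact: brE_linl.
by rewrite !h; lmod.
Qed.
Lemma brP_linr a A B C : brP C (a *: A + B) = a *: brP C A + brP C B.
Proof.
apply/funext => r; apply/funext => ys; rewrite /brP !fctE.
have h q t : brE q t (C q) ((a *: A + B) t) ys = a *: brE q t (C q) (A t) ys + brE q t (C q) (B t) ys.
  exact: brE_linr.
by rewrite !h; lmod.
Qed.

(** Infinite sums over the degree would still make sense word by word; finite sums give the direct
    sum that a graded algebra has to be. *)
Definition finP (A : bool -> seq I -> G) : Prop :=
  exists s : seq (int * bool * (bool -> seq I -> G)),
    (forall t, t \in s -> homP t.1.1 t.1.2 t.2) /\ A = \sum_(t <- s) t.2.

Lemma homP0 k p : homP k p 0.
Proof. by exists (fun=> 0); [exact: homE0|rewrite inj0]. Qed.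
Lemma homP_lin k p a A B : homP k p A -> homP k p B -> homP k p (a *: A + B).
Proof.
move=> [F hF ->] [F' hF' ->]; exists (fun ys => a *: F ys + F' ys); first exact: homE_lin.
by rewrite inj_lin.
Qed.
Lemma homP_br k l p q A B : homP k p A -> homP l q B -> homP (k + l) (p (+) q) (brP A B).
Proof.
by move=> [F hF ->] [F' hF' ->]; exists (brE p q F F'); [exact: homE_brE|rewrite brP_inj].
Qed.
Lemma finP0 : finP 0. Proof. by exists [::]; rewrite big_nil. Qed.
Lemma finP_hom k p A : homP k p A -> finP A.
Proof. by move=> h; exists [:: (k, p, A)]; rewrite big_seq1; split=> // t; rewrite inE => /eqP ->. Qed.
Lemma finP_lin a A B : finP A -> finP B -> finP (a *: A + B).
Proof.
move=> [s [hs ->]] [u [hu ->]]; exists ([seq (t.1, a *: t.2) | t <- s] ++ u); split.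
  move=> t; rewrite mem_cat => /orP[/mapP[v /hs h ->]|/hu //] /=.
  by rewrite -[a *: _]addr0; apply: homP_lin => //; apply: homP0.
by rewrite big_cat big_map /= scaler_sumr.
Qed.
Lemma finP_sum (J : eqType) (r : seq J) f : (forall j, j \in r -> finP (f j)) ->
  finP (\sum_(j <- r) f j).
Proof.
elim: r => [|j r IH] h; first by rewrite big_nil; apply: finP0.
rewrite big_cons -[f j]scale1r; apply: finP_lin; first by apply: h; rewrite mem_head.
by apply: IH => i ir; apply: h; rewrite inE ir orbT.
Qed.
Lemma brP_sum (s u : seq (int * bool * (bool -> seq I -> G))) :
  brP (\sum_(t <- s) t.2) (\sum_(v <- u) v.2) = \sum_(t <- s) \sum_(v <- u) brP t.2 v.2.
Proof.
have l0 C : brP 0 C = 0.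
  have := brP_linl (-1) 0 0 C; rewrite scaler0 addr0 => ->; by rewrite scaleN1r addNr.
have r0 C : brP C 0 = 0.
  have := brP_linr (-1) 0 0 C; rewrite scaler0 addr0 => ->; by rewrite scaleN1r addNr.
rewrite (big_morph (brP^~ _) (id1 := 0) (op1 := +%R)) //; last first.
  by move=> A B; rewrite -[A]scale1r brP_linl !scale1r.
apply: eq_bigr => t _; apply: (big_morph (brP _)) => // A B.
by rewrite -[A]scale1r brP_linr !scale1r.
Qed.
Lemma finP_br A B : finP A -> finP B -> finP (brP A B).
Proof.
move=> [s [hs ->]] [u [hu ->]]; rewrite brP_sum; apply: finP_sum => t ts.
apply: finP_sum => v vu; apply: finP_hom; apply: homP_br; [exact: hs|exact: hu].
Qed.

Definition prolong_type := submod finP0 finP_lin.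

Definition prolong : gLSA K := @MkG K prolong_type
  (fun x y => Submod finP0 finP_lin (finP_br (submodP x) (submodP y)))
  (fun k p x => homP k p (val x)).

Lemma prolong_elt k p F : homE k p F ->
  exists2 x : prolong, gl_hom k p x & val x = inj p F.
Proof.
move=> hF; have hX : homP k p (inj p F) by exists F.
by exists (Submod finP0 finP_lin (finP_hom hX)).
Qed.

Lemma valDZ a (x y : prolong) : val (a *: x + y) = a *: val x + val y.
Proof. exact: (linearP (val : prolong_type -> _)). Qed.
Lemma val_sum (J : Type) (r : seq J) (f : J -> prolong_type) :
  val (\sum_(j <- r) f j) = \sum_(j <- r) val (f j).
Proof. by rewrite raddf_sum. Qed.

Lemma prolong_glsa : IsGLSA prolong.
Proof.
split.
- split=> a x y z; apply: val_inj; rewrite valDZ /=.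
    by rewrite -brP_linl -valDZ.
  by rewrite -brP_linr -valDZ.
- split; first by move=> k p; apply: homP0.
  split; first by move=> k p a x y hx hy; exact: (eq_ind_r (homP k p) (homP_lin a hx hy) (valDZ a x y)).
  move=> v; have [s [hs ev]] := submodP v.
  have fin t : finP (if t \in s then t.2 else 0).
    by case: ifP => [/hs /finP_hom //|_]; apply: finP0.
  exists [seq (t.1, Submod finP0 finP_lin (fin t)) | t <- s]; split.
    by move=> _ /mapP[t ts ->] /=; rewrite /= ts; apply: hs.
  apply: val_inj; rewrite val_sum big_map ev /= [LHS]big_seq [RHS]big_seq.
  by apply: eq_bigr => t ts; rewrite ts.
- split; last by move=> k l p q x y; apply: homP_br.
  (* Evaluation at a fixed parity [r] and word [ys] shifts every bidegree by the same amount, so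
     distinct bidegrees stay distinct and independence in [G] applies. *)
  move=> s us hs s0 t ts; apply: val_inj => /=; apply/funext => r; apply/funext => ys.
  have := @glsa_indep _ G hG [seq ((u.1.1 + dgs ys, u.1.2 (+) prs ys), val u.2 r ys) | u <- s].
  move=> /(_ _ _ _ ((t.1.1 + dgs ys, t.1.2 (+) prs ys), val t.2 r ys)) /= -> //.
  + rewrite -map_comp; have -> : fst \o (fun u : int * bool * prolong => (u.1.1 + dgs ys, u.1.2 (+) prs ys, val u.2 r ys))
       = (fun k : int * bool => (k.1 + dgs ys, k.2 (+) prs ys)) \o fst by [].
    rewrite map_comp map_inj_uniq // => -[k1 p1] [k2 p2] /= [/addIr -> /addIb -> //].
  + move=> _ /mapP[u us' ->] /=; have [F hF ->] := hs _ us'; rewrite /inj.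
    by case: eqP => _; [have [] := hF ys|apply: glsa_hom0].
  + rewrite big_map /=; apply: etrans (congr1 (fun x : prolong => val x r ys) s0).
    rewrite val_sum /=; elim: (s) => [|u v IH]; first by rewrite !big_nil.
    by rewrite !big_cons IH.
  + by apply/mapP; exists t.
- move=> k l p q x y [F hF eF] [F' hF' eF']; apply: val_inj.
  change (brP (val x) (val y) = - (sgn p q *: brP (val y) (val x))).
  rewrite eF eF' !brP_inj (addbC q).
  apply/funext => r; apply/funext => ys; rewrite !fctE /inj; case: eqP => _.
    exact: brE_anti hF hF'.
  by rewrite scaler0 oppr0.
- move=> k l p q x y z [F hF eF] [F' hF' eF']; apply: val_inj.
  change (brP (val x) (brP (val y) (val z)) =
    brP (brP (val x) (val y)) (val z) + sgn p q *: brP (val y) (brP (val x) (val z))).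
  have [s [hs ->]] := submodP z.
  have e0 (C : bool -> seq I -> G) : C = \sum_(t <- [:: ((0, false), C)]) t.2 by rewrite big_seq1.
  have br0 C : brP C 0 = 0.
    have := brP_linr (-1) 0 0 C; rewrite scaler0 addr0 => ->; by rewrite scaleN1r addNr.
  elim: s hs => [|t s IH] hs; first by rewrite !big_nil !br0 scaler0 addr0.
  have {}IH := IH (fun u us => hs u (mem_behead (s := t :: s) us)).
  rewrite big_cons -[t.2]scale1r !brP_linr !scale1r {}IH.
  have [F'' hF'' ->] := hs _ (mem_head _ _); rewrite eF eF' !brP_inj.
  have -> : inj (p (+) (q (+) t.1.2)) (brE p (q (+) t.1.2) F (brE q t.1.2 F' F'')) =
    inj (p (+) q (+) t.1.2) (brE (p (+) q) t.1.2 (brE p q F F') F'') +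
    sgn p q *: inj (q (+) (p (+) t.1.2)) (brE q (p (+) t.1.2) F' (brE p t.1.2 F F'')).
    apply/funext => r; apply/funext => ys; rewrite !fctE /inj (addbCA q) addbA.
    case: eqP => _; last by rewrite scaler0 addr0.
    exact: brE_jacobi hF hF' hF''.
  by rewrite [in RHS]scalerDr addrACA.
Qed.

Lemma dgs_le0 ys : dgs ys <= 0.
Proof. by elim: ys => [|i ys IH]; rewrite ?dgs_nil // dgs_cons; have := dg_neg i; lia. Qed.

(** * Coefficient functions of the elements of an arbitrary algebra *)

Section Coefficients.
Variables (L : gLSA K) (phL : G -> L).
Hypotheses (hL : IsGLSA L) (nL : NegIso phL).
Local Notation act := (iter_act b phL).

Lemma act_hom k p x ys : gl_hom k p x -> gl_hom (k + dgs ys) (p (+) prs ys) (act x ys).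
Proof.
elim: ys k p x => [|i ys IH] k p x hx; first by rewrite dgs_nil prs_nil addr0 addbF.
rewrite dgs_cons prs_cons addrA addbA; apply: IH; apply: glsa_br_hom => //.
exact: (phb_hom hb).
Qed.

Lemma act_cat x ys zs : act x (ys ++ zs) = act (act x ys) zs.
Proof. exact: foldl_cat. Qed.

Lemma act_sum (J : Type) (r : seq J) (c : J -> K) (f : J -> L) ys :
  act (\sum_(j <- r) c j *: f j) ys = \sum_(j <- r) c j *: act (f j) ys.
Proof.
elim: r => [|j r IH]; first by rewrite !big_nil act0.
by rewrite !big_cons act_lin // IH.
Qed.

Lemma negiso_inj k p z t : k < 0 -> gl_hom k p z -> gl_hom k p t -> phL z = phL t -> z = t.
Proof.
move=> k0 hz ht e; apply/eqP; rewrite -subr_eq0; apply/eqP; rewrite addrC -scaleN1r.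
case: (nL) => lin _ _ inj _; apply: (inj k p) => //; first exact: glsa_homP.
by rewrite lin e scaleN1r addNr.
Qed.

Lemma act_swap k p x i j zs : gl_hom k p x ->
  act x [:: i, j & zs] = sgn (pr i) (pr j) *: act x [:: j, i & zs]
    + \sum_l cf l (gl_br (b i) (b j)) *: act x (l :: zs).
Proof.
move=> hx; have hi := phb_hom hb nL i; have hj := phb_hom hb nL j.
have hij : gl_hom (dg i + dg j) (pr i (+) pr j) (gl_br (b i) (b j)) by apply: glsa_br_hom.
have neg : dg i + dg j < 0 by have := dg_neg i; have := dg_neg j; lia.
rewrite /= (glsa_jacobi_r hL hx hi hj) addrC act_lin //; congr (_ + _).
have -> : gl_br (phL (b i)) (phL (b j)) = phL (gl_br (b i) (b j)).
  by case: (nL) => _ _ _ _ h; rewrite (h _ _ _ _ _ _ (dg_neg i) (dg_neg j) (b_hom i) (b_hom j)).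
rewrite (negiso_span hb nL neg hij) (glsa_br_sumr hL).
by rewrite -act_sum; congr iter_act; apply: eq_bigr => l _; rewrite (glsa_brZr hL).
Qed.

(** Brackets of [x] that reach negative degree pull back to [m] because [phL] is onto there. The
    relations between them hold in [L] and descend because [phL] is injective in each negative
    degree. *)
Lemma coefficients k p x : gl_hom k p x ->
  exists2 F, homE k p F & forall ys, k + dgs ys < 0 -> act x ys = phL (F ys).
Proof.
move=> hx; have ex ys : exists z, [/\ gl_hom (k + dgs ys) (p (+) prs ys) z,
    (k + dgs ys < 0 -> act x ys = phL z) & (0 <= k + dgs ys -> z = 0)].
  have [d|d] := ltP (k + dgs ys) 0; last by exists 0; split=> //; apply: glsa_hom0.
  case: (nL) => _ _ sur _ _; have [z [hz ez]] := sur _ _ _ d (act_hom ys hx).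
  by exists z; split.
pose F ys := projT1 (cid (ex ys)).
have F1 ys : gl_hom (k + dgs ys) (p (+) prs ys) (F ys) by rewrite /F; case: cid => ? [].
have F2 ys : k + dgs ys < 0 -> act x ys = phL (F ys) by rewrite /F; case: cid => ? [].
have F3 ys : 0 <= k + dgs ys -> F ys = 0 by rewrite /F; case: cid => ? [].
exists F => // ys; split; [exact: F1|exact: F3| |].
  move=> d i; have di := dg_neg i.
  have e1 : k + dgs (rcons ys i) = k + dgs ys + dg i by rewrite /degsum -cats1 big_cat big_seq1 addrA.
  have e2 : p (+) prs (rcons ys i) = p (+) prs ys (+) pr i.
    by rewrite /parsum -cats1 big_cat big_seq1 addbA.
  apply: (@negiso_inj (k + dgs (rcons ys i)) (p (+) prs (rcons ys i))) => //.
  - by rewrite e1; lia.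
  - by rewrite e1 e2; apply: glsa_br_hom.
  - rewrite -F2; last by rewrite e1; lia.
    rewrite /iter_act foldl_rcons -/(act x ys) F2 //.
    by case: (nL) => _ _ _ _ h; rewrite (h _ _ _ _ _ _ d di (F1 ys) (b_hom i)).
move=> i j zs.
have dE l : dgs (ys ++ l :: zs) = dgs ys + dg l + dgs zs.
  by rewrite /degsum big_cat big_cons /= addrA.
have d2E l m : dgs (ys ++ l :: m :: zs) = dgs ys + (dg l + dg m) + dgs zs.
  by rewrite /degsum big_cat !big_cons /= !addrA.
have pE l : prs (ys ++ l :: zs) = prs ys (+) pr l (+) prs zs.
  by rewrite /parsum big_cat big_cons /= addbA.
have p2E l m : prs (ys ++ l :: m :: zs) = prs ys (+) (pr l (+) pr m) (+) prs zs.
  by rewrite /parsum big_cat !big_cons /= !addbA.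
have hij : gl_hom (dg i + dg j) (pr i (+) pr j) (gl_br (b i) (b j)) by apply: glsa_br_hom.
have [d|d] := ltP (k + dgs (ys ++ i :: j :: zs)) 0; last first.
  rewrite !F3 //; last by move: d; rewrite !d2E (addrC (dg j)).
  rewrite scaler0 subr0 big1 // => l _.
  have [[e _]|ne] := eqVneq (dg l, pr l) (dg i + dg j, pr i (+) pr j).
    by rewrite F3 ?scaler0 //; move: d; rewrite d2E dE e.
  by rewrite (cf0 hij ne) scale0r.
have d' : k + dgs (ys ++ j :: i :: zs) < 0 by move: d; rewrite !d2E (addrC (dg j)).
have hsum : gl_hom (k + dgs (ys ++ i :: j :: zs)) (p (+) prs (ys ++ i :: j :: zs))
    (\sum_l cf l (gl_br (b i) (b j)) *: F (ys ++ l :: zs)).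
  apply: (glsa_hom_sum hG) => l _; rewrite d2E p2E.
  have [[<- <-]|ne] := eqVneq (dg l, pr l) (dg i + dg j, pr i (+) pr j).
    by rewrite -dE -pE; apply: (glsa_homZ hG).
  by rewrite (cf0 hij ne) scale0r; apply: (glsa_hom0 hG).
have hji : gl_hom (k + dgs (ys ++ i :: j :: zs)) (p (+) prs (ys ++ i :: j :: zs))
    (F (ys ++ j :: i :: zs)).
  by rewrite d2E p2E (addrC (dg i)) (addbC (pr i)) -d2E -p2E.
apply: (canLR (addrK _)); rewrite addrC.
apply: (@negiso_inj (k + dgs (ys ++ i :: j :: zs)) (p (+) prs (ys ++ i :: j :: zs))) => //.
  by apply: (glsa_homP hG).
rewrite (negiso_lin nL) -!F2 // !act_cat (act_swap _ _ _ (act_hom ys hx)); congr (_ + _).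
rewrite (negiso_sum nL); apply: eq_bigr => l _; rewrite (negisoZ nL).
have [[e _]|ne] := eqVneq (dg l, pr l) (dg i + dg j, pr i (+) pr j).
  by rewrite -F2 ?act_cat //; move: d; rewrite d2E dE e.
by rewrite (cf0 hij ne) !scale0r.
Qed.
End Coefficients.

Definition emb (z : G) : seq I -> G := iter_act b (id : G -> G) z.

Lemma emb_hom k p z : k < 0 -> gl_hom k p z -> homE k p (emb z).
Proof.
move=> k0 hz; have [F hF eF] := coefficients hG (negiso_id G) hz.
suff -> : emb z = F by [].
by apply/funext => ys; apply: eF; have := dgs_le0 ys; lia.
Qed.

Lemma homE_cat k p F ys zs : homE k p F -> k + dgs ys < 0 -> F (ys ++ zs) = emb (F ys) zs.
Proof.
move=> hF d; elim/last_ind: zs => [|zs i IH]; first by rewrite cats0.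
have [_ _ h _] := hF (ys ++ zs).
rewrite -rcons_cat h ?IH /emb /iter_act ?foldl_rcons //.
have -> : dgs (ys ++ zs) = dgs ys + dgs zs by rewrite /degsum big_cat.
by have := dgs_le0 zs; lia.
Qed.

Lemma homE_neg k p F : k < 0 -> homE k p F -> F = emb (F [::]).
Proof.
move=> k0 hF; apply/funext => ys; have := @homE_cat _ _ _ [::] ys hF.
by rewrite dgs_nil addr0; apply.
Qed.

Hypothesis cf_dual : forall i l, cf l (b i) = (l == i)%:R.
(** Generation of [m] by its part of degree -1, in a form that a table can certify: each remaining
    basis vector is, up to a scalar, a single bracket of basis vectors. *)
Hypothesis gen : forall i, dg i != -1 -> exists j m c,
  [/\ dg j = -1, dg i < dg m, c != 0 & forall l, cf l (gl_br (b j) (b m)) = c * (l == i)%:R].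

Lemma brE_b k p F i : homE k p F -> brE p (pr i) F (emb (b i)) = sh F i.
Proof.
move=> hF; apply/funext => ys.
rewrite (brE_negr _ (dg_neg i) hF (emb_hom (dg_neg i) (b_hom i))) (bigD1 i) //=.
rewrite /emb /= cf_dual eqxx scale1r big1 ?addr0 // => l ne.
by rewrite cf_dual (negPf ne) scale0r.
Qed.

Lemma homP_b i : homP (dg i) (pr i) (inj (pr i) (emb (b i))).
Proof. by exists (emb (b i)) => //; apply: emb_hom. Qed.

Definition pb i : prolong := Submod finP0 finP_lin (finP_hom (homP_b i)).
Definition phiP (z : G) : prolong := \sum_i cf i z *: pb i.

Lemma phiP_val k p z : k < 0 -> gl_hom k p z -> val (phiP z) = inj p (emb z).
Proof.
move=> k0 hz; rewrite /phiP val_sum; apply/funext => r; apply/funext => ys.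
have -> : (\sum_i val (cf i z *: pb i)) r ys = \sum_i cf i z *: inj (pr i) (emb (b i)) r ys.
  elim: (index_enum I) => [|i s IH]; first by rewrite !big_nil.
  by rewrite !big_cons -IH.
rewrite /inj [in RHS]/emb {2}(b_span k0 hz) (act_sum _ hG).
have -> : (if r == p then \sum_i cf i z *: iter_act b id (b i) ys else 0) =
   \sum_i cf i z *: (if r == p then emb (b i) ys else 0).
  by case: eqP => _ //; rewrite big1 // => i _; rewrite scaler0.
apply: eq_bigr => i _; have [[_ <-]|ne] := eqVneq (dg i, pr i) (k, p) => //.
by rewrite (cf0 hz ne) !scale0r.
Qed.

Lemma phiP_negiso : NegIso phiP.
Proof.
split.
- move=> a x y; rewrite /phiP scaler_sumr -big_split; apply: eq_bigr => i _ /=.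
  by rewrite cfP scalerDl scalerA.
- by move=> k p x k0 hx; exists (emb x); [exact: emb_hom|exact: phiP_val hx].
- move=> k p y k0 [F hF eF]; have h0 := homE_hom hF; exists (F [::]); split=> //.
  by apply: val_inj; rewrite (phiP_val k0 h0) eF -(homE_neg k0 hF).
- move=> k p x k0 hx /(congr1 val); rewrite (phiP_val k0 hx) => /(congr1 (fun A => A p [::])).
  by rewrite /inj eqxx.
- move=> k l p q x y k0 l0 hx hy; apply: val_inj.
  have hxy := glsa_br_hom hG hx hy; have kl : k + l < 0 by lia.
  rewrite (phiP_val kl hxy) /= (phiP_val k0 hx) (phiP_val l0 hy) brP_inj; congr inj.
  apply/funext => ys; rewrite (brE_negr _ l0 (emb_hom k0 hx) (emb_hom l0 hy)) /emb /=.
  rewrite {1}(b_span l0 hy) (glsa_br_sumr hG).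
  rewrite -(act_sum _ hG); congr iter_act; apply: eq_bigr => i _.
  by rewrite (glsa_brZr hG).
Qed.

Lemma pb_phiP i : phiP (b i) = pb i.
Proof.
rewrite /phiP (bigD1 i) //= cf_dual eqxx scale1r big1 ?addr0 // => l ne.
by rewrite cf_dual (negPf ne) scale0r.
Qed.

Lemma prolong_transitive : Transitive prolong.
Proof.
move=> k p x k0 [F hF eF] h; apply: val_inj; rewrite eF.
have sh1 i : dg i = -1 -> sh F i = fun=> 0.
  move=> di; have hi := homP_b i; rewrite di in hi.
  have /(congr1 val) := h (pr i) (pb i) hi.
  change (brP (val x) (val (pb i)) = 0 -> sh F i = fun=> 0).
  rewrite eF brP_inj (brE_b _ hF) => /(congr1 (fun A => A (p (+) pr i))).
  by rewrite injE.
(* Shifts by deeper letters vanish by descent through the degrees: by [gen] such a letter is a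
   bracket, and the commutation relation expresses its shift through shifts already known to
   vanish. *)
have sh0 : forall n i, dg i >= - n%:Z -> sh F i = fun=> 0.
  elim=> [|n IH] i di; first by have := dg_neg i; lia.
  have [|ne] := eqVneq (dg i) (-1); first exact: sh1.
  have [j [m [c [dj dm c0 ec]]]] := gen ne.
  apply/funext => zs; have [_ _ _ /(_ j m zs)] := hF [::]; rewrite /=.
  have -> : F [:: j, m & zs] = 0 by have := congr1 (fun A => A (m :: zs)) (sh1 j dj).
  have -> : F [:: m, j & zs] = 0.
    by have := congr1 (fun A => A (j :: zs)) (IH m _); apply; lia.
  rewrite scaler0 subr0 (bigD1 i) //= ec eqxx mulr1 big1 ?addr0 => [/esym/eqP|l ne'].
    by rewrite scaler_eq0 (negPf c0) => /eqP.
  by rewrite ec (negPf ne') mulr0 scale0r.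
have -> : F = fun=> 0; last by rewrite inj0.
apply/funext => -[|i ys]; first exact: homE_ge0 hF k0.
by have := congr1 (fun A => A ys) (sh0 (`|dg i|)%N i _); apply; lia.
Qed.

Lemma act_pb k p F ys (x : prolong) : homE k p F -> val x = inj p F ->
  val (iter_act b phiP x ys) = inj (p (+) prs ys) (fun zs => F (ys ++ zs)).
Proof.
elim: ys k p F x => [|i ys IH] k p F x hF ex /=; first by rewrite prs_nil addbF.
rewrite (IH _ _ _ _ (homE_sh i hF)) ?prs_cons ?addbA // pb_phiP.
change (brP (val x) (val (pb i)) = inj (p (+) pr i) (sh F i)).
by rewrite ex brP_inj (brE_b _ hF).
Qed.

(** Maximality is built into the construction: the partner of [x] is its own coefficient
    function. *)
Theorem prolong_IsPr : IsPr phiP.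
Proof.
split; [exact: prolong_glsa|exact: prolong_transitive|exact: phiP_negiso|].
move=> L phL hL tL nL; apply: (embed_of_rel hG hb) => //;
  [exact: prolong_glsa|exact: phiP_negiso|exact: prolong_transitive|].
move=> k p x hx; have [F hF eF] := coefficients hL nL hx.
have [X hX eX] := prolong_elt hF; exists X; split=> // ys d.
have [h1 _ _ _] := hF ys; exists (F ys); split=> //; first exact: eF.
apply: val_inj; rewrite (act_pb _ hF) // (phiP_val d h1); congr inj.
by apply/funext => zs; apply: homE_cat hF d.
Qed.
End Prolongation.

Lemma InfDim_of_hom (K : fieldType) (P : gLSA K) (f : nat -> int) (p : bool) :
  IsGLSA P -> injective f -> (forall m, exists2 x : P, gl_hom (f m) p x & x != 0) -> InfDim P.
Proof.
move=> hP finj hex n.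
have hx m : {x : P | gl_hom (f m) p x & x != 0} by apply/cid2/hex.
pose v m : P := s2val (hx m); exists (fun i : 'I_n => v i) => c s0 i.
have hv m : gl_hom (f m) p (v m) := s2valP (hx m).
have v0 m : v m != 0 := s2valP' (hx m).
have := @glsa_indep _ P hP [seq ((f i, p), c i *: v i) | i : 'I_n <- index_enum 'I_n].
move=> /(_ _ _ _ ((f i, p), c i *: v i)) /= h.
have /eqP : c i *: v i = 0.
  apply: h.
  - rewrite -map_comp map_inj_uniq ?index_enum_uniq // => j k /= [] /finj.
    exact: val_inj.
  - by move=> _ /mapP[j _ ->] /=; apply: glsa_homZ.
  - by rewrite big_map.
  - by apply: map_f; apply: mem_index_enum.
by rewrite scaler_eq0 (negPf (v0 _)) orbF => /eqP.
Qed.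

(** * Infinite-dimensional prolongations *)

Section InfiniteDimension.
Variables (K : numFieldType) (G : gLSA K) (I : finType) (b : I -> G)
  (dg : I -> int) (pr : I -> bool) (cf : I -> G -> K).
Hypothesis hG : IsGLSA G.
Hypothesis hb : NegBasis b dg pr cf.
Hypothesis cf_dual : forall i l, cf l (b i) = (l == i)%:R.
Hypothesis gen : forall i, dg i != -1 -> exists j m c,
  [/\ dg j = -1, dg i < dg m, c != 0 & forall l, cf l (gl_br (b j) (b m)) = c * (l == i)%:R].
Local Notation P := (prolong hG hb).
Local Notation homE := (homE b dg pr cf).
Local Notation dgs := (degsum dg).
Local Notation prs := (parsum pr).

Let dg_neg i : dg i < 0. Proof. by case: hb. Qed.
Let b_hom i : gl_hom (dg i) (pr i) (b i). Proof. by case: hb. Qed.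
Let cf0 k p y i : gl_hom k p y -> (dg i, pr i) != (k, p) -> cf i y = 0.
Proof. by case: hb => _ _ _ h _; apply: h. Qed.
Let b_span k p y : k < 0 -> gl_hom k p y -> y = \sum_i cf i y *: b i.
Proof. by case: hb => _ _ _ _; apply. Qed.

Let hP : IsGLSA P := prolong_glsa hG hb.
Let tP : Transitive P := @prolong_transitive _ _ _ _ _ _ _ hG hb cf_dual gen.

Lemma homE_elt k p F ys : homE k p F -> F ys != 0 -> exists2 x : P, gl_hom k p x & x != 0.
Proof.
move=> hF nz; have [x hx ex] := prolong_elt hG hb hF; exists x => //.
apply: contraNneq nz => x0; have := congr1 (fun A => A p ys) ex.
by rewrite x0 /inj eqxx => <-.
Qed.

(** * Infinitely many degrees from one even coordinate *)

Section EvenFamily.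
Variables a c : I.
Hypotheses (da : dg a = -1) (dc : dg c = -1) (pa : pr a = false) (pc : pr c = false).
Hypothesis ha : forall s, s != c -> gl_br (b a) (b s) = 0.
Hypothesis hc : forall s, gl_br (gl_br (b a) (b c)) (b s) = 0.

(* The Hamiltonian vector field of [y ^ m.+1], where [y] is the coordinate dual to [b c]. *)
Definition powF (m : nat) (ys : seq I) : G :=
  if ys == nseq m c then b a else if ys == nseq m.+1 c then gl_br (b a) (b c) else 0.

Let dgs_nseq m : dgs (nseq m c) = - m%:Z.
Proof. by elim: m => [|m IH]; rewrite ?dgs_nil //= dgs_cons IH dc; lia. Qed.
Let prs_nseq m : prs (nseq m c) = false.
Proof. by elim: m => [|m IH]; rewrite ?prs_nil //= prs_cons IH pc. Qed.

Let powF_notin m ys i : i \in ys -> i != c -> powF m ys = 0.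
Proof.
move=> hi ne; rewrite /powF; case: eqP => [e|_]; last case: eqP => [e|//].
  by move: hi; rewrite e mem_nseq (negPf ne) andbF.
by move: hi; rewrite e mem_nseq (negPf ne) andbF.
Qed.

(** By [ha] and [hc] the vector [b a] is moved only by [b c], and only once, so [powF] records all
    iterated brackets. Its support consists of words in the single even letter [c], where exchanging
    letters changes nothing. *)
Lemma powF_hom m : homE (m%:Z - 1) false (powF m).
Proof.
have b0 : b a != 0 by apply/eqP => e; have := cf_dual a a; rewrite e eqxx;
  case: (hb) => _ _ lin _ _; have := lin a (-1) 0 0;
  rewrite scaler0 addr0 mulN1r addNr => -> /esym/eqP; rewrite oner_eq0.
move=> ys; split.
- rewrite /powF; case: eqP => [->|_].
    rewrite dgs_nseq prs_nseq; have -> : m%:Z - 1 + - m%:Z = dg a by rewrite da; lia.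
    by have -> : false (+) false = pr a by rewrite pa.
  case: eqP => [->|_]; last exact: glsa_hom0.
  rewrite dgs_nseq prs_nseq; have -> : m%:Z - 1 + - m.+1%:Z = dg a + dg c by rewrite da dc; lia.
  have -> : false (+) false = pr a (+) pr c by rewrite pa pc.
  exact: glsa_br_hom.
- move=> d; rewrite /powF; case: eqP => [e|_]; first by move: d; rewrite e dgs_nseq; lia.
  by case: eqP => [e|//]; move: d; rewrite e dgs_nseq; lia.
- move=> d i; have rE k : (rcons ys i == nseq k.+1 c) = (ys == nseq k c) && (i == c).
    have -> : nseq k.+1 c = rcons (nseq k c) c by elim: k => [//|k IH] /=; rewrite -IH.
    by rewrite eqseq_rcons.
  have r0 : (rcons ys i == nseq 0 c) = false by case: (ys).
  rewrite /powF !rE; have [ey|ny] := eqVneq ys (nseq m c).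
    have -> : (rcons ys i == nseq m c) = false.
      by apply/eqP => /(congr1 size); rewrite size_rcons ey !size_nseq; lia.
    by case: eqVneq => [->|ne] //=; rewrite ha.
  have [ey|ny'] := eqVneq ys (nseq m.+1 c).
    rewrite hc; case: eqP => // /(congr1 size); rewrite size_rcons ey !size_nseq; lia.
  rewrite (glsa_br0l hG); case: eqP => // e; case: m e rE ny ny' d => [|m] e rE ny ny' d.
    by move: r0; rewrite e eqxx.
  move: (rE m); rewrite e eqxx => /esym/andP[/eqP ey _].
  by move: d; rewrite ey dgs_nseq; lia.
- move=> i j zs; rewrite [RHS]big1 => [|l _].
    have [ei|ne] := eqVneq i c; last first.
      by rewrite !(@powF_notin m _ i) ?mem_cat ?inE ?eqxx ?orbT // scaler0 subr0.
    have [ej|ne] := eqVneq j c; last first.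
      by rewrite !(@powF_notin m _ j) ?mem_cat ?inE ?eqxx ?orbT // scaler0 subr0.
    by rewrite ei ej pc /sgn expr0 scale1r subrr.
  have [->|ne] := eqVneq l c; last first.
    by rewrite (@powF_notin m _ l) ?mem_cat ?inE ?eqxx ?orbT // scaler0.
  (* The letter [c] has degree -1 and does not occur in a bracket of two elements of [m], so the
     right side of the commutation relation vanishes. *)
  have hij : gl_hom (dg i + dg j) (pr i (+) pr j) (gl_br (b i) (b j)) by apply: glsa_br_hom.
  rewrite (cf0 hij) ?scale0r //; apply/eqP => -[e _].
  by move: e; rewrite dc; have := dg_neg i; have := dg_neg j; lia.
Qed.

Lemma InfDim_even : InfDim P.
Proof.
apply: (@InfDim_of_hom _ _ (fun m => m%:Z - 1) false) => //; first by move=> m m'; lia.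
move=> m; apply: (homE_elt (powF_hom m) (ys := nseq m c)).
rewrite /powF eqxx; apply/eqP => e; have := cf_dual a a; rewrite e eqxx.
case: (hb) => _ _ lin _ _; have := lin a (-1) 0 0.
by rewrite scaler0 addr0 mulN1r addNr => -> /esym/eqP; rewrite oner_eq0.
Qed.
End EvenFamily.

(** * Infinitely many degrees in the odd contact gradings *)

Section OddContact.
Variable w : I -> I -> G.
Hypothesis dg12 : forall i, dg i = -1 \/ dg i = -2.
Hypothesis odd1 : forall i, dg i = -1 -> pr i.
Hypothesis even2 : forall i, dg i = -2 -> pr i = false.
Hypothesis w_hom : forall i j, gl_hom (-1) true (w i j).
Hypothesis w_supp : forall i j, dg i = -2 \/ dg j = -2 -> w i j = 0.
Hypothesis w_anti : forall i j, w i j = sgn K (pr i) (pr j) *: w j i.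
Hypothesis w_cyc : forall k i j, gl_br (w k i) (b j) = sgn K (pr i) (pr j) *: gl_br (w k j) (b i).

(* The Hamiltonian vector field of a cubic form in the odd variables. *)
Definition cubF (ys : seq I) : G := match ys with
  | [:: i; j] => w i j
  | [:: i; j; k] => gl_br (w i j) (b k)
  | _ => 0
  end.

Let deep (k : int) p (y : G) : k < -2 -> gl_hom k p y -> y = 0.
Proof.
move=> k2 hy; have k0 : k < 0 by lia.
rewrite (b_span k0 hy) big1 // => i _; rewrite (cf0 hy) ?scale0r //.
by apply/eqP => -[e _]; case: (dg12 i); rewrite e; lia.
Qed.
Let w_deep i j l : dg l = -2 -> gl_br (w i j) (b l) = 0.
Proof.
move=> dl; apply: (@deep (-1 + dg l) (true (+) pr l)); first by rewrite dl.
by apply: glsa_br_hom.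
Qed.
Let w_deep3 i j l m : gl_br (gl_br (w i j) (b l)) (b m) = 0.
Proof.
have [dl|dl] := dg12 l; last by rewrite w_deep // (glsa_br0l hG).
apply: (@deep (-1 + dg l + dg m) (true (+) pr l (+) pr m)); first by have := dg_neg m; lia.
by apply: glsa_br_hom => //; apply: glsa_br_hom.
Qed.

(** [w_anti] and [w_cyc] are the symmetry of the second and third derivatives of the form. The
    correction terms involve only letters of degree -2, on which the form does not depend, and words
    of length four exceed the depth of [m]. *)
Lemma cubF_hom : homE 1 true cubF.
Proof.
have cfw i j l : dg l = -1 -> cf l (gl_br (b i) (b j)) = 0.
  move=> dl; have hij : gl_hom (dg i + dg j) (pr i (+) pr j) (gl_br (b i) (b j)) by apply: glsa_br_hom.
  rewrite (cf0 hij) //; apply/eqP => -[e _].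
  by move: e; rewrite dl; have := dg_neg i; have := dg_neg j; lia.
have sum0 i j (F : I -> G) : (forall l, dg l = -2 -> F l = 0) ->
    \sum_l cf l (gl_br (b i) (b j)) *: F l = 0.
  by move=> hF; rewrite big1 // => l _; case: (dg12 l) => dl; [rewrite cfw // scale0r|rewrite hF // scaler0].
move=> ys; split.
- case: ys => [|i [|j [|k [|m ys]]]] /=; try exact: glsa_hom0.
    have [di|di] := dg12 i; last by rewrite w_supp; [apply: glsa_hom0|left].
    have [dj|dj] := dg12 j; last by rewrite w_supp; [apply: glsa_hom0|right].
    rewrite !dgs_cons !prs_cons dgs_nil prs_nil (odd1 di) (odd1 dj) di dj.
    exact: w_hom.
  have [di|di] := dg12 i; last by rewrite w_supp ?(glsa_br0l hG); [apply: glsa_hom0|left].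
  have [dj|dj] := dg12 j; last by rewrite w_supp ?(glsa_br0l hG); [apply: glsa_hom0|right].
  rewrite !dgs_cons !prs_cons dgs_nil prs_nil (odd1 di) (odd1 dj) di dj.
  have -> : 1 + (-1 + (-1 + (dg k + 0))) = -1 + dg k by lia.
  by rewrite /= addbF negbK; apply: (glsa_br_hom hG (w_hom i j) (b_hom k)).
- case: ys => [|i [|j [|k [|m ys]]]] //=; rewrite !dgs_cons dgs_nil => d.
    by rewrite w_supp //; case: (dg12 i) (dg12 j) => [di|di] [dj|dj]; lia.
  by have := dg_neg i; have := dg_neg j; have := dg_neg k; lia.
- case: ys => [|i [|j [|k [|m ys]]]] d l /=; rewrite ?(glsa_br0l hG) //.
  by rewrite w_supp //; left; move: d; rewrite !dgs_cons dgs_nil; case: (dg12 i); lia.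
- case: ys => [|k [|m [|q ys]]] i j zs.
  + case: zs => [|k [|m zs]] /=.
    * rewrite sum0 // {1}w_anti subrr //.
    * rewrite sum0; first by rewrite {1}w_anti (glsa_brZl hG) subrr.
      by move=> l dl; rewrite w_supp //; left.
    * rewrite scaler0 subr0 sum0 //; case: zs => [|z zs] //= l dl.
      by rewrite w_supp ?(glsa_br0l hG) //; left.
  + case: zs => [|m [|q zs]] /=.
    * rewrite w_cyc subrr sum0 // => l dl; by rewrite w_supp //; right.
    * rewrite scaler0 subr0 sum0 // => l dl; by rewrite w_supp ?(glsa_br0l hG) //; right.
    * by rewrite scaler0 subr0 big1 // => l _; rewrite scaler0.
  + rewrite /= scaler0 subr0; case: zs => [|q zs] /=; last by rewrite big1 // => l _; rewrite scaler0.
    by rewrite sum0 // => l dl; apply: w_deep.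
  + have z0 (x y : I) us : cubF [:: k, m, q & ys ++ x :: y :: us] = 0 by case: (ys).
    have z1 (x : I) us : cubF [:: k, m, q & ys ++ x :: us] = 0 by case: (ys).
    by rewrite !cat_cons !z0 scaler0 subr0 big1 // => l _; rewrite !cat_cons z1 scaler0.
Qed.

Variables (z : I) (e : G) (lam : K).
Hypothesis tG : Transitive G.
Hypothesis dz : dg z = -2.
Hypothesis lam0 : lam != 0.
Hypothesis e_hom : gl_hom 2 false e.
Hypothesis h_act : forall i, gl_br (gl_br e (b z)) (b i) = (lam * (dg i)%:~R) *: b i.
Hypothesis w_neq0 : exists i j, w i j != 0.

(** [e], [b z] and their bracket span an [sl_2] whose Cartan element is a multiple of the grading
    element. The cubic form is killed by [b z] and has degree 1: a lowest weight vector of positive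
    weight, which no finite-dimensional module admits. *)
Lemma InfDim_odd_contact : InfDim P.
Proof.
have [prP _ _ univ] := @prolong_IsPr _ _ _ _ _ _ _ hG hb cf_dual gen.
have [psi [[psiL psi_hom psi_inj psi_br] compat]] := univ G id hG tG (negiso_id G).
pose f' : P := psi (b z); pose e' : P := psi e; pose h' : P := psi (gl_br e (b z)).
have pz : pr z = false := even2 dz.
have hf' : gl_hom (-2) false f' by rewrite -dz -pz; apply: psi_hom; apply: b_hom.
have he' : gl_hom 2 false e' by apply: psi_hom.
have hh' : gl_hom 0 false h'.
  by apply: psi_hom; have := glsa_br_hom hG e_hom (b_hom z); rewrite dz pz.
have h'E : h' = gl_br e' f' by rewrite /h' psi_br.
have nP := phiP_negiso hG hb.
(* On [m] this is [h_act]. It spreads to all degrees by transitivity, since both sides have the same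
   brackets with degree -1. *)
have h'_act k p x : gl_hom k p x -> gl_br h' x = (lam * k%:~R) *: x.
  elim/neg_ind: k p x => k IH p x hx; have [k0|k0] := ltP k 0.
    case: (nP) => _ _ sur _ _; have [y [hy <-]] := sur _ _ _ k0 hx.
    rewrite -(compat _ _ _ k0 hy) -psi_br /=.
    have psiZ a u : psi (a *: u) = a *: psi u.
      have psi0 : psi 0 = 0 by have := psiL (-1) 0 0; rewrite scaler0 addr0 scaleN1r addNr.
      by rewrite -[a *: u]addr0 psiL psi0 addr0.
    rewrite -psiZ; congr psi; rewrite (b_span k0 hy) (glsa_br_sumr hG) scaler_sumr.
    apply: eq_bigr => i _; have [[di _]|ne] := eqVneq (dg i, pr i) (k, p).
      by rewrite (glsa_brZr hG) h_act di !scalerA mulrC.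
    by rewrite (cf0 hy ne) !scale0r scaler0 (glsa_br0r hG).
  apply/eqP; rewrite -subr_eq0; apply/eqP; apply: (tP (k := k) (p := p)) => //.
    apply: (glsa_homD prP); first by have := glsa_br_hom prP hh' hx; rewrite add0r.
    by apply: (glsa_homN prP); apply: (glsa_homZ prP).
  move=> q y hy; case: (nP) => _ _ sur _ _.
  rewrite (glsa_brDl prP) (glsa_brNl prP) (glsa_brZl prP).
  rewrite (glsa_jacobi_r prP hh' hx hy) /sgn.
  have hxy := glsa_br_hom prP hx hy.
  rewrite (IH (k - 1) _ k0 _ _ hxy); last by lia.
  rewrite (IH (-1) _ k0 _ _ hy); last by lia.
  rewrite (glsa_brZl prP) [gl_br y x](glsa_anti prP hy hx) /sgn.
  rewrite intrB; have := sgnM K p q; rewrite /sgn (andbC q p); set s := _ ^+ _ => ss.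
  rewrite !scalerN !scalerA -!scalerBl.
  have -> : lam * (k%:~R - 1%:~R) - s * (lam * (-1)%:~R) * s - lam * k%:~R =
     lam * (s * s - 1) by rewrite mulrNz; ring.
  by rewrite ss subrr mulr0 scale0r.
have [i0 [j0 w0]] := w_neq0.
have [x0 hx0 ex0] := prolong_elt hG hb cubF_hom.
have x0n : x0 != 0.
  apply: contraNneq w0 => x00; have := congr1 (fun A => A true [:: i0; j0]) ex0.
  by rewrite x00 /inj eqxx /= => <-.
have fx0 : gl_br f' x0 = 0.
  rewrite (glsa_anti prP hf' hx0); suff -> : gl_br x0 f' = 0 by rewrite scaler0 oppr0.
  have -> : f' = phiP hG hb (b z) by apply: compat (b_hom z); rewrite dz.
  rewrite (pb_phiP hG hb cf_dual); apply: val_inj; rewrite /= ex0.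
  rewrite (brP_inj hG hb) (brE_b hG hb cf_dual z cubF_hom).
  have -> : sh cubF z = fun=> 0; last by rewrite inj0.
  apply/funext => -[|i [|j [|k ys]]] //=; rewrite /sh /=.
    by rewrite w_supp //; left.
  by rewrite w_supp ?(glsa_br0l hG) //; left.
pose x m : P := iter m (gl_br e') x0.
have hx m : gl_hom (m%:Z * 2 + 1) true (x m).
  elim: m => [//|m IH]; have := glsa_br_hom prP he' IH.
  by have -> : 2 + (m%:Z * 2 + 1) = m.+1%:Z * 2 + 1 by lia.
have xS m : x m.+1 = gl_br e' (x m) by [].
have xO : x 0%N = x0 by [].
(* Each step adds the weight of the vector just raised, and [1 + 3 + ... + (2m+1) = (m+1)^2]. *)
have fx m : gl_br f' (x m.+1) = (- lam * (m.+1%:R) ^+ 2) *: x m.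
  elim: m => [|m IH]; rewrite xS (glsa_jacobi prP _ hf' he').
    rewrite xO fx0 (glsa_br0r prP) scaler0 addr0.
    rewrite (glsa_anti prP hf' he') -h'E (glsa_brNl prP) (glsa_brZl prP) (h'_act _ _ _ hx0).
    by rewrite /sgn expr0 scale1r expr1n mulr1 mulr1z mulr1 scaleNr.
  rewrite IH (glsa_anti prP hf' he') -h'E (glsa_brNl prP) (glsa_brZl prP) (h'_act _ _ _ (hx m.+1)).
  rewrite (glsa_brZr prP) -xS /sgn expr0 !scale1r -scaleNr -scalerDl; congr (_ *: _).
  rewrite intrD intrM -!pmulrn.
  have -> : (m.+2)%:R = m%:R + 2 :> K by rewrite -addn2 natrD.
  have -> : (m.+1)%:R = m%:R + 1 :> K by rewrite natr1.
  by ring.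
apply: (@InfDim_of_hom _ _ (fun m => m%:Z * 2 + 1) true) => //; first by move=> m m'; lia.
move=> m; exists (x m) => //; elim: m => [//|m IH].
apply: contraNneq IH => e0; have := fx m; rewrite e0 (glsa_br0r prP) => /esym/eqP.
rewrite scaler_eq0 mulf_eq0 oppr_eq0 (negPf lam0) expf_eq0 pnatr_eq0 /=.
by [].
Qed.
End OddContact.
End InfiniteDimension.

(** * Integer elimination *)

Section IntegerScalars.
Variable K : numFieldType.

Definition zK (z : Z) : K := (int_of_Z z)%:~R.

Lemma zK0 : zK Z0 = 0. Proof. by []. Qed.
Lemma zK1 : zK (Zpos xH) = 1. Proof. by []. Qed.
Lemma zKD x y : zK (Z.add x y) = zK x + zK y.
Proof. by rewrite /zK (raddfD int_of_Z) intrD. Qed.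
Lemma zKM x y : zK (Z.mul x y) = zK x * zK y.
Proof. by rewrite /zK (rmorphM int_of_Z) intrM. Qed.
Lemma zKN x : zK (Z.opp x) = - zK x.
Proof. by rewrite /zK (raddfN int_of_Z) mulrNz. Qed.
Lemma zKB x y : zK (Z.sub x y) = zK x - zK y.
Proof. by rewrite /Z.sub zKD zKN. Qed.
Lemma zK_eq0 x : (zK x == 0) = Z.eqb x 0.
Proof.
rewrite /zK intr_eq0; apply/eqP/Z.eqb_spec => [h|->//].
by rewrite -[x]int_of_ZK h.
Qed.
Lemma zK_inj : injective zK.
Proof.
move=> x y e; apply/eqP; have : zK (Z.sub x y) == 0 by rewrite zKB e subrr.
by rewrite zK_eq0 => /Z.eqb_eq h; apply/eqP; lia.
Qed.
End IntegerScalars.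
Arguments zK {K} z.

Definition lrow := seq (Z * Z).

Fixpoint radd (v c : Z) (r : lrow) : lrow :=
  if r is (w, d) :: r' then
    if Z.eqb v w then let e := Z.add c d in if Z.eqb e 0 then r' else (w, e) :: r'
    else (w, d) :: radd v c r'
  else if Z.eqb c 0 then [::] else [:: (v, c)].

Fixpoint rcomb (a : Z) (r s : lrow) : lrow :=
  if r is (v, c) :: r' then radd v (Z.mul a c) (rcomb a r' s) else s.

Fixpoint rsplit (v : Z) (r : lrow) : option (Z * lrow) :=
  if r is (w, c) :: r' then
    if Z.eqb v w then Some (c, r')
    else if rsplit v r' is Some (d, s) then Some (d, (w, c) :: s) else None
  else None.

(** Cross-multiplication with the pivot equation [c v + prow = 0] keeps all coefficients
    integral. *)
Definition reduce (v c : Z) (prow r : lrow) : lrow :=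
  if rsplit v r is Some (d, s) then rcomb (Z.opp d) prow (rcomb c s [::]) else r.

(* [pivot v rs acc best]: a row containing [v], preferably a singleton. *)
Fixpoint pivot (v : Z) (rs : seq lrow) (acc : seq lrow) (best : option (Z * lrow * lrow)) :
    option (Z * lrow * seq lrow) :=
  if rs is r :: rs' then
    if rsplit v r is Some (c, s) then
      if s is [::] then
        Some (c, s, if best is Some (_, _, r0) then r0 :: (rs' ++ acc) else rs' ++ acc)
      else if best is Some _ then pivot v rs' (r :: acc) best
      else pivot v rs' acc (Some (c, s, r))
    else pivot v rs' (r :: acc) best
  else if best is Some (c, s, _) then Some (c, s, acc) else None.

(** Certifies that a homogeneous system has only the zero solution. The rest of a pivot row may
    involve only variables later in the list, so the values vanish from the last variable backwards;
    a nonzero integer pivot is invertible in characteristic 0. *)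
Fixpoint elim_rows (rs : seq lrow) (vs : seq Z) : bool :=
  if vs is v :: vs' then
    if pivot v rs [::] None is Some (c, s, rest) then
      [&& ~~ Z.eqb c 0, all (fun t => t.1 \in vs') s
        & elim_rows (map (reduce v c s) rest) vs']
    else false
  else true.

Section Elimination.
Variables (K : numFieldType) (x : Z -> K).

Definition rval (r : lrow) : K := \sum_(t <- r) zK t.2 * x t.1.

Lemma rval_cons v c r : rval ((v, c) :: r) = zK c * x v + rval r.
Proof. by rewrite /rval big_cons. Qed.

Lemma rval_radd v c r : rval (radd v c r) = zK c * x v + rval r.
Proof.
elim: r => [|[w d] r IH] /=.
  case: Z.eqb_spec => [->|_]; first by rewrite zK0 mul0r add0r.
  by rewrite rval_cons.
case: Z.eqb_spec => [->|_]; last by rewrite !rval_cons IH addrCA.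
case: Z.eqb_spec => h; rewrite !rval_cons addrA -mulrDl -zKD ?h ?zK0 ?mul0r ?add0r //.
Qed.

Lemma rval_rcomb a r s : rval (rcomb a r s) = zK a * rval r + rval s.
Proof.
elim: r => [|[v c] r IH] /=; first by rewrite {2}/rval big_nil mulr0 add0r.
by rewrite rval_radd IH rval_cons zKM mulrDr -!mulrA addrA.
Qed.

Lemma rval_rsplit v r c s : rsplit v r = Some (c, s) -> rval r = zK c * x v + rval s.
Proof.
elim: r c s => [//|[w d] r IH] c s /=; case: Z.eqb_spec => [->|_].
  by move=> [<- <-]; rewrite rval_cons.
case: rsplit IH => [[c' s']|//] IH [<- <-].
by rewrite !rval_cons (IH _ _ erefl) addrCA.
Qed.

Lemma rval_reduce v c p r : zK c * x v + rval p = 0 -> rval r = 0 -> rval (reduce v c p r) = 0.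
Proof.
rewrite /reduce => hp; case e: rsplit => [[d s]|//]; rewrite (rval_rsplit e) => hr.
rewrite !rval_rcomb {3}/rval big_nil addr0 zKN.
have -> : rval p = - (zK c * x v) by apply/eqP; rewrite -addr_eq0 addrC hp.
have -> : rval s = - (zK d * x v) by apply/eqP; rewrite -addr_eq0 addrC hr.
by ring.
Qed.

Lemma pivotP v rs acc best c s rest : pivot v rs acc best = Some (c, s, rest) ->
  (forall r, r \in rs -> rval r = 0) -> (forall r, r \in acc -> rval r = 0) ->
  (if best is Some (c', s', r') then zK c' * x v + rval s' = 0 /\ rval r' = 0 else True) ->
  zK c * x v + rval s = 0 /\ forall r, r \in rest -> rval r = 0.
Proof.
elim: rs acc best => [|r rs IH] acc best /=.
  by case: best => [[[c' s'] r']|//] [<- <- <-] _ h [].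
move=> e hrs hacc hb.
have hr : rval r = 0 by apply: hrs; rewrite mem_head.
have hrs' q : q \in rs -> rval q = 0 by move=> h; apply: hrs; rewrite inE h orbT.
have hacc' q : q \in r :: acc -> rval q = 0 by rewrite inE => /predU1P[->|/hacc].
move: e; case er: rsplit => [[d t]|] e; last exact: (IH _ _ e).
have ht : zK d * x v + rval t = 0 by rewrite -(rval_rsplit er).
case: t er ht e => [|u t] er ht e.
  case: e => <- <- <-; split=> // q; case: best hb => [[[c' s'] r0] [_ h0]|_];
    rewrite ?inE mem_cat; last by case/orP => [/hrs'|/hacc].
  by case/or3P => [/eqP ->|/hrs'|/hacc].
case: best hb e => [best hb|_] e; first exact: (IH _ _ e).
exact: (IH _ _ e).
Qed.

Lemma elim_rowsP rs vs : elim_rows rs vs -> (forall r, r \in rs -> rval r = 0) ->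
  forall v, v \in vs -> x v = 0.
Proof.
elim: vs rs => [//|v vs IH] rs /=; case e: pivot => [[[c s] rest]|//].
case/and3P => c0 hs hel hrs.
have [||hp hrest] := pivotP e hrs => //.
have hvs : forall w, w \in vs -> x w = 0.
  apply: IH hel _ => r /mapP[q hq ->]; apply: rval_reduce => //; exact: hrest.
move=> w; rewrite inE => /predU1P[->|]; last exact: hvs.
move: hp; rewrite /rval big_seq big1 ?addr0 => [/eqP|t ht].
  by rewrite mulf_eq0 zK_eq0 (negPf c0) => /eqP.
by rewrite hvs ?mulr0 // (allP hs).
Qed.
End Elimination.

Delimit Scope Z_scope with zz.

(** * Structure constants from root data *)

(* Rank, number of positive roots, positive roots (coordinates in the simple roots) and their
   parities, Gram matrix of the simple roots, structure constants of the root vectors, and for each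
   non-simple root [k] a pair [(a, k')] with [a] simple and [k = a + k'].  Basis vectors are numbered
   with the Cartan subalgebra first, then the positive roots, then the negative ones in the same order. *)
Record rdata := RData {
  rk : nat; np : nat;
  posw : seq (seq Z);
  posp : seq bool;
  gram : seq (seq Z);
  nmat : seq (seq Z);
  parents : seq (nat * nat) }.

Definition zadd (v w : seq Z) : seq Z := [seq Z.add t.1 t.2 | t <- zip v w].
Definition zopp (v : seq Z) : seq Z := map Z.opp v.
Definition zdot (v w : seq Z) : Z := foldr Z.add Z0 [seq Z.mul t.1 t.2 | t <- zip v w].

Section RootData.
Variable d : rdata.
Definition rdim : nat := (rk d + (np d).*2)%N.
Definition rwts : seq (seq Z) := nseq (rk d) (nseq (rk d) Z0) ++ posw d ++ map zopp (posw d).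
Definition rpars : seq bool := nseq (rk d) false ++ posp d ++ posp d.
Definition rwt i := nth [::] rwts i.
Definition rpar i := nth false rpars i.
(** The element of the Cartan subalgebra that corresponds to root [i] under the invariant form, in
    the basis dual to the simple roots. It is not normalised by the square length, which vanishes
    for isotropic roots. *)
Definition rcor i : seq Z := [seq zdot r (rwt i) | r <- gram d].
Definition nz (v : seq (nat * Z)) := [seq t <- v | ~~ Z.eqb t.2 0].
Definition rbr i j : seq (nat * Z) :=
  if (i < rk d)%N then nz [:: (j, nth Z0 (rwt j) i)]
  else if (j < rk d)%N then nz [:: (i, Z.opp (nth Z0 (rwt i) j))]
  else let c := nth Z0 (nth [::] (nmat d) (i - rk d)%N) (j - rk d)%N in
       if Z.eqb c 0 then [::]
       else let w := zadd (rwt i) (rwt j) in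
       if w == nseq (rk d) Z0 then nz (zip (iota 0 (rk d)) [seq Z.mul c u | u <- rcor i])
       else [:: (index w rwts, c)].
Definition rtab := [seq [seq rbr i j | j <- iota 0 rdim] | i <- iota 0 rdim].
End RootData.

Section LsaTheory.
Variables (K : fieldType) (g : LSA K).
Hypothesis hg : IsLSA g.
Local Notation br := (@lsa_br K g).

Lemma lsa_brPl a (x y z : g) : br (a *: x + y) z = a *: br x z + br y z.
Proof. by case: hg => [[]]. Qed.
Lemma lsa_brPr a (x y z : g) : br z (a *: x + y) = a *: br z x + br z y.
Proof. by case: hg => [[]]. Qed.
Lemma lsa_br0l (z : g) : br 0 z = 0.
Proof. by apply: (addrI (br 0 z)); rewrite -{1}[br 0 z]scale1r -lsa_brPl scaler0 !addr0. Qed.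
Lemma lsa_br0r (z : g) : br z 0 = 0.
Proof. by apply: (addrI (br z 0)); rewrite -{1}[br z 0]scale1r -lsa_brPr scaler0 !addr0. Qed.
Lemma lsa_brZl a (x z : g) : br (a *: x) z = a *: br x z.
Proof. by rewrite -[a *: x]addr0 lsa_brPl lsa_br0l addr0. Qed.
Lemma lsa_brZr a (x z : g) : br z (a *: x) = a *: br z x.
Proof. by rewrite -[a *: x]addr0 lsa_brPr lsa_br0r addr0. Qed.
Lemma lsa_brBr (x y z : g) : br z (x - y) = br z x - br z y.
Proof. by rewrite addrC -scaleN1r lsa_brPr scaleN1r addrC. Qed.
Lemma lsa_br_suml (J : Type) (r : seq J) (Q : pred J) (f : J -> g) z :
  br (\sum_(j <- r | Q j) f j) z = \sum_(j <- r | Q j) br (f j) z.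
Proof.
apply: (big_morph (fun x => br x z)) => [x y|]; last exact: lsa_br0l.
by rewrite -[x]scale1r lsa_brPl !scale1r.
Qed.
Lemma lsa_br_sumr (J : Type) (r : seq J) (Q : pred J) (f : J -> g) z :
  br z (\sum_(j <- r | Q j) f j) = \sum_(j <- r | Q j) br z (f j).
Proof.
apply: (big_morph (fun x => br z x)) => [x y|]; last exact: lsa_br0r.
by rewrite -[x]scale1r lsa_brPr !scale1r.
Qed.
Lemma lsa_anti p q (x y : g) : x \in lsa_par g p -> y \in lsa_par g q ->
  br x y = - (sgn K p q *: br y x).
Proof. by case: hg => _ _ _ h _; apply: h. Qed.
Lemma lsa_jacobi p q (x y z : g) : x \in lsa_par g p -> y \in lsa_par g q ->
  br x (br y z) = br (br x y) z + sgn K p q *: br y (br x z).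
Proof. by case: hg => _ _ _ _ h; apply: h. Qed.
Lemma lsa_jacobi_l p q (x y z : g) : x \in lsa_par g p -> y \in lsa_par g q ->
  br (br x y) z = br x (br y z) - sgn K p q *: br y (br x z).
Proof. by move=> hx hy; rewrite (lsa_jacobi z hx hy) addrK. Qed.
End LsaTheory.

Lemma basis_coords (K : fieldType) (V : vectType K) (n : nat) (e : nat -> V) :
  basis_of fullv (mkseq e n) -> exists cf : nat -> V -> K,
  [/\ forall i a x y, cf i (a *: x + y) = a * cf i x + cf i y,
      forall v, v = \sum_(i < n) cf i v *: e i
    & forall i j, (i < n)%N -> (j < n)%N -> cf i (e j) = (i == j)%:R].
Proof.
move=> hb; have sz : size (mkseq e n) == n by rewrite size_mkseq.
pose X : n.-tuple V := Tuple sz.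
have XE (i : 'I_n) : X`_i = e i by rewrite /= nth_mkseq.
exists (fun i v => if insub i is Some j then coord X j v else 0); split.
- by move=> i a x y; case: insubP => [u _ _|_]; rewrite ?linearP // mulr0 addr0.
- move=> v; rewrite {1}(coord_basis (X := X) hb (memvf v)).
  by apply: eq_bigr => i _; rewrite valK XE.
- move=> i j hi hj; rewrite insubT -[e j](XE (Ordinal hj)) coord_free ?(basis_free hb) //.
by rewrite -val_eqE eq_sym.
Qed.

Lemma nth_zadd v w j : size v = size w -> nth Z0 (zadd v w) j = Z.add (nth Z0 v j) (nth Z0 w j).
Proof.
by elim: v w j => [|x v IH] [|y w] [|j] //= [h]; apply: IH.
Qed.
Lemma size_zadd v w : size v = size w -> size (zadd v w) = size v.
Proof. by move=> h; rewrite size_map size_zip h minnn. Qed.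
Lemma nth_zopp v j : nth Z0 (zopp v) j = Z.opp (nth Z0 v j).
Proof. by elim: v j => [|x v IH] [|j] //=. Qed.
Lemma zadd_sub u v : size u = size v ->
  zadd v (zopp (zadd u v)) = zopp u /\ zadd u (zopp (zadd u v)) = zopp v.
Proof.
elim: u v => [|x u IH] [|y v] //= [/IH [h1 h2]]; rewrite /zadd /zopp /= in h1 h2 *.
by split; congr (_ :: _) => //; lia.
Qed.
Lemma zadd_eq0 v w n : size v = n -> size w = n -> zadd v w = nseq n Z0 -> v = zopp w.
Proof.
elim: n v w => [|n IH] [|x v] [|y w] //= [sv] [sw] [h1 h2]; congr (_ :: _); first lia.
exact: IH.
Qed.
Lemma zdotE v w n : size v = n -> size w = n ->
  zdot v w = \big[Z.add/Z0]_(j < n) Z.mul (nth Z0 v j) (nth Z0 w j).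
Proof.
elim: n v w => [|n IH] [|x v] [|y w] //=; first by rewrite big_ord0.
by move=> [hv] [hw]; rewrite big_ord_recl /= -(IH v w).
Qed.

Definition ropp d i : nat := if (i < rk d + np d)%N then (i + np d)%N else (i - np d)%N.
Definition rroots d : seq nat := iota (rk d) (np d).*2.
Definition zrow (m : nat) (w : seq Z) : lrow := 
  [seq u <- [seq (Z.of_nat j, nth Z0 w j) | j <- iota 0 m] | ~~ Z.eqb u.2 0].
(** The roots strongly orthogonal to root [i]. Since [rwts] contains the weight 0, [i] and its
    opposite are excluded as well. *)
Definition orth d i : seq nat := [seq k <- rroots d |
  (zadd (rwt d i) (rwt d k) \notin rwts d) && (zadd (rwt d (ropp d i)) (rwt d k) \notin rwts d)].
Definition isot d i := rpar d i && (zadd (rwt d i) (rwt d i) \notin rwts d).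
Definition corrows d i : seq (seq Z) :=
  [seq rwt d k | k <- orth d i ++ (if isot d i then [:: i] else [::])].
Definition check_wts d : bool :=
  [&& (0 < rk d)%N, size (rwts d) == rdim d, all (fun w => size w == rk d) (rwts d), size (gram d) == rk d,
   uniq (drop (rk d) (rwts d)), nseq (rk d) Z0 \notin drop (rk d) (rwts d),
   all (fun i => rwt d (ropp d i) == zopp (rwt d i)) (rroots d)
   & all (fun i => rpar d (ropp d i) == rpar d i) (rroots d)].
(** The weights of [corrows] must vanish on [[e i, e (-i)]]. They also vanish on [rcor d i], and
    once its first nonzero coordinate [p0] is fixed no freedom is left, so they determine the line
    of the coroot. *)
Definition check_cor d : bool := all (fun i =>
  let u := rcor d i in let p0 := find (fun z => ~~ Z.eqb z 0) u in
  [&& (p0 < rk d)%N, all (fun w => Z.eqb (zdot w u) 0) (corrows d i)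
    & elim_rows ([:: (Z.of_nat p0, Zpos xH)] :: [seq zrow (rk d) w | w <- corrows d i])
        (map Z.of_nat (iota 0 (rk d)))]) (rroots d).
Definition indepz (u v : seq Z) : bool :=
  has (fun t => has (fun s => ~~ Z.eqb (Z.mul t.1 s.2) (Z.mul t.2 s.1)) (zip u v)) (zip u v).
(* The exceptional clauses deal with the roots [δ] and [2δ] of G(3), whose coroots are parallel. *)
Definition check_ideal d : bool := all (fun k => all (fun i =>
  let w := zadd (rwt d k) (rwt d i) in
  (w \notin drop (rk d) (rwts d)) ||
  let l := index w (rwts d) in
  [|| indepz (rcor d l) (rcor d k), k == i, l == ropp d i
    | [&& l == ropp d k, rpar d k & zadd (rwt d k) (rwt d k) == rwt d (ropp d i)]]) (rroots d)) (rroots d).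

Definition tb (T : seq (seq (seq (nat * Z)))) i j := nth [::] (nth [::] T i) j.
Definition vscale (z : Z) (v : seq (nat * Z)) := [seq (t.1, Z.mul z t.2) | t <- v].
Definition vcoef (v : seq (nat * Z)) (i : nat) : Z :=
  foldr (fun t s => if t.1 == i then Z.add t.2 s else s) Z0 v.
Definition veq (v w : seq (nat * Z)) : bool :=
  all (fun i => Z.eqb (vcoef v i) (vcoef w i)) (map fst v ++ map fst w).
Definition zsgn (p q : bool) : Z := if p && q then Zneg xH else Zpos xH.

Lemma mem_iota0 s m : (s < m)%N -> s \in iota 0 m.
Proof. by rewrite mem_iota. Qed.

Section SparseVectors.
Variables (K : numFieldType) (V : lmodType K) (b : nat -> V).
Definition svec (v : seq (nat * Z)) : V := \sum_(t <- v) zK t.2 *: b t.1.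
Local Notation vec := svec.

Lemma vec_nil : vec [::] = 0. Proof. exact: big_nil. Qed.
Lemma vec_cat v w : vec (v ++ w) = vec v + vec w. Proof. exact: big_cat. Qed.
Lemma vec_scale z v : vec (vscale z v) = zK z *: vec v.
Proof. by rewrite /svec big_map scaler_sumr; apply: eq_bigr => t _; rewrite /= zKM scalerA. Qed.

Lemma vec_coef v s : uniq s -> {subset map fst v <= s} ->
  vec v = \sum_(i <- s) zK (vcoef v i) *: b i.
Proof.
move=> us; elim: v => [|[k z] v IH] sub.
  by rewrite vec_nil big1 // => i _; rewrite scale0r.
rewrite /svec big_cons -/(vec v) {}IH => [|i iv]; last by apply: sub; rewrite inE iv orbT.
have ks : k \in s by apply: sub; rewrite mem_head.
rewrite (bigD1_seq k) //= [in RHS](bigD1_seq k) //= eqxx zKD scalerDl addrA; congr (_ + _).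
by apply: eq_bigr => i ne; rewrite eq_sym (negPf ne).
Qed.

Lemma vec_veq v w : veq v w -> vec v = vec w.
Proof.
move=> h; pose s := undup (map fst v ++ map fst w).
rewrite (@vec_coef v s) ?undup_uniq //; last by move=> i iv; rewrite mem_undup mem_cat iv.
rewrite (@vec_coef w s) ?undup_uniq //; last by move=> i iv; rewrite mem_undup mem_cat iv orbT.
rewrite big_seq [RHS]big_seq; apply: eq_bigr => i; rewrite mem_undup => hi.
by have /Z.eqb_spec -> := allP h i hi.
Qed.

End SparseVectors.

(** * Checks on a table of structure constants *)

Section TableChecks.
Variables (d : rdata) (T : seq (seq (seq (nat * Z)))).
Local Notation r := (rk d).
Local Notation t := (tb T).
Definition adl a (v : seq (nat * Z)) := flatten [seq vscale u.2 (t a u.1) | u <- v].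
Definition adr (v : seq (nat * Z)) k := flatten [seq vscale u.2 (t u.1 k) | u <- v].
Definition parent k := nth (0, 0)%N (parents d) (k - r)%N.

Definition check_tab := all (fun i => all (fun j =>
  if t i j is [::] then zadd (rwt d i) (rwt d j) \notin rwts d
  else all (fun u => (u.1 < rdim d)%N && (rwt d u.1 == zadd (rwt d i) (rwt d j))) (t i j))
  (rroots d)) (rroots d).

(** The brackets at hand at stage [m] of the induction: with a Cartan element, zero for weight
    reasons, or between a simple vector and a vector below [m] with all terms below [m]. *)
Definition kn lo m a l := [|| (l < r)%N, t a l == [::]
  | (lo <= l < m)%N && all (fun u => (u.1 < m)%N) (t a l)].
Definition check_parent lo k := let: (a, k') := parent k in
  [&& (lo <= a < lo + r)%N, (lo <= k' < k)%N & zadd (rwt d a) (rwt d k') == rwt d k].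
(* The bracket of [f] with [e, x], expanded by the Jacobi identity. *)
Definition fe f e l := adr (t f e) l ++ vscale (zsgn (rpar d f) (rpar d e)) (adl e (t f l)).
Definition fe_known lo m f e l :=
  all (fun u => (u.1 < r)%N) (t f e) && all (fun u => kn lo m e u.1) (t f l).
(** A simple vector of the opposite side that sends the root vector [k] to a nonzero multiple of an
    earlier one. It shows that the vector [k] is nonzero and detects multiples of it. *)
Definition fsel lo lo' k s : bool :=
  if t (lo' + s)%N k is [:: (l, z)] then ~~ Z.eqb z 0 && (lo <= l < k)%N else false.
Definition check_root lo lo' k :=
  let: (a, k') := parent k in
  let s0 := find (fsel lo lo' k) (iota 0 r) in
  let f0 := (lo' + s0)%N in
  [&& check_parent lo k,
     all (fun s => fe_known lo k (lo' + s)%N a k' && veq (t (lo' + s)%N k) (fe (lo' + s)%N a k')) (iota 0 r),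
     has (fsel lo lo' k) (iota 0 r)
   & all (fun s => [|| t (lo + s)%N k == [::] | ~~ all (fun u => (u.1 < k.+1)%N) (t (lo + s)%N k)] &&
       all (fun l => if t (lo + s)%N l is u :: v then (v == [::]) && ((u.1 != k) ||
         (fe_known lo k f0 (lo + s)%N l && veq (adl f0 (t (lo + s)%N l)) (fe f0 (lo + s)%N l)))
        else true) (iota lo (k - lo))) (iota 0 r)].
Definition check_simple lo lo' := all (fun s => all (fun s' =>
   ((s == s') || (t (lo' + s)%N (lo + s')%N == [::])) &&
   ((t (lo + s)%N (lo + s')%N == [::]) || ~~ all (fun u => (u.1 < lo + r)%N) (t (lo + s)%N (lo + s')%N)))
   (iota 0 r)) (iota 0 r).
Definition check_side lo lo' :=
  [&& check_simple lo lo', all (check_root lo lo') (iota (lo + r) (np d - r))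
    & all (fun s => all (fun l => all (fun u => (u.1 < lo + np d)%N) (t (lo + s)%N l))
        (iota lo (np d))) (iota 0 r)].
Definition nonsimple := iota (r + r) (np d - r) ++ iota (r + np d + r) (np d - r).
Definition check_rest := all (fun k => let: (a, k') := parent k in all (fun l =>
   veq (t k l) (adl a (t k' l) ++
     vscale (Z.opp (zsgn (rpar d a) (rpar d k'))) (adl k' (t a l)))) (iota 0 (rdim d))) nonsimple.
Definition check_norm := all (fun s => let e := (r + s)%N in let f := (r + np d + s)%N in
   veq (t e f) (zip (iota 0 r) (rcor d e)) &&
   veq (t f e) (vscale (Z.opp (zsgn (rpar d e) (rpar d f))) (t e f))) (iota 0 r).
(** Existence of the algebra is given, so the Jacobi identities are not verified for the table as a
    whole. The checks contain instances of them through which every entry follows from the simple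
    root vectors and their normalisation. *)
Definition check_table := [&& (r <= np d)%N, check_tab, check_side r (r + np d), check_side (r + np d) r,
  check_rest & check_norm].
End TableChecks.
Definition check_all d := [&& check_wts d, check_cor d, check_ideal d & check_table d (rtab d)].

(** * Uniqueness of the structure constants *)

Section Structure.
Variables (K : numFieldType) (d : rdata) (g : LSA K).
Hypothesis hg : IsLSA g.
Hypothesis simple : IsSimpleLSA g.
Variable e : nat -> g.
Local Notation br := (@lsa_br K g).
Local Notation n := (rdim d).
Local Notation r := (rk d).
Local Notation wt := (rwt d).
Local Notation par := (rpar d).
Local Notation opp := (ropp d).
Hypothesis e_basis : basis_of fullv (mkseq e n).
Hypothesis e_par : forall i, (i < n)%N -> e i \in lsa_par g (par i).
Hypothesis e_wt : forall j i, (j < r)%N -> (i < n)%N -> br (e j) (e i) = zK (nth Z0 (wt i) j) *: e i.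

Hypothesis ck_wts : check_wts d.

Let r_gt0 : (0 < r)%N. Proof. by case/and5P: ck_wts. Qed.
Let size_wts : size (rwts d) = n. Proof. by case/and5P: ck_wts => _ /eqP. Qed.
Let size_wt i : (i < n)%N -> size (wt i) = r.
Proof. by case/and5P: ck_wts => _ h1 h2 _ _ hi; apply/eqP/(allP h2)/mem_nth; rewrite size_wts. Qed.
Let size_gram : size (gram d) = r. Proof. by case/and5P: ck_wts => _ _ _ /eqP. Qed.
Let uniq_wts : uniq (drop r (rwts d)). Proof. by case/and5P: ck_wts => _ _ _ _ /and4P[]. Qed.
Let wt_neq0 : nseq r Z0 \notin drop r (rwts d).
Proof. by case/and5P: ck_wts => _ _ _ _ /and4P[]. Qed.
Let root_lt i : i \in rroots d -> (r <= i < n)%N.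
Proof. by rewrite mem_iota. Qed.
Let rootP i : (r <= i < n)%N -> i \in rroots d.
Proof. by rewrite mem_iota. Qed.
Let wt_opp i : i \in rroots d -> wt (opp i) = zopp (wt i).
Proof. by case/and5P: ck_wts => _ _ _ _ /and4P[_ _ h _] hi; apply/eqP/(allP h). Qed.
Let par_opp i : i \in rroots d -> par (opp i) = par i.
Proof. by case/and5P: ck_wts => _ _ _ _ /and4P[_ _ _ h] hi; apply/eqP/(allP h). Qed.
Let opp_root i : i \in rroots d -> opp i \in rroots d.
Proof. by rewrite !mem_iota /ropp -addnn; case: ifP; lia. Qed.
Let oppK i : i \in rroots d -> opp (opp i) = i.
Proof. by rewrite !mem_iota /ropp -addnn; do 2!case: ifP; lia. Qed.
Let wt_cartan j : (j < r)%N -> wt j = nseq r Z0.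
Proof. by move=> hj; rewrite /rwt /rwts nth_cat size_nseq hj nth_nseq hj. Qed.
Let par_cartan j : (j < r)%N -> par j = false.
Proof. by move=> hj; rewrite /rpar /rpars nth_cat size_nseq hj nth_nseq hj. Qed.
Let r_le_n : (r <= n)%N. Proof. exact: leq_addr. Qed.
Let wt_mem i : (r <= i < n)%N -> wt i \in drop r (rwts d).
Proof.
case/andP=> h1 h2; have -> : wt i = nth [::] (drop r (rwts d)) (i - r) by rewrite nth_drop subnKC.
by apply: mem_nth; rewrite size_drop size_wts ltn_sub2r // (leq_ltn_trans h1 h2).
Qed.
Let wt_inj k j : (r <= k < n)%N -> (r <= j < n)%N -> wt k = wt j -> k = j.
Proof.
move=> /andP[k1 k2] /andP[j1 j2] ekj.
have /eqP := ekj; rewrite -[k](subnKC k1) -[j](subnKC j1) /rwt -!nth_drop nth_uniq //.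
- by move=> /eqP ->.
- by rewrite size_drop size_wts ltn_sub2r // (leq_ltn_trans k1 k2).
- by rewrite size_drop size_wts ltn_sub2r // (leq_ltn_trans j1 j2).
Qed.
Let drop_idx w : w \in drop r (rwts d) ->
  (r <= index w (rwts d) < n)%N /\ wt (index w (rwts d)) = w.
Proof.
move=> hw; have hw' : w \in rwts d := mem_drop hw.
split; last by rewrite /rwt nth_index.
rewrite -size_wts index_mem hw' andbT leqNgt; apply/negP => hlt.
by move: wt_neq0; rewrite -(wt_cartan hlt) /rwt nth_index // hw.
Qed.

Lemma structure_e_neq0 i : (i < n)%N -> e i != 0.
Proof.
by move=> hi; apply: (free_not0 (basis_free e_basis)); apply: map_f; rewrite mem_iota.
Qed.

Definition Wt (x : g) (w : seq Z) := forall j, (j < r)%N -> br (e j) x = zK (nth Z0 w j) *: x.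

Lemma Wt_e i : (i < n)%N -> Wt (e i) (wt i).
Proof. by move=> hi j hj; apply: e_wt. Qed.

Lemma jac_cartan j x y : (j < r)%N -> br (e j) (br x y) = br (br (e j) x) y + br x (br (e j) y).
Proof.
move=> hj; have hjn : (j < n)%N := leq_trans hj r_le_n.
have he : e j \in lsa_par g false by rewrite -(par_cartan hj); apply: e_par.
have hp p z : z \in lsa_par g p -> br (e j) (br z y) = br (br (e j) z) y + br z (br (e j) y).
  by move=> hz; rewrite (lsa_jacobi hg y he hz) /sgn /= expr0 scale1r.
case: (hg) => _ [hs _] _ _ _; have : x \in (lsa_par g false + lsa_par g true)%VS by rewrite hs memvf.
case/memv_addP => x0 h0 [x1 h1 ->]; rewrite -[x0]scale1r !(lsa_brPl hg, lsa_brPr hg) !scale1r.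
by rewrite (hp _ _ h0) (hp _ _ h1) addrACA.
Qed.

Lemma Wt_br x y w w' : size w = r -> size w' = r -> Wt x w -> Wt y w' -> Wt (br x y) (zadd w w').
Proof.
move=> sw sw' hx hy j hj; rewrite jac_cartan // hx // hy // (lsa_brZl hg) (lsa_brZr hg).
by rewrite -scalerDl nth_zadd ?sw // zKD.
Qed.

Lemma Wt_lin a x y w : Wt x w -> Wt y w -> Wt (a *: x + y) w.
Proof.
by move=> hx hy j hj; rewrite (lsa_brPr hg) hx // hy // scalerDr !scalerA mulrC.
Qed.

Variable cf : nat -> g -> K.
Hypothesis cfP : forall i a x y, cf i (a *: x + y) = a * cf i x + cf i y.
Hypothesis cfE : forall v, v = \sum_(i < n) cf i v *: e i.
Hypothesis cf_dual : forall i j, (i < n)%N -> (j < n)%N -> cf i (e j) = (i == j)%:R.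

Let cf0 i : cf i 0 = 0.
Proof. by have := cfP i (-1) 0 0; rewrite scaler0 addr0 mulN1r addNr. Qed.
Let cfZ i a x : cf i (a *: x) = a * cf i x.
Proof. by rewrite -[a *: x]addr0 cfP cf0 addr0. Qed.
Let cf_sum i m (c : nat -> K) : (i < n)%N -> (m <= n)%N ->
  cf i (\sum_(j < m) c j *: e j) = if (i < m)%N then c i else 0.
Proof.
move=> hi; elim: m => [|m IH] hm; first by rewrite big_ord0 cf0.
rewrite big_ord_recr /= addrC cfP (IH (ltnW hm)) cf_dual //.
have [<-|ne] := eqVneq i m; first by rewrite ltnn ltnS leqnn mulr1 addr0.
by rewrite mulr0 add0r ltnS [(i <= m)%N]leq_eqVlt (negPf ne).
Qed.

Lemma cf_ext x y : (forall i, (i < n)%N -> cf i x = cf i y) -> x = y.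
Proof. by move=> h; rewrite (cfE x) (cfE y); apply: eq_bigr => i _; rewrite h. Qed.

Lemma Wt_supp x w i : size w = r -> Wt x w -> (i < n)%N -> wt i != w -> cf i x = 0.
Proof.
move=> sw hx hi ne; apply/eqP; apply: contraNT ne => nz.
apply/eqP/(@eq_from_nth _ Z0); rewrite size_wt // => j hj.
apply: (@zK_inj K); apply/eqP; rewrite -subr_eq0.
have := congr1 (cf i) (hx j hj); rewrite cfZ {1}(cfE x) (lsa_br_sumr hg).
under eq_bigr => k _ do rewrite (lsa_brZr hg) e_wt // scalerA.
rewrite (@cf_sum i n (fun k => cf k x * zK (nth Z0 (wt k) j))) // hi => /eqP.
by rewrite mulrC -subr_eq0 -mulrBl mulf_eq0 (negPf nz) orbF.
Qed.

Lemma Wt_none x w : size w = r -> Wt x w -> w \notin rwts d -> x = 0.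
Proof.
move=> sw hx nw; apply: cf_ext => i hi; rewrite cf0; apply: (Wt_supp _ hx hi) => //.
by apply: contraNneq nw => <-; rewrite /rwt mem_nth ?size_wts.
Qed.

Lemma Wt_one x i : (r <= i < n)%N -> Wt x (wt i) -> x = cf i x *: e i.
Proof.
move=> hi hx; have [h1 h2] := andP hi; apply: cf_ext => j hj; rewrite cfZ cf_dual //.
have [->|ne] := eqVneq j i; first by rewrite mulr1.
rewrite mulr0; apply: (Wt_supp _ hx hj); first exact: size_wt.
have [jr|jr] := ltnP j r; last first.
  by apply: contraNneq ne => /wt_inj -> //; rewrite jr.
by rewrite wt_cartan //; apply: contraNneq wt_neq0 => ->; apply: wt_mem.
Qed.

Definition vecH (u : seq Z) : g := \sum_(j < r) zK (nth Z0 u j) *: e j.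

Lemma Wt_zero x : Wt x (nseq r Z0) -> x = \sum_(j < r) cf j x *: e j.
Proof.
move=> hx; apply: cf_ext => i hi; rewrite (@cf_sum i r (fun j => cf j x)) //.
case: ltnP => // ri; apply: (Wt_supp _ hx hi); first by rewrite size_nseq.
by apply: contraNneq wt_neq0 => <-; apply: wt_mem; rewrite ri.
Qed.

Lemma zadd_opp i : i \in rroots d -> zadd (wt i) (wt (opp i)) = nseq r Z0.
Proof.
move=> hi; have [h1 h2] := andP (root_lt hi).
have s1 : size (wt i) = r by apply: size_wt.
apply: (@eq_from_nth _ Z0); rewrite size_zadd ?wt_opp ?size_map ?s1 ?size_nseq // => j hj.
by rewrite nth_zadd ?size_map // nth_zopp nth_nseq hj; lia.
Qed.

Definition hh i := br (e i) (e (opp i)).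

Lemma hh_zero i : i \in rroots d -> Wt (hh i) (nseq r Z0).
Proof.
move=> hi; have [h1 h2] := andP (root_lt hi); have [h3 h4] := andP (root_lt (opp_root hi)).
by rewrite -(zadd_opp hi); apply: Wt_br; rewrite ?size_wt //; apply: Wt_e.
Qed.

Lemma hh_opp i : i \in rroots d -> hh (opp i) = - (sgn K (par i) (par i) *: hh i).
Proof.
move=> hi; have [h1 h2] := andP (root_lt hi); have [h3 h4] := andP (root_lt (opp_root hi)).
by rewrite /hh oppK // (lsa_anti hg (e_par h4) (e_par h2)) par_opp.
Qed.

Lemma br_none i j : (i < n)%N -> (j < n)%N -> zadd (wt i) (wt j) \notin rwts d -> br (e i) (e j) = 0.
Proof.
move=> hi hj; apply: Wt_none; first by rewrite size_zadd !size_wt.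
by apply: Wt_br; rewrite ?size_wt //; apply: Wt_e.
Qed.

Lemma br_one i j l : (i < n)%N -> (j < n)%N -> (r <= l < n)%N -> zadd (wt i) (wt j) = wt l ->
  br (e i) (e j) = cf l (br (e i) (e j)) *: e l.
Proof.
by move=> hi hj hl ew; apply: Wt_one => //; rewrite -ew; apply: Wt_br; rewrite ?size_wt //; apply: Wt_e.
Qed.

Lemma br_cartan x k : Wt x (nseq r Z0) -> (k < n)%N ->
  br x (e k) = (\sum_(j < r) cf j x * zK (nth Z0 (wt k) j)) *: e k.
Proof.
move=> hx hk; rewrite {1}(Wt_zero hx) (lsa_br_suml hg) scaler_suml; apply: eq_bigr => j _.
by rewrite (lsa_brZl hg) e_wt // scalerA.
Qed.

Hypothesis ck_cor : check_cor d.

Lemma nth_rcor_size i : size (rcor d i) = r. Proof. by rewrite size_map size_gram. Qed.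

Lemma rval_zrow (x : Z -> K) m w :
  rval x (zrow m w) = \sum_(j < m) zK (nth Z0 w j) * x (Z.of_nat j).
Proof.
rewrite -(big_mkord xpredT (fun j => zK (nth Z0 w j) * x (Z.of_nat j))) /index_iota subn0.
rewrite /rval /zrow big_filter big_mkcond big_map; apply: eq_bigr => j _ /=.
by case: ifP => // /negbFE/Z.eqb_spec ->; rewrite zK0 mul0r.
Qed.

Lemma zK_zdot v w : size v = r -> size w = r ->
  zK (zdot v w) = \sum_(j < r) zK (nth Z0 v j) * zK (nth Z0 w j) :> K.
Proof.
move=> sv sw; rewrite (zdotE sv sw) (big_morph zK (@zKD K) (zK0 K)).
by apply: eq_bigr => j _; rewrite zKM.
Qed.

Lemma hh_orth i k : i \in rroots d -> k \in orth d i ++ (if isot d i then [:: i] else [::]) ->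
  br (hh i) (e k) = 0.
Proof.
move=> hi; have [h1 h2] := andP (root_lt hi); have [h3 h4] := andP (root_lt (opp_root hi)).
rewrite mem_cat => /orP[|].
  rewrite mem_filter => /andP[/andP[n1 n2] /root_lt /andP[k1 k2]].
  rewrite (lsa_jacobi_l hg _ (e_par h2) (e_par h4)) (br_none h4 k2 n2) (br_none h2 k2 n1).
  by rewrite !(lsa_br0r hg) scaler0 subr0.
case: ifP => // /andP[p1 n1]; rewrite inE => /eqP ->.
(* For odd [e i] with [[e i, e i] = 0] the Jacobi identity reads [[e i, hh i] = - [e i, hh i]]. *)
have := lsa_jacobi hg (e (opp i)) (e_par h2) (e_par h2).
rewrite (br_none h2 h2 n1) (lsa_br0l hg) add0r /sgn p1 expr1 scaleN1r -/(hh i) => /eqP.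
rewrite -addr_eq0 -mulr2n -scaler_nat scaler_eq0 pnatr_eq0 /= => /eqP e0.
have hc : hh i \in lsa_par g false.
  case: (hg) => _ _ hp _ _; have := hp _ _ _ _ (e_par h2) (e_par h4).
  by rewrite par_opp // addbb.
by rewrite (lsa_anti hg hc (e_par h2)) e0 scaler0 oppr0.
Qed.

Lemma hh_line i : i \in rroots d -> exists t, hh i = t *: vecH (rcor d i).
Proof.
move=> hi; have /and3P[] := allP ck_cor i hi.
set u := rcor d i; set p0 := find _ _ => hp0 hu hel; have [h1 h2] := andP (root_lt hi).
have su : size u = r by apply: nth_rcor_size.
have u0 : zK (nth Z0 u p0) != 0 :> K.
  by rewrite zK_eq0; apply: (@nth_find _ Z0 (fun z => ~~ Z.eqb z 0)); rewrite has_find su.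
(* The scalar is forced by the coordinate [p0]; the difference then solves the system of [check_cor]
   and is zero. *)
exists (cf p0 (hh i) / zK (nth Z0 u p0)); set t := _ / _.
pose x (z : Z) := cf (Z.to_nat z) (hh i) - t * zK (nth Z0 u (Z.to_nat z)).
have hrows q : q \in [:: (Z.of_nat p0, Zpos xH)] :: [seq zrow r w | w <- corrows d i] -> rval x q = 0.
  rewrite inE => /predU1P[->|/mapP[w /[dup] hw /mapP[k hk ek] ->]].
    by rewrite /rval big_seq1 /= zK1 mul1r /x Nat2Z.id /t divfK // subrr.
  have kn : (k < n)%N.
    move: hk; rewrite mem_cat mem_filter => /orP[/andP[_ /root_lt /andP[]//]|].
    by case: ifP => // _; rewrite inE => /eqP ->.
  have swk : size w = r by rewrite ek size_wt.
  rewrite rval_zrow; under eq_bigr => j _ do rewrite /x Nat2Z.id mulrBr mulrCA.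
  rewrite big_split /= sumrN -mulr_sumr -zK_zdot //.
  have := allP hu w hw => /Z.eqb_spec ->; rewrite zK0 mulr0 subr0.
  have := hh_orth hi hk; rewrite (br_cartan (hh_zero hi)) // => /eqP.
  rewrite scaler_eq0 (negPf (structure_e_neq0 kn)) orbF => /eqP {2}<-.
  by rewrite ek; apply: eq_bigr => j _; rewrite mulrC.
have hx := elim_rowsP hel hrows.
rewrite {1}(Wt_zero (hh_zero hi)) /vecH scaler_sumr; apply: eq_bigr => j _.
rewrite scalerA; congr (_ *: _); apply/eqP; rewrite -subr_eq0.
have := hx (Z.of_nat j); rewrite /x Nat2Z.id => -> //.
by apply: map_f; rewrite mem_iota /=.
Qed.

Hypothesis ck_ideal : check_ideal d.

Lemma vecH_indep u v a b : size u = r -> size v = r -> indepz u v ->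
  a *: vecH u = b *: vecH v -> a = 0.
Proof.
move=> su sv /hasP[[u1 v1] h1] /hasP[[u2 v2] h2] /= ne eq.
have cfH j w : (j < r)%N -> cf j (vecH w) = zK (nth Z0 w j).
  move=> hj; rewrite /vecH (@cf_sum j r (fun j => zK (nth Z0 w j))) //; last exact: leq_trans hj _.
  by rewrite hj.
have zn p : p \in zip u v -> exists2 j, (j < r)%N & p = (nth Z0 u j, nth Z0 v j).
  move=> hp; exists (index p (zip u v)).
    by have := index_mem p (zip u v); rewrite hp size_zip su sv minnn.
  by rewrite -nth_zip ?su ?sv // nth_index.
move: ne; have [j' hj' [e1 e2]] := zn _ h1; have [k' hk' [e3 e4]] := zn _ h2.
rewrite e1 e2 e3 e4 => ne.
have := congr1 (cf j') eq; have := congr1 (cf k') eq; rewrite !cfZ !cfH // => q1 q2.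
apply/eqP; have : a * zK (Z.sub (Z.mul (nth Z0 u j') (nth Z0 v k')) (Z.mul (nth Z0 v j') (nth Z0 u k'))) == 0.
  rewrite zKB !zKM mulrBr mulrA q2 [X in _ - X]mulrCA q1.
  by apply/eqP; ring.
rewrite mulf_eq0 zK_eq0 => /orP[//|/Z.eqb_spec h].
by case/negP: ne; apply/Z.eqb_spec/Zminus_eq.
Qed.

(** Put [l = k + i]. Once [hh i = 0], the Jacobi identity for [e k], [e i], [e (-l)] equates a
    nonzero multiple of [hh l] with a multiple of [hh k]. In general the two lie on different lines,
    so [hh l] vanishes. *)
Lemma bad_step k i : k \in rroots d -> i \in rroots d -> hh i = 0 ->
  zadd (wt k) (wt i) \in drop r (rwts d) ->
  br (e k) (e i) != 0 -> hh (index (zadd (wt k) (wt i)) (rwts d)) = 0.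
Proof.
move=> hk hi bad hw; have [hl ew] := drop_idx hw; set l := index _ _ in hl ew *.
have [k1 k2] := andP (root_lt hk); have [i1 i2] := andP (root_lt hi).
have [l1 l2] := andP hl; have hlr := rootP hl.
have [k3 k4] := andP (root_lt (opp_root hk)); have [i3 i4] := andP (root_lt (opp_root hi)).
have [l3 l4] := andP (root_lt (opp_root hlr)).
have eN := br_one k2 i2 hl (esym ew); set N := cf l _ in eN => nz.
have N0 : N != 0 by apply: contraNneq nz => h; rewrite eN h scale0r.
have sz q : (q < n)%N -> size (wt q) = r by move=> hq; apply: size_wt.
have [wk wi] : zadd (wt i) (wt (opp l)) = wt (opp k) /\ zadd (wt k) (wt (opp l)) = wt (opp i).
  by rewrite !wt_opp // ew; apply: zadd_sub; rewrite !sz.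
have e1 := br_one i2 l4 (root_lt (opp_root hk)) wk.
have e2 := br_one k2 l4 (root_lt (opp_root hi)) wi.
have key : N *: hh l = cf (opp k) (br (e i) (e (opp l))) *: hh k.
  rewrite /hh -(lsa_brZl hg) -eN (lsa_jacobi_l hg _ (e_par k2) (e_par i2)) e1 e2.
  by rewrite !(lsa_brZr hg) -/(hh k) -/(hh i) bad !scaler0 subr0 cfZ cf_dual // eqxx mulr1.
have /= := allP (allP ck_ideal k hk) i hi; rewrite hw /= -/l => /or4P[ind|/eqP eki|/eqP eli|].
- have [t et] := hh_line hlr; have [s es] := hh_line hk.
  move: key; rewrite et es !scalerA => /(vecH_indep (nth_rcor_size _) (nth_rcor_size _) ind).
  by move=> /eqP; rewrite mulf_eq0 (negPf N0) /= => /eqP ->; rewrite scale0r.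
- by move: key; rewrite eki bad scaler0 => /eqP; rewrite scaler_eq0 (negPf N0) => /eqP.
- by rewrite eli hh_opp // bad scaler0 oppr0.
(* Here [2 k = - i] and [l = - k] with [k] odd. The Jacobi identity for [e k], [e k], [e i] gives
   [2 N hh k = 0], because [[e (-i), e i] = 0]. *)
case/and3P => /eqP elk pk /eqP w2.
have e3 := br_one k2 k2 (root_lt (opp_root hi)) w2.
have := lsa_jacobi_l hg (e i) (e_par k2) (e_par k2).
rewrite e3 (lsa_brZl hg) {1}/sgn pk expr1 scaleN1r opprK eN (lsa_brZr hg) elk -/(hh k).
have -> : br (e (opp i)) (e i) = 0.
  by have := hh_opp hi; rewrite bad scaler0 oppr0 /hh oppK.
rewrite scaler0 -scalerDr => /esym/eqP; rewrite scaler_eq0 (negPf N0) /= -mulr2n -scaler_nat.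
by rewrite scaler_eq0 pnatr_eq0 /= => /eqP h0; rewrite hh_opp // h0 scaler0 oppr0.
Qed.

(** By [bad_step] the root vectors with [hh k = 0] span a graded ideal. It has no component in the
    Cartan subalgebra, so it is proper, and simplicity makes it zero. *)
Lemma hh_neq0 i : i \in rroots d -> hh i != 0.
Proof.
move=> hi0; pose bad := [seq k <- rroots d | hh k == 0].
pose X := in_tuple (map e bad); pose J : {vspace g} := (<<X>>)%VS.
have badP k : k \in bad -> k \in rroots d /\ hh k = 0.
  by rewrite mem_filter => /andP[/eqP].
have eJ k : k \in bad -> e k \in J by move=> hk; apply: memv_span; apply: map_f.
have ideal x y : y \in J -> br x y \in J.
  move=> hy; rewrite (coord_span hy) (lsa_br_sumr hg); apply: memv_suml => m _.
  rewrite (lsa_brZr hg); apply: memvZ.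
  have [k hk ->] : exists2 k, k \in bad & X`_m = e k.
    have hm : (m < size bad)%N by case: m => m /=; rewrite size_map.
    by exists (nth 0%N bad m); [apply: mem_nth|rewrite (nth_map 0%N)].
  have [hkr bk] := badP _ hk; have [k1 k2] := andP (root_lt hkr).
  rewrite (cfE x) (lsa_br_suml hg); apply: memv_suml => j _; rewrite (lsa_brZl hg); apply: memvZ.
  have [jr|jr] := ltnP j r; first by rewrite e_wt //; apply/memvZ/eJ.
  have hj : (j : nat) \in rroots d by apply: rootP; rewrite jr /=.
  have [->|nz] := eqVneq (br (e j) (e k)) 0; first exact: mem0v.
  have [hw|hw] := boolP (zadd (wt j) (wt k) \in drop r (rwts d)).
    have [hl ew] := drop_idx hw; rewrite (br_one _ _ hl) //; apply/memvZ/eJ.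
    by rewrite mem_filter rootP // andbT; apply/eqP/bad_step.
  have [hw'|hw'] := boolP (zadd (wt j) (wt k) \in rwts d); last first.
    by move: nz; rewrite br_none ?eqxx.
  have w0 : zadd (wt j) (wt k) = nseq r Z0.
    move: hw'; rewrite -{1}(cat_take_drop r (rwts d)) mem_cat (negPf hw) orbF.
    rewrite /rwts take_cat size_nseq ltnn subnn take0 cats0 mem_nseq => /andP[_ /eqP].
    by [].
  have ejk : (j : nat) = opp k.
    apply: wt_inj; rewrite ?jr //=; first exact: root_lt (opp_root hkr).
    by rewrite wt_opp //; apply: zadd_eq0 w0; rewrite size_wt.
  by move: nz; rewrite ejk; have := hh_opp hkr; rewrite /hh oppK // -/(hh k) bk scaler0 oppr0 => ->; rewrite eqxx.
have graded : (J = (J :&: lsa_par g false) + (J :&: lsa_par g true))%VS.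
  apply: subv_anti; apply/andP; split; last by rewrite subv_add !capvSl.
  apply/span_subvP => _ /mapP[k hk ->]; have [/root_lt /andP[_ kn] _] := badP _ hk.
  have := e_par kn; have := eJ _ hk; case: (par k) => h1 h2.
    by apply: (subvP (addvSr _ _)); rewrite memv_cap h1.
  by apply: (subvP (addvSl _ _)); rewrite memv_cap h1.
case: simple => _ /(_ J graded ideal) [J0|J1].
  apply/negP => h0; have : e i \in J by apply: eJ; rewrite mem_filter h0.
  have [_ i2] := andP (root_lt hi0).
  by rewrite J0 memv0 (negPf (structure_e_neq0 i2)).
have h0n : (0 < n)%N := leq_trans r_gt0 r_le_n.
have : cf 0%N (e 0%N) = 0.
  have h0J : e 0%N \in J by rewrite J1 memvf.
  rewrite (coord_span h0J).
  have : forall s : seq 'I_(size (map e bad)), cf 0%N (\sum_(m <- s) coord X m (e 0%N) *: X`_m) = 0.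
    elim=> [|m s IH]; first by rewrite big_nil cf0.
    rewrite big_cons cfP IH addr0.
    have hm : (m < size bad)%N by case: m => m /=; rewrite size_map.
    rewrite (nth_map 0%N) //; have := mem_nth 0%N hm; set k := nth _ _ _ => /badP [/root_lt /andP[k1 k2] _].
    rewrite cf_dual // (_ : (0%N == k) = false) ?mulr0 //.
    by apply/negbTE; rewrite eq_sym -lt0n (leq_trans r_gt0).
  by apply.
by rewrite cf_dual // eqxx => /eqP; rewrite oner_eq0.
Qed.

Local Notation T := (tb (rtab d)).

Lemma tbE i j : (i < n)%N -> (j < n)%N -> T i j = rbr d i j.
Proof.
move=> hi hj; rewrite /tb /rtab (nth_map 0%N) ?size_iota // (nth_map 0%N) ?size_iota //.
by rewrite !nth_iota.
Qed.

Section Scaled.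
Variable c : nat -> K.
Hypothesis c_cartan : forall j, (j < r)%N -> c j = 1.
Definition bb i := c i *: e i.
Local Notation b := bb.
Local Notation vec := (svec b).
Definition Kn i j := br (b i) (b j) = vec (T i j).

Lemma adl_Kn a v : (forall u, u \in v -> Kn a u.1) -> br (b a) (vec v) = vec (adl (rtab d) a v).
Proof.
elim: v => [|u v IH] h; first by rewrite vec_nil (lsa_br0r hg).
rewrite /svec big_cons (lsa_brPr hg) -/(vec v) IH => [|w hw]; last by apply: h; rewrite inE hw orbT.
by rewrite /adl /= -/(vec _) vec_cat vec_scale h // mem_head.
Qed.

Lemma adr_Kn v k : (forall u, u \in v -> Kn u.1 k) -> br (vec v) (b k) = vec (adr (rtab d) v k).
Proof.
elim: v => [|u v IH] h; first by rewrite vec_nil (lsa_br0l hg).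
rewrite /svec big_cons (lsa_brPl hg) -/(vec v) IH => [|w hw]; last by apply: h; rewrite inE hw orbT.
by rewrite /adr /= -/(vec _) vec_cat vec_scale h // mem_head.
Qed.

Lemma b_par i : (i < n)%N -> b i \in lsa_par g (par i).
Proof. by move=> hi; apply/memvZ/e_par. Qed.

Lemma Wt_b i : (i < n)%N -> Wt (b i) (wt i).
Proof.
move=> hi j hj; rewrite /bb (lsa_brZr hg) e_wt // !scalerA.
by rewrite mulrC.
Qed.

Lemma b_cartan j : (j < r)%N -> b j = e j.
Proof. by move=> hj; rewrite /bb c_cartan // scale1r. Qed.

Lemma vec_nz v : vec (nz v) = vec v.
Proof.
rewrite /nz /svec big_filter big_mkcond; apply: eq_bigr => u _; case: ifP => // /negbFE/Z.eqb_spec ->.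
by rewrite zK0 scale0r.
Qed.

Lemma Kn_cartanl j i : (j < r)%N -> (i < n)%N -> Kn j i.
Proof.
move=> hj hi; have hjn : (j < n)%N := leq_trans hj r_le_n.
by rewrite /Kn tbE // /rbr ifT // vec_nz /svec big_seq1 /= b_cartan // (Wt_b hi).
Qed.

Lemma Kn_cartanr j i : (j < r)%N -> (i < n)%N -> Kn i j.
Proof.
move=> hj hi; have hjn : (j < n)%N := leq_trans hj r_le_n.
have [ir|ir] := ltnP i r; first exact: Kn_cartanl.
rewrite /Kn tbE // /rbr [(i < r)%N]ltnNge ir ifT // vec_nz /svec big_seq1 /= zKN.
rewrite (lsa_anti hg (b_par hi) (b_par hjn)) (par_cartan hj) /sgn andbF expr0 scale1r.
by rewrite b_cartan // (Wt_b hi) // scaleNr.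
Qed.

Hypothesis ck_tab : check_tab d (rtab d).

Lemma Kn_nil i j : i \in rroots d -> j \in rroots d -> T i j = [::] -> Kn i j.
Proof.
move=> hi hj h; have [_ i2] := andP (root_lt hi); have [_ j2] := andP (root_lt hj).
have := allP (allP ck_tab i hi) j hj; rewrite h => hw.
by rewrite /Kn h vec_nil /bb (lsa_brZl hg) (lsa_brZr hg) br_none // !scaler0.
Qed.

Lemma tab_lt i j u : (i < n)%N -> (j < n)%N -> u \in T i j -> (u.1 < n)%N.
Proof.
move=> hi hj; have [ir|ir] := ltnP i r.
  by rewrite tbE // /rbr ifT // mem_filter inE => /andP[_ /eqP ->].
have [jr|jr] := ltnP j r.
  by rewrite tbE // /rbr [(i < r)%N]ltnNge ir ifT // mem_filter inE => /andP[_ /eqP ->].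
have := allP (allP ck_tab i (rootP _)) j (rootP _); rewrite ir jr => /(_ hi hj).
by case: (T i j) => // w v /allP h /h /andP[].
Qed.

Lemma tab_wt i j u : i \in rroots d -> j \in rroots d -> u \in T i j -> wt u.1 = zadd (wt i) (wt j).
Proof.
move=> hi hj; have := allP (allP ck_tab i hi) j hj.
by case: (T i j) => // w v /allP h /h /andP[_ /eqP].
Qed.

Lemma br_wt i j : (i < n)%N -> (j < n)%N -> Wt (br (b i) (b j)) (zadd (wt i) (wt j)).
Proof. by move=> hi hj; apply: Wt_br; rewrite ?size_wt //; apply: Wt_b. Qed.

(** * One triangular half, generated by its simple root vectors *)

Section Side.
Variables lo lo' : nat.
Hypothesis lo_root : forall k, (k < np d)%N -> (lo + k)%N \in rroots d.
Hypothesis lo'_root : forall k, (k < np d)%N -> (lo' + k)%N \in rroots d.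
Hypothesis r_np : (r <= np d)%N.
Hypothesis ck : check_side d (rtab d) lo lo'.
Hypothesis c_simple : forall s, (s < r)%N -> c (lo + s)%N != 0.
Hypothesis Kn_fe : forall s, (s < r)%N -> Kn (lo' + s)%N (lo + s)%N.
Hypothesis b_parent : forall k, (lo + r <= k < lo + np d)%N ->
  b k = br (b (parent d k).1) (b (parent d k).2).

Let lo_r s : (s < r)%N -> (lo + s)%N \in rroots d.
Proof. by move=> hs; apply/lo_root/(leq_trans hs). Qed.
Let lo'_r s : (s < r)%N -> (lo' + s)%N \in rroots d.
Proof. by move=> hs; apply/lo'_root/(leq_trans hs). Qed.
Let rng k : (lo <= k < lo + np d)%N -> k \in rroots d.
Proof.
case/andP=> h1 h2; rewrite -(subnKC h1); apply: lo_root.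
by rewrite -(ltn_add2l lo) subnKC.
Qed.
Let root_n k : k \in rroots d -> (k < n)%N. Proof. by move=> /root_lt /andP[]. Qed.

(** Roots are treated in table order, and [m] is the first one not yet reached. Brackets with simple
    vectors of the opposite side are known outright, those with simple vectors of the same side only
    when all terms stay below [m]. *)
Definition Inv m := [/\ forall k, (lo <= k < m)%N -> c k != 0,
  forall s k, (s < r)%N -> (lo <= k < m)%N -> Kn (lo' + s)%N k
  & forall s l, (s < r)%N -> (lo <= l < m)%N -> all (fun u => (u.1 < m)%N) (T (lo + s)%N l) ->
      Kn (lo + s)%N l].

Lemma inv_base : Inv (lo + r)%N.
Proof.
have /and3P[cks _ _] := ck.
have split_lo k : (lo <= k < lo + r)%N -> exists2 s, (s < r)%N & k = (lo + s)%N.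
  by case/andP=> h1 h2; exists (k - lo)%N; rewrite ?subnKC // -(ltn_add2l lo) subnKC.
have cks' s s' (h : (s < r)%N) (h' : (s' < r)%N) :=
   allP (allP cks s (mem_iota0 h)) s' (mem_iota0 h').
split.
- by move=> k /split_lo [s hs ->]; apply: c_simple.
- move=> s k hs /split_lo [s' hs' ->]; have /andP[/predU1P[->|/eqP h] _] := cks' s s' hs hs'.
    exact: Kn_fe.
  by apply: Kn_nil => //; [apply: lo'_r|apply: lo_r].
- move=> s k hs /split_lo [s' hs' ->]; have /andP[_ /orP[/eqP h _|/negP h /h//]] := cks' s s' hs hs'.
  by apply: Kn_nil => //; apply: lo_r.
Qed.

Lemma fe_vec m f x l : Inv m -> (m <= lo + np d)%N -> f \in rroots d ->
  (exists2 s, (s < r)%N & x = (lo + s)%N) -> (lo <= l < m)%N ->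
  Kn f x -> Kn f l -> fe_known d (rtab d) lo m f x l ->
  br (b f) (br (b x) (b l)) = vec (fe d (rtab d) f x l).
Proof.
move=> [_ _ inv] mle hf [s hs ->] hl k1 k2 /andP[/allP kn1 /allP kn2].
have hx := lo_r hs; have [hl1 hl2] := andP hl.
have hlr : l \in rroots d by apply: rng; rewrite hl1 (leq_trans hl2).
rewrite (lsa_jacobi hg _ (b_par (root_n hf)) (b_par (root_n hx))) k1 k2 /fe vec_cat vec_scale.
rewrite adr_Kn => [|u /kn1 hu]; last by apply: Kn_cartanl hu _; apply: root_n.
rewrite adl_Kn => [|u hu].
  by congr (_ + _ *: _); rewrite /sgn /zsgn; case: ifP; rewrite ?expr1 ?expr0.
have un : (u.1 < n)%N := tab_lt (root_n hf) (root_n hlr) hu.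
case/or3P: (kn2 u hu) => [ur|/eqP h0|/andP[h1 h2]].
- by apply: Kn_cartanr => //; apply: root_n.
- have [ur|ur] := ltnP u.1 r; first by apply: Kn_cartanr => //; apply: root_n.
  by apply: Kn_nil => //; apply: rootP; rewrite ur.
- exact: inv.
Qed.

(** The parents of [m] give its brackets with the simple vectors of the opposite side. One of these,
    [f0], produces a nonzero multiple of an earlier vector, so [b m] is nonzero. If some other
    bracket has weight [m], its error against the table is a multiple of [b m] killed by [f0], hence
    zero; different ways to reach a root need not be compared directly. *)
Lemma inv_step m : (lo + r <= m < lo + np d)%N -> Inv m -> Inv m.+1.
Proof.
move=> /[dup] hm /andP[m1 m2] inv; have [invA invB invC] := inv; have /and3P[_ ckr _] := ck.
have lom : (lo <= m)%N by apply: leq_trans m1; apply: leq_addr.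
have hmr : m \in rroots d by apply: rng; rewrite lom.
have := allP ckr m; rewrite mem_iota -addnA subnKC // m1 m2 => /(_ isT).
have := b_parent hm; rewrite /check_root /check_parent; case: (parent d m) => a k' /=.
set s0 := find _ _; set f0 := (lo' + s0)%N => bm /and4P[].
move=> /and3P[/andP[a1 a2] /andP[k1 k2] /eqP wm] cki hasf ckiii.
have [sa hsa ea] : exists2 s, (s < r)%N & a = (lo + s)%N.
  by exists (a - lo)%N; rewrite ?subnKC // -(ltn_add2l lo) subnKC.
have mle : (m <= lo + np d)%N := ltnW m2.
have hk'r : k' \in rroots d by apply: rng; rewrite k1 (ltn_trans k2).
have simple_in s : (s < r)%N -> (lo <= lo + s < m)%N.
  by move=> hs; rewrite leq_addr /= (leq_trans _ m1) // ltn_add2l.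
have KB s : (s < r)%N -> Kn (lo' + s)%N m.
  move=> hs; have /andP[kn1 ve] := allP cki s (mem_iota0 hs).
  rewrite /Kn (vec_veq _ ve) bm; apply: (fe_vec inv) => //.
  - exact: lo'_r.
  - by exists sa.
  - by rewrite k1.
  - by rewrite ea; apply: invB => //; apply: simple_in.
  - by apply: invB => //; rewrite k1.
have hs0 : (s0 < r)%N by move: hasf; rewrite has_find size_iota.
have : fsel (rtab d) lo lo' m s0.
  by have := nth_find 0%N hasf; rewrite -/s0 nth_iota.
rewrite /fsel -/f0; case ef: (T f0 m) => [//|[l z] [|//]] /andP[z0 hl].
have hl' : (lo <= l < m)%N by [].
have cl0 := invA l hl'; have lr : l \in rroots d by apply: rng; case/andP: hl' => -> /ltn_trans ->.
have ef0 : br (b f0) (b m) = zK z *: b l by rewrite (KB s0 hs0) ef /svec big_seq1.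
have cm0 : c m != 0.
  apply/eqP => cm; move: ef0; rewrite [b m]/bb cm scale0r (lsa_br0r hg) /bb scalerA => /esym/eqP.
  rewrite scaler_eq0 mulf_eq0 zK_eq0 (negPf z0) (negPf cl0) /=; apply/negP.
  exact: structure_e_neq0 (root_n lr).
have ltS k : (lo <= k < m.+1)%N -> (lo <= k < m)%N \/ k = m.
  by case/andP=> h1; rewrite ltnS leq_eqVlt => /predU1P[->|h2]; [right|left; rewrite h1].
split.
- by move=> k /ltS [/invA|->].
- by move=> s k hs /ltS [/(invB s k hs)|->] //; apply: KB.
move=> s k hs hk; have hmr1 : (r <= m < n)%N := root_lt hmr.
have hsr := lo_r hs.
have hkr : k \in rroots d.
  by apply: rng; case/andP: hk => -> /= hk; apply: leq_ltn_trans m2; rewrite -ltnS.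
have /andP[cks1 cks2] := allP ckiii s (mem_iota0 hs).
have [hkm|ekm] := ltS k hk; last first.
  by rewrite ekm; case/orP: cks1 => [/eqP h0 _|/negP h /h //]; apply: Kn_nil.
have := allP cks2 k; rewrite mem_iota subnKC // => /(_ hkm).
case eT: (T (lo + s)%N k) => [|u v]; first by move=> _ _; apply: Kn_nil.
case/andP=> /eqP ev; rewrite ev /= andbT => hu um.
have [uE|une] := eqVneq u.1 m; last first.
  apply: invC => //; rewrite eT ev /= andbT; move: um.
  by rewrite ltnS leq_eqVlt (negPf une).
move: hu; rewrite uE eqxx /= => /andP[kn1 ve].
have hf0 : f0 \in rroots d by apply: lo'_r.
have hfe : br (b f0) (br (b (lo + s)%N) (b k)) = vec (adl (rtab d) f0 (T (lo + s)%N k)).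
  rewrite (vec_veq _ _ : vec (adl _ _ _) = vec (fe d (rtab d) f0 (lo + s)%N k)); last by rewrite eT ev.
  apply: (fe_vec inv) => //; first by exists s.
  - by apply: invB => //; apply: simple_in.
  - exact: invB.
have hw : Wt (br (b (lo + s)%N) (b k) - vec (T (lo + s)%N k)) (wt m).
  rewrite addrC -scaleN1r; apply: Wt_lin.
    rewrite eT ev /svec big_seq1 uE => j hj; rewrite (lsa_brZr hg) (Wt_b (root_n hmr)) //.
    by rewrite scalerA mulrC -scalerA.
  by rewrite -uE (tab_wt hsr hkr (u := u)) ?eT ?mem_head //; apply: br_wt; apply: root_n.
have := Wt_one hmr1 hw; set y := cf m _ => ey.
have : br (b f0) (br (b (lo + s)%N) (b k) - vec (T (lo + s)%N k)) = 0.
  rewrite (lsa_brBr hg) hfe adl_Kn ?subrr // => w; rewrite eT ev inE => /eqP ->.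
  by rewrite uE; apply: KB.
rewrite ey (lsa_brZr hg) => h0.
have : y *: br (b f0) (b m) = 0 by rewrite /bb (lsa_brZr hg) scalerA mulrC -scalerA h0 scaler0.
rewrite ef0 /bb !scalerA => /eqP; rewrite scaler_eq0 (negPf (structure_e_neq0 (root_n lr))) orbF.
rewrite !mulf_eq0 zK_eq0 (negPf z0) (negPf cl0) !orbF => /eqP y0.
by move: ey; rewrite y0 scale0r => /eqP; rewrite subr_eq0 => /eqP.
Qed.

Lemma inv_end : Inv (lo + np d)%N.
Proof.
have h m : (m <= np d - r)%N -> Inv (lo + r + m)%N.
  elim: m => [|m IH] hm; first by rewrite addn0; apply: inv_base.
  rewrite addnS; apply: inv_step; last by apply: IH; apply: ltnW.
  by rewrite leq_addr /= -addnA ltn_add2l -(subnKC r_np) ltn_add2l.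
by have := h _ (leqnn _); rewrite -addnA subnKC.
Qed.
End Side.

Hypothesis ck_table : check_table d (rtab d).
Hypothesis c_pos : forall s, (s < r)%N -> c (r + s)%N != 0.
Hypothesis c_neg : forall s, (s < r)%N -> c (r + np d + s)%N != 0.
Hypothesis Kn_ef : forall s, (s < r)%N -> Kn (r + s)%N (r + np d + s)%N.
Hypothesis b_parent : forall k, k \in nonsimple d -> b k = br (b (parent d k).1) (b (parent d k).2).

Let pos_root k : (k < np d)%N -> (r + k)%N \in rroots d.
Proof. by move=> hk; rewrite mem_iota leq_addr ltn_add2l -addnn ltn_addr. Qed.
Let neg_root k : (k < np d)%N -> (r + np d + k)%N \in rroots d.
Proof. by move=> hk; rewrite mem_iota -addnA leq_addr ltn_add2l -addnn ltn_add2l. Qed.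
Let r_np : (r <= np d)%N. Proof. by case/andP: ck_table. Qed.

Lemma Kn_fe s : (s < r)%N -> Kn (r + np d + s)%N (r + s)%N.
Proof.
move=> hs; have hsn := leq_trans hs r_np.
have [_ h1] := andP (root_lt (pos_root hsn)); have [_ h2] := andP (root_lt (neg_root hsn)).
have /and5P[_ _ _ _ /andP[_ ckn]] := ck_table.
have /andP[_ ve] := allP ckn s (mem_iota0 hs).
rewrite /Kn (vec_veq _ ve) vec_scale (lsa_anti hg (b_par h2) (b_par h1)) (Kn_ef hs) zKN scaleNr.
by congr (- (_ *: _)); rewrite sgnC /sgn /zsgn; case: ifP; rewrite ?expr1 ?expr0.
Qed.

Lemma pos_end : Inv r (r + np d) (r + np d).
Proof.
have /and5P[_ _ ck1 _ _] := ck_table.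
apply: inv_end => //; first exact: Kn_fe.
by move=> k hk; apply: b_parent; rewrite mem_cat mem_iota -addnA subnKC // hk.
Qed.
Lemma neg_end : Inv (r + np d) r (r + np d + np d).
Proof.
have /and5P[_ _ _ ck2 _] := ck_table.
apply: inv_end => //.
by move=> k hk; apply: b_parent; rewrite mem_cat !mem_iota -!addnA subnKC // !addnA hk orbT.
Qed.

Lemma root_cases k : k \in rroots d -> (r <= k < r + np d)%N \/ (r + np d <= k < r + np d + np d)%N.
Proof.
rewrite mem_iota -addnn addnA => /andP[h1 h2].
by have [h3|h3] := ltnP k (r + np d)%N; [left; rewrite h1|right].
Qed.

Lemma c_neq0 i : (i < n)%N -> c i != 0.
Proof.
move=> hi; have [ir|ir] := ltnP i r; first by rewrite c_cartan // oner_eq0.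
have [h1 _ _] := pos_end; have [h2 _ _] := neg_end.
by case: (@root_cases i); [apply: rootP; rewrite ir|apply: h1|apply: h2].
Qed.

Lemma Kn_gen i j : (j < n)%N ->
  (exists2 s, (s < r)%N & i = (r + s)%N \/ i = (r + np d + s)%N) -> Kn i j.
Proof.
move=> hj [s hs hi].
have [_ b1 c1] := pos_end; have [_ b2 c2] := neg_end.
have /and5P[_ _ /and3P[_ _ t1] /and3P[_ _ t2] _] := ck_table.
have hsn := leq_trans hs r_np.
have hin : (i < n)%N by case: hi => ->; [have := pos_root hsn|have := neg_root hsn] => /root_lt /andP[].
have [jr|jr] := ltnP j r; first exact: Kn_cartanr.
case: (@root_cases j) => [|hj1|hj1]; first by apply: rootP; rewrite jr.
- case: hi => ->; last exact: b1.
  apply: c1 => //; apply: (allP (allP t1 s (mem_iota0 hs))).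
  by rewrite mem_iota.
- case: hi => ->; first exact: b2.
  apply: c2 => //; apply: (allP (allP t2 s (mem_iota0 hs))).
  by rewrite mem_iota.
Qed.

Lemma parentP k : k \in nonsimple d ->
  exists2 s, (s < r)%N & [/\ (parent d k).1 = (r + s)%N \/ (parent d k).1 = (r + np d + s)%N,
    (parent d k).2 \in rroots d, ((parent d k).2 < k)%N, ((parent d k).1 < k)%N
    & zadd (wt (parent d k).1) (wt (parent d k).2) = wt k /\ k \in rroots d].
Proof.
have /and5P[_ _ /and3P[_ t1 _] /and3P[_ t2 _] _] := ck_table.
have core lo : (forall q, (q < np d)%N -> (lo + q)%N \in rroots d) ->
    (lo + r <= k < lo + np d)%N -> check_parent d lo k ->
    exists2 s, (s < r)%N & [/\ (parent d k).1 = (lo + s)%N, (parent d k).2 \in rroots d,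
      ((parent d k).2 < k)%N, ((parent d k).1 < k)%N
      & zadd (wt (parent d k).1) (wt (parent d k).2) = wt k /\ k \in rroots d].
  move=> lo_root /andP[h1 h2]; rewrite /check_parent; case: (parent d k) => a k' /=.
  have rng q : (lo <= q < lo + np d)%N -> q \in rroots d.
    case/andP=> q1 q2; rewrite -(subnKC q1); apply: lo_root.
    by rewrite -(ltn_add2l lo) subnKC.
  case/and3P=> /andP[a1 a2] /andP[k1 k2] /eqP ew; exists (a - lo)%N.
    by rewrite -(ltn_add2l lo) subnKC.
  split=> //; first by rewrite subnKC.
  - by apply: rng; rewrite k1 (ltn_trans k2).
  - exact: leq_trans a2 h1.
  - by split=> //; apply: rng; rewrite h2 andbT (leq_trans _ h1) // leq_addr.
rewrite mem_cat => /orP[] hk.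
  have := allP t1 k hk; rewrite /check_root; case ep: (parent d k) => [a k'] /and4P[ckp _ _ _].
  have hk2 : (r + r <= k < r + np d)%N by move: hk; rewrite mem_iota -addnA subnKC.
  have [s hs [h1 h2 h3 h4 [h5 h6]]] := core r pos_root hk2 ckp.
  by exists s => //; move: h1 h2 h3 h4 h5; rewrite ep => h1 h2 h3 h4 h5; split=> //; left.
have := allP t2 k hk; rewrite /check_root; case ep: (parent d k) => [a k'] /and4P[ckp _ _ _].
have hk2 : (r + np d + r <= k < r + np d + np d)%N.
  by move: hk; rewrite mem_iota -(addnA (r + np d)%N) subnKC.
have [s hs [h1 h2 h3 h4 [h5 h6]]] := core _ neg_root hk2 ckp.
by exists s => //; move: h1 h2 h3 h4 h5; rewrite ep => h1 h2 h3 h4 h5; split=> //; right.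
Qed.

Lemma simple_cases k : k \in rroots d -> k \notin nonsimple d ->
  exists2 s, (s < r)%N & k = (r + s)%N \/ k = (r + np d + s)%N.
Proof.
move=> hk; rewrite mem_cat !mem_iota -!addnA !subnKC // !addnA negb_or.
case: (root_cases hk) => /andP[h1 h2].
  rewrite h2 andbT -ltnNge => /andP[h3 _]; exists (k - r)%N; last by left; rewrite subnKC.
  by rewrite -(ltn_add2l r) subnKC.
rewrite h2 andbT -[X in _ && X]ltnNge => /andP[_ h3]; exists (k - (r + np d))%N; last by right; rewrite subnKC.
by rewrite -(ltn_add2l (r + np d)) subnKC.
Qed.

(** A nonsimple left factor is the bracket of a simple vector with an earlier one, so the Jacobi
    identity allows induction along the order of the roots. *)
Lemma Kn_all i j : (i < n)%N -> (j < n)%N -> Kn i j.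
Proof.
elim/ltn_ind: i j => i IH j hi hj.
have [ir|ir] := ltnP i r; first exact: Kn_cartanl.
have hir : i \in rroots d by apply: rootP; rewrite ir.
have [hns|hs] := boolP (i \in nonsimple d); last by apply: Kn_gen => //; apply: simple_cases.
have /and5P[_ _ _ _ /andP[ckr _]] := ck_table.
have [s hs [h1 h2 h3 h4 _]] := parentP hns.
have := allP ckr i hns; have bi := b_parent hns; case: (parent d i) h1 h2 h3 h4 bi => a k' /= h1 h2 h3 h4 bi.
move=> /allP /(_ j (mem_iota0 hj)) ve.
have an : (a < n)%N := ltn_trans h4 hi; have kn' : (k' < n)%N := ltn_trans h3 hi.
have gen u : (u < n)%N -> Kn a u by move=> hu; apply: Kn_gen => //; exists s.
rewrite /Kn (vec_veq _ ve) vec_cat vec_scale bi (lsa_jacobi_l hg _ (b_par an) (b_par kn')).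
rewrite (IH k' h3 j kn' hj) (gen j hj) !adl_Kn.
- by rewrite zKN scaleNr; congr (_ - _ *: _); rewrite /sgn /zsgn; case: ifP; rewrite ?expr1 ?expr0.
- by move=> u hu; apply: IH => //; apply: tab_lt hu.
- by move=> u hu; apply: gen; apply: tab_lt hu.
Qed.
End Scaled.

Hypothesis ck_table : check_table d (rtab d).

Theorem structure_constants_cf : exists b : nat -> g,
  [/\ forall i, (i < n)%N -> exists2 c, c != 0 & b i = c *: e i,
      forall j, (j < r)%N -> b j = e j
    & forall i j, (i < n)%N -> (j < n)%N ->
        br (b i) (b j) = \sum_(t <- T i j) zK t.2 *: b t.1].
Proof.
have /and5P[r_np ck_tab _ _ /andP[_ ckn]] := ck_table.
have pos_root k : (k < np d)%N -> (r + k)%N \in rroots d.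
  by move=> hk; rewrite mem_iota leq_addr ltn_add2l -addnn ltn_addr.
have tex s : exists t : K, (s < r)%N -> t != 0 /\ hh (r + s)%N = t *: vecH (rcor d (r + s)%N).
  have [hs|hs] := ltnP s r; last by exists 0.
  have hr := pos_root s (leq_trans hs r_np).
  have [t et] := hh_line hr; exists t; split=> //.
  by apply: contraNneq (hh_neq0 hr) => t0; rewrite et t0 scale0r.
pose t s := projT1 (cid (tex s)).
have tP s : (s < r)%N -> t s != 0 /\ hh (r + s)%N = t s *: vecH (rcor d (r + s)%N).
  by rewrite /t; case: cid.
(* The vectors of positive simple roots are kept and those of negative ones divided by [t], so that
   [[e_s, f_s]] becomes the prescribed coroot. The values at nonsimple roots are placeholders. *)
pose c0 i := if (i < r + np d)%N then 1 else (t (i - (r + np d))%N)^-1.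
(* The remaining scalars are fixed one root at a time by making each nonsimple vector the bracket of
   its parents, which come earlier in the order. *)
have ex m : exists c : nat -> K, (forall i, i \notin nonsimple d -> c i = c0 i) /\
    (forall k, (k < m)%N -> k \in nonsimple d ->
       bb c k = br (bb c (parent d k).1) (bb c (parent d k).2)).
  elim: m => [|m [c [h1 h2]]]; first by exists c0.
  have [hm|hm] := boolP (m \in nonsimple d); last first.
    exists c; split=> // k; rewrite ltnS leq_eqVlt => /predU1P[->|]; last exact: h2.
    by rewrite (negPf hm).
  pose x := br (bb c (parent d m).1) (bb c (parent d m).2).
  pose c' i := if i == m then cf m x else c i; exists c'.
  have c'E i : i != m -> bb c' i = bb c i by move=> ne; rewrite /bb /c' (negPf ne).
  split; first by move=> i hi; rewrite /c'; case: eqP => [e0|_]; [rewrite e0 hm in hi|apply: h1].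
  move=> k km hk; have [s hs [_ hk2 h3 h4 [ew hkr]]] := parentP ck_table hk.
  have ne1 : (parent d k).1 != m by rewrite neq_ltn (leq_trans h4).
  have ne2 : (parent d k).2 != m by rewrite neq_ltn (leq_trans h3).
  rewrite (c'E _ ne1) (c'E _ ne2).
  have [ekm|ne] := eqVneq k m; last by rewrite c'E // h2 // ltn_neqAle ne -ltnS.
  rewrite ekm -/x {1}/bb /c' eqxx [RHS](@Wt_one x m) //; first by rewrite -ekm; apply: root_lt.
  rewrite -ekm -ew /x -ekm; have [_ kn] := andP (root_lt hkr).
  by apply: br_wt; [apply: ltn_trans h4 kn|apply: ltn_trans h3 kn].
have [c [h1 h2]] := ex n.
have nsr k : k \in nonsimple d -> (r + r <= k)%N /\ ((k < r + np d)%N || (r + np d + r <= k)%N).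
  rewrite mem_cat !mem_iota -!addnA !subnKC // => /orP[/andP[-> ->]//|/andP[h3 _]].
  by rewrite h3 orbT; split=> //; apply: leq_trans h3; rewrite leq_add2l (leq_trans r_np) // leq_addr.
have csmall i : (i < r + r)%N -> c i = 1.
  move=> hi; rewrite h1; last by apply/negP => /nsr [h3 _]; rewrite ltnNge h3 in hi.
  by rewrite /c0 (leq_trans hi) // leq_add2l.
have cneg s : (s < r)%N -> c (r + np d + s)%N = (t s)^-1.
  move=> hs; rewrite h1; first by rewrite /c0 ltnNge leq_addr /= addKn.
  apply/negP => /nsr [_]; rewrite ltnNge leq_addr /= leq_add2l leqNgt hs //.
have c_cartan j : (j < r)%N -> c j = 1 by move=> hj; rewrite csmall // ltn_addr.
have c_pos s : (s < r)%N -> c (r + s)%N != 0.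
  by move=> hs; rewrite csmall ?oner_eq0 // ltn_add2l.
have c_neg s : (s < r)%N -> c (r + np d + s)%N != 0.
  by move=> hs; rewrite cneg // invr_eq0; case: (tP s hs).
have Kn_ef s : (s < r)%N -> Kn c (r + s)%N (r + np d + s)%N.
  move=> hs; have /andP[ve _] := allP ckn s (mem_iota0 hs); have [t0 et] := tP s hs.
  have eopp : opp (r + s)%N = (r + np d + s)%N.
    by rewrite /ropp ltn_add2l (leq_trans hs r_np) addnAC.
  rewrite /Kn (vec_veq _ ve) /bb (lsa_brZl hg) (lsa_brZr hg) cneg // csmall ?ltn_add2l // scale1r.
  rewrite -eopp -/(hh _) et scalerA mulVf // scale1r /vecH /svec.
  have zipE : zip (iota 0 r) (rcor d (r + s)%N) = [seq (j, nth Z0 (rcor d (r + s)%N) j) | j <- iota 0 r].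
    apply: (@eq_from_nth _ (0%N, Z0)); first by rewrite size_zip size_iota nth_rcor_size minnn size_map size_iota.
    move=> q; rewrite size_zip size_iota nth_rcor_size minnn => hq.
    by rewrite nth_zip ?size_iota ?nth_rcor_size // (nth_map 0%N) ?size_iota // nth_iota.
  rewrite zipE big_map -(big_mkord xpredT (fun j => zK (nth Z0 (rcor d (r + s)%N) j) *: e j)).
  rewrite /index_iota subn0 big_seq [RHS]big_seq; apply: eq_bigr => j; rewrite mem_iota => /andP[_ hj] /=.
  by rewrite /bb c_cartan // scale1r.
have h2' k : k \in nonsimple d -> bb c k = br (bb c (parent d k).1) (bb c (parent d k).2).
  move=> hk; apply: h2 => //; have [s hs [_ _ _ _ [_ /root_lt /andP[]]]] := parentP ck_table hk.
  by [].
exists (bb c); split.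
- by move=> i hi; exists (c i) => //; apply: c_neq0.
- by move=> j hj; rewrite /bb c_cartan // scale1r.
- by move=> i j hi hj; apply: Kn_all.
Qed.
End Structure.

(** * Gradings and vanishing of cohomology *)

Section GradingChecks.
(* [T]: structure constants, [we]: weights encoded as single integers, [dgl]: degrees, [pl]: parities. *)
Variables (T : seq (seq (seq (nat * Z)))) (n : nat) (we dgl : seq Z) (pl : seq bool) (rk np : nat).
Local Notation t := (tb T).
Definition zdg i : Z := nth Z0 dgl i.
Definition wcode i : Z := nth Z0 we i.
Definition pcode i : bool := nth false pl i.
Definition negl := [seq i <- iota 0 n | Z.ltb (zdg i) Z0].
Definition neg1l := [seq i <- iota 0 n | Z.eqb (zdg i) (Zneg xH)].

Definition check_homog := all (fun i => all (fun j => all (fun u =>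
  [&& (u.1 < n)%N, Z.eqb (zdg u.1) (Z.add (zdg i) (zdg j)), Z.eqb (wcode u.1) (Z.add (wcode i) (wcode j))
    & pcode u.1 == pcode i (+) pcode j]) (t i j)) (iota 0 n)) (iota 0 n).

Definition gen_by a s a' := if t s a' is [:: (l, z)] then [&& l == a, ~~ Z.eqb z 0 & Z.ltb (zdg a) (zdg a')] else false.
Definition check_gen (neg neg1 : seq nat) := all (fun a =>
  (a \in neg1) || has (fun s => has (gen_by a s) neg) neg1) neg.

(* Linear functionals recovering an element of nonnegative degree from its action on the negative part. *)
Definition gauge (neg : seq nat) k : seq (nat * nat * Z) :=
  if (k < rk)%N then
    if Z.ltb (zdg (rk + k)%N) Z0 then [:: (rk + k, rk + k, Zpos xH)]%N
    else if Z.ltb Z0 (zdg (rk + k)%N) then [:: (rk + np + k, rk + np + k, Zneg xH)]%N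
    else let a := head 0%N [seq a <- neg | t (rk + k)%N a != [::]] in
         let l := (head (0%N, Z0) (t (rk + k)%N a)).1 in [:: (a, a, Zneg xH); (l, l, Zpos xH)]
  else let a := head 0%N [seq a <- neg | t k a != [::]] in
       [:: (a, (head (0%N, Z0) (t k a)).1, Zpos xH)].
Definition gauge_pair neg k k' : Z :=
  foldr Z.add Z0 [seq Z.mul u.2 (vcoef (t k' u.1.1) u.1.2) | u <- gauge neg k].
(** Diagonality of the pairing lets an element be read off one coordinate at a time, which makes the
    inner part of a cocycle explicit. *)
Definition check_gauge (neg : seq nat) := let nn := [seq k <- iota 0 n | Z.leb Z0 (zdg k)] in
  all (fun k => [&& ~~ Z.eqb (gauge_pair neg k k) 0,
     all (fun k' => (k == k') || Z.eqb (gauge_pair neg k k') Z0) nn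
   & all (fun u => [&& u.1.1 \in neg, (u.1.2 < n)%N, Z.eqb (zdg u.1.2) (Z.add (zdg k) (zdg u.1.1))
        & pcode u.1.2 == pcode k (+) pcode u.1.1]) (gauge neg k)]) nn.

(** One integer for the unknown coordinate [l] of the value at [a]; it can be decoded because
    [check_grading] demands [n <= 64]. *)
Definition key (a l : nat) : Z := Z.add (Z.mul (Zpos 64) (Z.of_nat a)) (Z.of_nat l).
(** A derivation that vanishes in degree -1 is zero, so only the weights of its possible values
    there matter. They are finitely many, although [d] runs over all degrees from [dmin] on. *)
Definition nus (neg1 : seq nat) (dmin : Z) : seq (Z * bool) :=
  undup [seq (Z.sub (wcode l) (wcode a), pcode l (+) pcode a)
  | a <- neg1, l <- [seq l <- iota 0 n | Z.leb dmin (Z.sub (zdg l) (zdg a))]].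
Definition wclass (neg : seq nat) (nu : Z) : seq (nat * seq nat) :=
  [seq (a, let w := Z.add nu (wcode a) in [seq l <- iota 0 n | Z.eqb (wcode l) w]) | a <- neg].
Definition lookup (c : seq (nat * seq nat)) j := head [::] [seq u.2 | u <- c & u.1 == j].
Definition split_rows (es : seq (nat * (Z * Z))) : seq lrow :=
  [seq foldr (fun u q => if u.1 == k then radd u.2.1 u.2.2 q else q) [::] es | k <- undup (map fst es)].
(** The cocycle identity for the pair [a], [a']. Each entry carries the coordinate of the scalar
    equation to which it belongs, and [split_rows] sorts by it. *)
Definition der_entries (p : bool) (c : seq (nat * seq nat)) a La a' La' : seq (nat * (Z * Z)) :=
  [seq (k, (key u.1 k, u.2)) | u <- t a a', k <- lookup c u.1]
  ++ [seq (u.1, (key a l, Z.opp u.2)) | l <- La, u <- t l a']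
  ++ [seq (u.1, (key a' l, if p && pcode a then u.2 else Z.opp u.2)) | l <- La', u <- t a l].
(** Gauge conditions stand in for the quotient by coboundaries: together with the cocycle equations
    whose first argument has degree -1 they must annihilate every unknown of the weight. *)
Definition check_weight (neg neg1 : seq nat) (nup : Z * bool) :=
  let c := wclass neg nup.1 in
  elim_rows
    ([seq [seq (key u.1.1 u.1.2, u.2) | u <- gauge neg k]
       | k <- iota 0 n & Z.eqb (wcode k) nup.1 && Z.leb Z0 (zdg k)]
     ++ flatten [seq (if v.1 \in neg1 then
          flatten [seq split_rows (der_entries nup.2 c v.1 v.2 u.1 u.2) | u <- c] else [::]) | v <- c])
    [seq key v.1 l | v <- c, l <- v.2].

Definition check_even (neg neg1 : seq nat) := has (fun a => has (fun c =>
  [&& ~~ pcode a, ~~ pcode c, all (fun s => (s == c) || (t a s == [::])) neg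
    & all (fun u => all (fun s => t u.1 s == [::]) neg) (t a c)]) neg1) neg1.

(* [w]: a cubic form in the odd variables; [e], [z]: indices of a pair of vectors of degrees 2, -2
   whose bracket is [lam] times the grading element. *)
Definition check_odd (neg neg1 : seq nat) (z e : nat) (lam : Z) (w : seq (nat * nat * seq (nat * Z))) :=
  let wv a c := flatten [seq u.2 | u <- w & u.1 == (a, c)] in
  [&& all (fun a => if a \in neg1 then pcode a else Z.eqb (zdg a) (Zneg 2) && ~~ pcode a) neg,
      z \in neg, z \notin neg1, (e < n)%N, Z.eqb (zdg e) (Zpos 2) & ~~ pcode e] &&
  [&& ~~ Z.eqb lam 0, all (fun a => veq (adr T (t e z) a) [:: (a, Z.mul lam (zdg a))]) neg,
      all (fun a => all (fun c => [&& all (fun u => u.1 \in neg1) (wv a c),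
        [&& a \in neg1 & c \in neg1] || (wv a c == [::])
        & veq (wv a c) (vscale (zsgn (pcode a) (pcode c)) (wv c a))]) neg) neg,
      all (fun k => all (fun a => all (fun c =>
        veq (adr T (wv k a) c) (vscale (zsgn (pcode a) (pcode c)) (adr T (wv k c) a))) neg) neg) neg
    & has (fun a => has (fun c => if wv a c is [:: (_, x)] then ~~ Z.eqb x 0 else false) neg) neg].

Definition check_grading (dmin : Z) :=
  let neg := negl in let neg1 := neg1l in
  [&& (n <= 64)%N, Z.leb Z0 dmin, check_homog, check_gen neg neg1, check_gauge neg
    & all (check_weight neg neg1) (nus neg1 dmin)].
End GradingChecks.

Lemma int_of_Z_lt0 x : (int_of_Z x < 0) = Z.ltb x Z0.
Proof. by case: x => [|q|q] //=; rewrite NegzE oppr_lt0. Qed.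
Lemma int_of_Z_lt x y : Z.lt x y -> int_of_Z x < int_of_Z y.
Proof.
by move=> h; rewrite -subr_lt0 -(raddfB int_of_Z) int_of_Z_lt0; apply/Z.ltb_lt/Z.lt_sub_0.
Qed.
Lemma int_of_Z_ge0 x : (0 <= int_of_Z x) = Z.leb Z0 x.
Proof. by rewrite leNgt int_of_Z_lt0 Z.leb_antisym. Qed.
Lemma key_split a l : (l < 64)%N ->
  Z.to_nat (Z.div (key a l) (Zpos 64)) = a /\ Z.to_nat (Z.modulo (key a l) (Zpos 64)) = l.
Proof.
move=> hl; rewrite /key Z.add_comm Z.mul_comm Z.div_add // Z.mod_add //.
have h : (Z.le Z0 (Z.of_nat l) /\ Z.lt (Z.of_nat l) (Zpos 64)) by lia.
by rewrite Z.div_small // Z.mod_small // Z.add_0_l !Nat2Z.id.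
Qed.
Lemma zK_vcoef (K : numFieldType) v k :
  zK (vcoef v k) = \sum_(u <- v | u.1 == k) zK u.2 :> K.
Proof.
elim: v => [|u v IH] /=; first by rewrite big_nil.
by rewrite big_cons; case: eqP => _ //; rewrite zKD IH.
Qed.
Lemma split_rowsP (K : numFieldType) (x : Z -> K) es q : q \in split_rows es ->
  (forall k, k \in map fst es -> \sum_(u <- es | u.1 == k) zK u.2.2 * x u.2.1 = 0) ->
  rval x q = 0.
Proof.
case/mapP=> k; rewrite mem_undup => hk -> h; rewrite -[RHS](h k hk).
elim: es {h hk} => [|u es IH] /=; first by rewrite /rval !big_nil.
by rewrite big_cons; case: eqP => _ //; rewrite rval_radd IH.
Qed.
Lemma big_pick (K : pzRingType) (s : seq nat) k (F : nat -> K) : uniq s ->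
  \sum_(l <- s | l == k) F l = if k \in s then F k else 0.
Proof.
move=> us; rewrite -big_filter; case: ifP => hk.
  by rewrite filter_pred1_uniq // big_seq1.
by rewrite (_ : [seq _ <- _ | _] = [::]) ?big_nil //; apply/eqP; rewrite -(negbK (_ == _)) -has_filter has_pred1 hk.
Qed.

Lemma big_allpairs_cond (V : nmodType) (A B C : Type) (f : A -> B -> C) (s : seq A)
    (r : A -> seq B) (P : pred C) (F : C -> V) :
  \sum_(x <- [seq f i j | i <- s, j <- r i] | P x) F x =
  \sum_(i <- s) \sum_(j <- r i | P (f i j)) F (f i j).
Proof.
by rewrite big_mkcond big_allpairs_dep; apply: eq_bigr => i _; rewrite -big_mkcond.
Qed.

Lemma map_uniq_inj (A B : eqType) (f : A -> B) (s : seq A) x y :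
  uniq (map f s) -> x \in s -> y \in s -> f x = f y -> x = y.
Proof.
move=> us xs ys e; rewrite -(nth_index x xs) -(nth_index x ys); congr nth; apply/eqP.
rewrite -(nth_uniq (f x) _ _ us) ?size_map ?index_mem // !(nth_map x) ?index_mem //.
by rewrite !nth_index // e.
Qed.

(** * The graded algebra in coordinates *)

Section Model.
Variables (K : numFieldType) (g : LSA K).
Hypothesis hg : IsLSA g.
Variables (T : seq (seq (seq (nat * Z)))) (n : nat) (we dgl : seq Z) (pl : seq bool) (rk np : nat).
Variables (b : nat -> g) (cf : nat -> g -> K).
Local Notation br := (@lsa_br K g).
Local Notation t := (tb T).
Local Notation par := (pcode pl).
Hypothesis cfP : forall i a x y, cf i (a *: x + y) = a * cf i x + cf i y.
Hypothesis cfE : forall v, v = \sum_(i < n) cf i v *: b i.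
Hypothesis cf_dual : forall i j, (i < n)%N -> (j < n)%N -> cf i (b j) = (i == j)%:R.
Hypothesis b_par : forall i, (i < n)%N -> b i \in lsa_par g (par i).
Hypothesis tab : forall i j, (i < n)%N -> (j < n)%N -> br (b i) (b j) = \sum_(u <- t i j) zK u.2 *: b u.1.

Definition dg i : int := int_of_Z (zdg dgl i).
Definition homT (k : int) (p : bool) (x : g) : Prop :=
  forall i, (i < n)%N -> (dg i, par i) != (k, p) -> cf i x = 0.
Definition model : gLSA K := @MkG K g br homT.

Let cf0 i : cf i 0 = 0.
Proof. by have := cfP i (-1) 0 0; rewrite scaler0 addr0 mulN1r addNr. Qed.
Let cfZ i a x : cf i (a *: x) = a * cf i x.
Proof. by rewrite -[a *: x]addr0 cfP cf0 addr0. Qed.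
Let cfD i x y : cf i (x + y) = cf i x + cf i y.
Proof. by rewrite -[x]scale1r cfP mul1r scale1r. Qed.
Let cf_sum i (J : Type) (s : seq J) (Q : pred J) (f : J -> g) :
  cf i (\sum_(j <- s | Q j) f j) = \sum_(j <- s | Q j) cf i (f j).
Proof. by apply: (big_morph (cf i)) => [x y|]; rewrite ?cfD ?cf0. Qed.
Let cf_ext x y : (forall i, (i < n)%N -> cf i x = cf i y) -> x = y.
Proof. by move=> h; rewrite (cfE x) (cfE y); apply: eq_bigr => i _; rewrite h. Qed.

Hypothesis homog : check_homog T n we dgl pl.

Let tabP i j u : (i < n)%N -> (j < n)%N -> u \in t i j ->
  [/\ (u.1 < n)%N, zdg dgl u.1 = Z.add (zdg dgl i) (zdg dgl j),
      wcode we u.1 = Z.add (wcode we i) (wcode we j) & par u.1 = par i (+) par j].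
Proof.
move=> hi hj hu; have := allP (allP (allP homog i (mem_iota0 hi)) j (mem_iota0 hj)) u hu.
by case/and4P=> h1 /Z.eqb_spec h2 /Z.eqb_spec h3 /eqP.
Qed.
Let dgD i j u : (i < n)%N -> (j < n)%N -> u \in t i j -> dg u.1 = dg i + dg j.
Proof. by move=> hi hj /(tabP hi hj) [_ h _ _]; rewrite /dg h (raddfD int_of_Z). Qed.

Let cf_tab i j l : (i < n)%N -> (j < n)%N -> (l < n)%N -> cf l (br (b i) (b j)) = zK (vcoef (t i j) l).
Proof.
move=> hi hj hl; rewrite tab // cf_sum.
have : forall u, u \in t i j -> (u.1 < n)%N by move=> u /(tabP hi hj) [].
elim: (t i j) => [|u v IH] h; first by rewrite big_nil.
rewrite big_cons IH => [|w hw]; last by apply: h; rewrite inE hw orbT.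
rewrite cfZ cf_dual ?h ?mem_head //= eq_sym; case: eqP => _; last by rewrite mulr0 add0r.
by rewrite zKD mulr1.
Qed.

Lemma homT_b i : (i < n)%N -> homT (dg i) (par i) (b i).
Proof. by move=> hi j hj ne; rewrite cf_dual // (_ : (j == i) = false) //; apply: contraNF ne => /eqP ->. Qed.

Lemma homT_par k p x : homT k p x -> x \in lsa_par g p.
Proof.
move=> hx; rewrite (cfE x); apply: memv_suml => i _.
have [[_ <-]|ne] := eqVneq (dg i, par i) (k, p); first exact/memvZ/b_par.
by rewrite hx // scale0r mem0v.
Qed.

Lemma homT_lin k p a x y : homT k p x -> homT k p y -> homT k p (a *: x + y).
Proof. by move=> hx hy i hi ne; rewrite cfP hx // hy // mulr0 addr0. Qed.
Lemma homT0 k p : homT k p 0. Proof. by move=> i _ _; rewrite cf0. Qed.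

Lemma cf_br x y l : (l < n)%N -> cf l (br x y) =
  \sum_(i < n) \sum_(j < n) cf i x * cf j y * zK (vcoef (t i j) l).
Proof.
move=> hl; rewrite {1}(cfE x) {1}(cfE y) (lsa_br_suml hg) cf_sum; apply: eq_bigr => i _.
rewrite (lsa_brZl hg) cfZ (lsa_br_sumr hg) cf_sum mulr_sumr; apply: eq_bigr => j _.
by rewrite (lsa_brZr hg) cfZ cf_tab // mulrA.
Qed.

Lemma vcoef_notin v l : l \notin map fst v -> vcoef v l = Z0.
Proof. by elim: v => //= u v IH; rewrite inE negb_or eq_sym => /andP[/negPf -> /IH]. Qed.

Lemma homT_br k l p q x y : homT k p x -> homT l q y -> homT (k + l) (p (+) q) (br x y).
Proof.
move=> hx hy m hm ne; rewrite cf_br // big1 // => i _; rewrite big1 // => j _.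
have [[ei pi]|ni] := eqVneq (dg i, par i) (k, p); last by rewrite hx // !mul0r.
have [[ej pj]|nj] := eqVneq (dg j, par j) (l, q); last by rewrite hy // mulr0 mul0r.
rewrite vcoef_notin ?zK0 ?mulr0 //; apply: contraNN ne => /mapP[u hu ->].
by rewrite (dgD _ _ hu) //; have [//|//|_ _ _ ->] := tabP _ _ hu; rewrite ei ej pi pj.
Qed.

Lemma model_glsa : IsGLSA model.
Proof.
split.
- by split=> a x y z; [apply: lsa_brPl|apply: lsa_brPr].
- split; first exact: homT0.
  split; first exact: homT_lin.
  move=> v; exists [seq ((dg i, par i), cf i v *: b i) | i : 'I_n <- index_enum 'I_n]; split.
    move=> _ /mapP[i _ ->] /=; rewrite -[_ *: _]addr0; apply: homT_lin; last exact: homT0.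
    exact: homT_b.
  by rewrite big_map /= {1}(cfE v).
- split; last exact: homT_br.
  move=> s us hs s0 u0 hu0; apply: cf_ext => i hi; rewrite cf0.
  have [ei|ne] := eqVneq (dg i, par i) u0.1; last by apply: (hs u0) => //; move: ne; case: (u0.1).
  have := congr1 (cf i) s0; rewrite cf0 cf_sum (bigD1_seq u0) //=; last by apply: map_uniq us.
  rewrite big_seq_cond big1 ?addr0 // => w /andP[ws nw]; apply: (hs w) => //.
  rewrite ei; apply: contraNneq nw => e0; apply/eqP.
  have ef : u0.1 = w.1 by rewrite e0; case: (w.1).
  exact: map_uniq_inj us ws hu0 (esym ef).
- by move=> k l p q x y hx hy; apply: lsa_anti => //; [apply: homT_par hx|apply: homT_par hy].
- by move=> k l p q x y z hx hy; apply: lsa_jacobi => //; [apply: homT_par hx|apply: homT_par hy].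
Qed.

Variable dmin : Z.
Hypothesis ck : check_grading T n we dgl pl rk np dmin.
Local Notation neg := (negl n dgl).
Local Notation neg1 := (neg1l n dgl).
Local Notation gauge := (gauge T dgl rk np neg).
Local Notation gauge_ad := (gauge_pair T dgl rk np neg).

Let negD a : a \in neg -> (a < n)%N /\ dg a < 0.
Proof. by rewrite mem_filter mem_iota /dg int_of_Z_lt0 => /and3P[]. Qed.
Let neg1D a : a \in neg1 -> (a < n)%N /\ dg a = -1.
Proof. by rewrite mem_filter mem_iota /dg => /and3P[/Z.eqb_spec ->]. Qed.
Let negI a : (a < n)%N -> dg a < 0 -> a \in neg.
Proof. by rewrite mem_filter mem_iota /dg int_of_Z_lt0 => -> ->. Qed.
Let neg1I a : (a < n)%N -> dg a = -1 -> a \in neg1.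
Proof.
move=> ha h; rewrite mem_filter mem_iota /= add0n ha andbT; apply/Z.eqb_spec.
exact: (can_inj int_of_ZK).
Qed.
Let neg1_neg a : a \in neg1 -> a \in neg.
Proof. by case/neg1D => h1 h2; apply: negI; rewrite ?h2. Qed.
Let uniq_neg : uniq neg. Proof. by rewrite filter_uniq // iota_uniq. Qed.

Lemma neg_gen a : a \in neg -> a \notin neg1 -> exists s a' z,
  [/\ s \in neg1, a' \in neg, t s a' = [:: (a, z)], zK z != 0 :> K & Z.lt (zdg dgl a) (zdg dgl a')].
Proof.
case/and5P: ck => _ _ _ h _ ha; have := allP h a ha => /orP[->//|/hasP[s hs /hasP[a' ha' hgen]] _].
move: hgen; rewrite /gen_by; case et: (t s a') => [//|[l z] [|//]] /and3P[/eqP el z0 /Z.ltb_lt lt].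
by exists s, a', z; split=> //; rewrite ?zK_eq0 // et el.
Qed.

(** Descends through the degrees along the generating brackets of [neg_gen]. It serves both
    transitivity and the uniqueness of cocycles; [c] stands for the sign of either parity. *)
Lemma der_zero (zz : nat -> g) (c : nat -> K) :
  (forall a a', a \in neg -> a' \in neg -> \sum_(u <- t a a') zK u.2 *: zz u.1 =
     br (zz a) (b a') + c a *: br (b a) (zz a')) ->
  (forall a, a \in neg1 -> zz a = 0) -> forall a, a \in neg -> zz a = 0.
Proof.
move=> der z1 a0; have [m hm] : exists m : nat, Z.le (Z.opp (Z.of_nat m)) (zdg dgl a0).
  by exists (Z.to_nat (Z.abs (zdg dgl a0))); lia.
elim: m a0 hm => [|m IH] a0 hm ha.
  have [_] := negD ha; rewrite /dg int_of_Z_lt0 => /Z.ltb_lt; lia.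
have [|nh] := boolP (a0 \in neg1); first exact: z1.
have [s [a' [z [hs ha' et z0 lt]]]] := neg_gen ha nh.
have := der s a' (neg1_neg hs) ha'; rewrite et big_seq1 /= (z1 s hs) (lsa_br0l hg) add0r.
rewrite (IH a') // ?(lsa_br0r hg) ?scaler0; last by lia.
by move=> /eqP; rewrite scaler_eq0 (negPf z0) => /eqP.
Qed.

Lemma ad_der k p x a a' : homT k p x -> a \in neg -> a' \in neg ->
  \sum_(u <- t a a') zK u.2 *: br x (b u.1) =
  br (br x (b a)) (b a') + sgn K p (par a) *: br (b a) (br x (b a')).
Proof.
move=> hx /negD [ha _] /negD [ha' _].
rewrite -(lsa_jacobi hg _ (homT_par hx) (b_par ha)) tab // (lsa_br_sumr hg).
by apply: eq_bigr => u _; rewrite (lsa_brZr hg).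
Qed.

Lemma gaugeP k : (k < n)%N -> Z.leb Z0 (zdg dgl k) ->
  [/\ zK (gauge_ad k k) != 0 :> K,
      forall k', (k' < n)%N -> Z.leb Z0 (zdg dgl k') -> k != k' -> gauge_ad k k' = Z0
    & forall u, u \in gauge k -> [/\ u.1.1 \in neg, (u.1.2 < n)%N, dg u.1.2 = dg k + dg u.1.1
        & par u.1.2 = par k (+) par u.1.1]].
Proof.
move=> hk k0; case/and5P: ck => _ _ _ _ /andP[/allP h _].
have nn q : (q < n)%N -> Z.leb Z0 (zdg dgl q) -> q \in [seq k <- iota 0 n | Z.leb Z0 (zdg dgl k)].
  by move=> h1 h2; rewrite mem_filter h2 mem_iota.
have /and3P[h1 /allP h2 /allP h3] := h k (nn k hk k0); split.
- by rewrite zK_eq0.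
- by move=> k' hk' k0' ne; have := h2 k' (nn k' hk' k0'); rewrite (negPf ne) => /Z.eqb_spec.
- move=> u /h3 /and4P[u1 u2 /Z.eqb_spec u3 /eqP u4]; split=> //.
  by rewrite /dg u3 (raddfD int_of_Z).
Qed.

(** The off-diagonal pairings vanish, so only coordinate [k] survives; the pairing says nothing
    about negative degrees, whose coordinates are assumed zero. *)
Lemma gauge_br k x : (k < n)%N -> Z.leb Z0 (zdg dgl k) ->
  (forall i, (i < n)%N -> Z.ltb (zdg dgl i) Z0 -> cf i x = 0) ->
  \sum_(u <- gauge k) zK u.2 * cf u.1.2 (br x (b u.1.1)) = zK (gauge_ad k k) * cf k x.
Proof.
move=> hk k0 hx; have [_ h2 h3] := gaugeP hk k0.
have e1 u : u \in gauge k -> zK u.2 * cf u.1.2 (br x (b u.1.1)) =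
    \sum_(i < n) cf i x * zK (Z.mul u.2 (vcoef (t i u.1.1) u.1.2)).
  move=> /h3 [/negD [u1 _] u2 _ _]; rewrite {1}(cfE x) (lsa_br_suml hg) cf_sum mulr_sumr.
  by apply: eq_bigr => i _; rewrite (lsa_brZl hg) cfZ cf_tab // zKM mulrCA.
rewrite big_seq (eq_bigr _ e1) -big_seq exchange_big /=.
have e2 (i : 'I_n) : \sum_(u <- gauge k) cf i x * zK (Z.mul u.2 (vcoef (t i u.1.1) u.1.2)) =
    cf i x * zK (gauge_ad k i).
  rewrite -mulr_sumr; congr (_ * _); rewrite /gauge_pair.
  by elim: (gauge k) => [|u v IH] /=; rewrite ?big_nil // big_cons zKD IH.
rewrite (eq_bigr _ (fun i _ => e2 i)) (bigD1 (Ordinal hk)) //= mulrC big1 ?addr0 // => i ne.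
have [neg_i|nneg] := boolP (Z.ltb (zdg dgl i) Z0); first by rewrite hx // mul0r.
rewrite h2 ?zK0 ?mulr0 //; first by rewrite Z.leb_antisym nneg.
by apply: contraNneq ne => ek; apply/eqP/val_inj.
Qed.

Lemma model_transitive : Transitive model.
Proof.
move=> k p x k0 hx h; pose zz a := br x (b a).
have z1 a : a \in neg1 -> zz a = 0.
  by move=> /neg1D [ha da]; apply: (h (par a)); rewrite /gl_hom /= -da; apply: homT_b.
have z0 := der_zero (zz := zz) (c := fun a => sgn K p (par a)) (fun a a' ha ha' => ad_der hx ha ha') z1.
have xneg i : (i < n)%N -> Z.ltb (zdg dgl i) Z0 -> cf i x = 0.
  move=> hi di; apply: hx => //; apply: contraTneq k0 => -[<- _].
  by rewrite -ltNge /dg int_of_Z_lt0.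
apply: cf_ext => i hi; rewrite cf0; have [di|di] := boolP (Z.ltb (zdg dgl i) Z0); first exact: xneg.
have di' : Z.leb Z0 (zdg dgl i) by rewrite Z.leb_antisym di.
have [g0 _ h3] := gaugeP hi di'; have := gauge_br hi di' xneg.
rewrite big_seq big1 => [/esym/eqP|u /h3 [u1 _ _ _]]; last by rewrite -/(zz _) z0 // cf0 mulr0.
by rewrite mulf_eq0 (negPf g0) => /eqP.
Qed.

Definition nI := size neg.
Definition ix (j : 'I_nI) : nat := nth 0%N neg j.
Definition bI (j : 'I_nI) : g := b (ix j).
Definition cfI (j : 'I_nI) : g -> K := cf (ix j).

Let ix_neg j : ix j \in neg. Proof. exact: mem_nth. Qed.
Let ix_inj : injective ix.
Proof. by move=> i j /eqP; rewrite /ix nth_uniq // => /eqP /val_inj. Qed.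
Let ix_ex a : a \in neg -> exists j, a = ix j.
Proof. by move=> ha; move: (ha); rewrite -index_mem => h; exists (Ordinal h); rewrite /ix /= nth_index. Qed.
Let sum_ix (V : nmodType) (F : nat -> V) : \sum_j F (ix j) = \sum_(a <- neg) F a.
Proof. by rewrite (big_nth 0%N) big_mkord. Qed.

Lemma model_negbasis : @NegBasis K model _ bI (fun j => dg (ix j)) (fun j => par (ix j)) cfI.
Proof.
split.
- by move=> i; case: (negD (ix_neg i)).
- by move=> i; apply: homT_b; case: (negD (ix_neg i)).
- by move=> i a x y; apply: cfP.
- by move=> k p y i hy ne; apply: hy => //; case: (negD (ix_neg i)).
move=> k p y k0 hy; rewrite (sum_ix (fun a => cf a y *: b a)) big_filter {1}(cfE y).
rewrite -(big_mkord xpredT (fun i => cf i y *: b i)) /index_iota subn0 [LHS]big_seq.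
rewrite [RHS]big_seq_cond [RHS]big_mkcond [LHS]big_mkcond; apply: eq_bigr => i _.
rewrite mem_iota /=; case: ltnP => //= hi; case: ifP => // nd.
rewrite hy ?scale0r //; apply: contraFneq nd => -[ek _].
by rewrite -int_of_Z_lt0 -/(dg i) ek.
Qed.

Lemma model_dual i l : cfI l (bI i) = (l == i)%:R.
Proof.
have [hi _] := negD (ix_neg i); have [hl _] := negD (ix_neg l).
by rewrite /cfI /bI cf_dual // (inj_eq ix_inj).
Qed.

Lemma model_gen i : dg (ix i) != -1 -> exists j m c,
  [/\ dg (ix j) = -1, dg (ix i) < dg (ix m), c != 0
    & forall l, cfI l (gl_br (bI j : model) (bI m)) = c * (l == i)%:R].
Proof.
move=> ne; have hi := ix_neg i.
have [|s [a' [z [hs ha' et z0 lt]]]] := neg_gen hi.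
  by apply: contraNN ne => /neg1D [_ ->].
have [hsn ds] := neg1D hs; have [ha'n _] := negD ha'.
have [j ej] := ix_ex (neg1_neg hs); have [m em] := ix_ex ha'; exists j, m, (zK z); split=> //.
- by rewrite -ej.
- by rewrite -em; apply: int_of_Z_lt.
move=> l; have [hl _] := negD (ix_neg l).
rewrite /cfI /bI -ej -em /gl_br /= cf_tab // et /= eq_sym (inj_eq ix_inj).
by case: eqP; rewrite ?mulr1 ?mulr0 // Z.add_0_r.
Qed.

(** * Vanishing of gauge-fixed cocycles *)

Section Derivation.
Variables (d : int) (p : bool) (yy : nat -> g).
Hypothesis d_ge : int_of_Z dmin <= d.
Hypothesis yy_hom : forall a, a \in neg -> homT (d + dg a) (p (+) par a) (yy a).
Hypothesis yy_der : forall a a', a \in neg -> a' \in neg ->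
  \sum_(u <- t a a') zK u.2 *: yy u.1 = br (yy a) (b a') + sgn K p (par a) *: br (b a) (yy a').
Hypothesis yy_gauge : forall k, (k < n)%N -> Z.leb Z0 (zdg dgl k) ->
  \sum_(u <- gauge k) zK u.2 * cf u.1.2 (yy u.1.1) = 0.

Let xv (z : Z) : K := cf (Z.to_nat (Z.modulo z (Zpos 64))) (yy (Z.to_nat (Z.div z (Zpos 64)))).
Let xvE a l : (l < n)%N -> xv (key a l) = cf l (yy a).
Proof.
move=> hl; have l64 : (l < 64)%N by case/andP: ck => h _; apply: leq_trans h.
by rewrite /xv; have [-> ->] := key_split a l64.
Qed.

(** The component of weight [nu] of the cochain under the Cartan subalgebra. *)
Let ynu nu a l : K := if Z.eqb (wcode we l) (Z.add nu (wcode we a)) then cf l (yy a) else 0.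

(** Read the cocycle identity at coordinate [k]. If [k] has the weight of [nu + a + a'], the
    truncation removes no term with a nonzero coefficient; otherwise every truncated term is
    zero. *)
Let der_nu nu a a' k : a \in neg -> a' \in neg -> (k < n)%N ->
  \sum_(u <- t a a') zK u.2 * ynu nu u.1 k =
  \sum_(l < n) ynu nu a l * zK (vcoef (t l a') k) +
  sgn K p (par a) * \sum_(l < n) ynu nu a' l * zK (vcoef (t a l) k).
Proof.
move=> ha ha' hk; have [han _] := negD ha; have [ha'n _] := negD ha'.
have wt_l i j : (i < n)%N -> (j < n)%N -> zK (vcoef (t i j) k) != 0 :> K ->
    wcode we k = Z.add (wcode we i) (wcode we j).
  move=> hi hj nz; have : k \in map fst (t i j).
    by apply: contraNT nz => /vcoef_notin ->; rewrite zK0.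
  by case/mapP=> u hu ->; case: (tabP hi hj hu).
have wt_u u : u \in t a a' -> wcode we u.1 = Z.add (wcode we a) (wcode we a').
  by move=> hu; case: (tabP han ha'n hu).
have [ek|ne] := eqVneq (wcode we k) (Z.add nu (Z.add (wcode we a) (wcode we a'))); last first.
  rewrite [LHS]big_seq big1; last first.
    move=> u /wt_u hu; rewrite /ynu hu; case: Z.eqb_spec => [h|_]; last by rewrite mulr0.
    by rewrite h eqxx in ne.
  rewrite big1 => [|l _]; last first.
    have [->|/(wt_l _ _ _ _) h] := eqVneq (zK (vcoef (t l a') k)) (0 : K); first by rewrite mulr0.
    rewrite /ynu; case: Z.eqb_spec => [h'|_]; last by rewrite mul0r.
    by case/eqP: ne; rewrite h // h'; lia.
  rewrite big1 => [|l _]; first by rewrite mulr0 addr0.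
  have [->|/(wt_l _ _ _ _) h] := eqVneq (zK (vcoef (t a l) k)) (0 : K); first by rewrite mulr0.
  rewrite /ynu; case: Z.eqb_spec => [h'|_]; last by rewrite mul0r.
  by case/eqP: ne; rewrite h // h'; lia.
have := congr1 (cf k) (yy_der ha ha'); rewrite cf_sum cfD cfZ.
have -> : \sum_(u <- t a a') cf k (zK u.2 *: yy u.1) = \sum_(u <- t a a') zK u.2 * ynu nu u.1 k.
  rewrite big_seq [RHS]big_seq; apply: eq_bigr => u /wt_u hu; rewrite cfZ /ynu hu ek.
  by rewrite Z.eqb_refl.
move=> ->; congr (_ + _ * _).
  rewrite {1}(cfE (yy a)) (lsa_br_suml hg) cf_sum; apply: eq_bigr => l _.
  rewrite (lsa_brZl hg) cfZ cf_tab // /ynu.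
  have [->|/(wt_l _ _ _ _) h] := eqVneq (zK (vcoef (t l a') k)) (0 : K); first by rewrite !mulr0.
  by case: Z.eqb_spec => // ne; case: ne; have := h (ltn_ord l) ha'n; rewrite ek; clear; lia.
rewrite {1}(cfE (yy a')) (lsa_br_sumr hg) cf_sum; apply: eq_bigr => l _.
rewrite (lsa_brZr hg) cfZ cf_tab // /ynu.
have [->|/(wt_l _ _ _ _) h] := eqVneq (zK (vcoef (t a l) k)) (0 : K); first by rewrite !mulr0.
by case: Z.eqb_spec => // ne; case: ne; have := h han (ltn_ord l); rewrite ek; clear; lia.
Qed.

Let wcls nu a := [seq l <- iota 0 n | Z.eqb (wcode we l) (Z.add nu (wcode we a))].

Let lookupE nu a : a \in neg -> lookup (wclass n we neg nu) a = wcls nu a.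
Proof.
rewrite /lookup /wclass; elim: neg => [//|x s IH]; rewrite inE /=.
by case: eqVneq => [->|ne] //=; rewrite ne eq_sym (negPf ne).
Qed.

Let wcls_uniq nu a : uniq (wcls nu a). Proof. by rewrite filter_uniq // iota_uniq. Qed.

Let sum_wcls nu a (F : nat -> K) :
  \sum_(l <- wcls nu a) F l * cf l (yy a) = \sum_(l < n) ynu nu a l * F l.
Proof.
rewrite -(big_mkord xpredT (fun l => ynu nu a l * F l)) /index_iota subn0 /wcls big_filter big_mkcond.
by apply: eq_bigr => l _; rewrite /ynu; case: ifP; rewrite ?mul0r // mulrC.
Qed.

Let rows_zero nu a a' q : a \in neg -> a' \in neg ->
  q \in split_rows (der_entries T pl p (wclass n we neg nu) a (wcls nu a) a' (wcls nu a')) ->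
  rval xv q = 0.
Proof.
move=> ha ha' /split_rowsP; apply=> k hk.
have [han _] := negD ha; have [ha'n da'] := negD ha'.
have hu_neg u : u \in t a a' -> u.1 \in neg.
  move=> hu; have [h1 _ _ _] := tabP han ha'n hu; apply: negI => //.
  by rewrite (dgD han ha'n hu) -[0]addr0; have [_ da] := negD ha; apply: ltrD.
have in_cls l c : l \in wcls nu c -> (l < n)%N by rewrite mem_filter mem_iota => /and3P[].
have kn : (k < n)%N.
  move: hk; rewrite /der_entries !map_cat !mem_cat => /or3P[] /mapP[x /allpairsPdep[u [v [h1 h2 ->]]] ->] /=.
  - by move: h2; rewrite lookupE ?hu_neg // => /in_cls.
  - by have [] := tabP (in_cls _ _ h1) ha'n h2.
  - by have [] := tabP han (in_cls _ _ h1) h2.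
rewrite /der_entries !big_cat /= !big_allpairs_cond /=.
have -> : \sum_(u <- t a a') \sum_(l <- lookup (wclass n we neg nu) u.1 | l == k) zK u.2 * xv (key u.1 l)
    = \sum_(u <- t a a') zK u.2 * ynu nu u.1 k.
  rewrite big_seq [RHS]big_seq; apply: eq_bigr => u hu; rewrite lookupE ?hu_neg //.
  rewrite big_pick // mem_filter mem_iota /= add0n kn andbT /ynu.
  by case: ifP; rewrite ?mulr0 // xvE.
have -> : \sum_(l <- wcls nu a) \sum_(u <- t l a' | u.1 == k) zK (Z.opp u.2) * xv (key a l)
    = - \sum_(l < n) ynu nu a l * zK (vcoef (t l a') k).
  rewrite -(sum_wcls nu a (fun l => zK (vcoef (t l a') k))) -sumrN big_seq [RHS]big_seq.
  apply: eq_bigr => l hl; rewrite zK_vcoef -mulNr -sumrN mulr_suml; apply: eq_bigr => u _.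
  by rewrite xvE ?zKN //; apply: in_cls hl.
have -> : \sum_(l <- wcls nu a') \sum_(u <- t a l | u.1 == k)
      zK (if p && par a then u.2 else Z.opp u.2) * xv (key a' l)
    = - (sgn K p (par a) * \sum_(l < n) ynu nu a' l * zK (vcoef (t a l) k)).
  rewrite -(sum_wcls nu a' (fun l => zK (vcoef (t a l) k))) mulr_sumr -sumrN big_seq [RHS]big_seq.
  apply: eq_bigr => l hl; rewrite zK_vcoef mulrA -mulNr mulr_sumr -sumrN mulr_suml; apply: eq_bigr => u _.
  rewrite xvE; last by apply: in_cls hl.
  by congr (_ * _); rewrite /sgn; case: ifP => _; rewrite ?zKN ?expr1 ?expr0 ?mulN1r ?opprK ?mul1r.
by rewrite (der_nu nu ha ha' kn) -opprD subrr.
Qed.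

Lemma der_gauge_zero a : a \in neg -> yy a = 0.
Proof.
apply: (der_zero yy_der) => {}a ha1; have ha := neg1_neg ha1; have [han da] := neg1D ha1.
apply: cf_ext => l hl; rewrite cf0.
have [[el pl']|ne] := eqVneq (dg l, par l) (d + dg a, p (+) par a); last by apply: (yy_hom ha).
case/and5P: ck => _ _ _ _ /andP[_ /allP ckw].
(* The weight in which coordinate [l] at [a] contributes; the bound on [d] puts it among the weights
   that were checked. *)
pose nu := Z.sub (wcode we l) (wcode we a).
have hnu : (nu, p) \in nus n we dgl pl neg1 dmin.
  rewrite mem_undup; apply/allpairsPdep; exists a, l; split=> //.
    rewrite mem_filter mem_iota /= add0n hl andbT; apply/Z.leb_le.
    rewrite Z.le_ngt => lt; have := int_of_Z_lt lt.
    have -> : int_of_Z (Z.sub (zdg dgl l) (zdg dgl a)) = dg l - dg a := raddfB int_of_Z _ _.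
    by rewrite el addrK ltNge d_ge.
  by rewrite pl' addbK.
have := ckw _ hnu; rewrite /check_weight /= => /(elim_rowsP (x := xv)) h.
rewrite -(xvE a hl); apply: h => [q|].
  rewrite mem_cat => /orP[/mapP[k]|/flattenP[s /mapP[v /mapP[c hc ->] ->]] /=].
    rewrite mem_filter mem_iota => /andP[/andP[_ k0] /andP[_ kn]] ->.
    have [_ _ h3] := gaugeP kn k0.
    rewrite /rval big_map /= big_seq -[RHS](yy_gauge kn k0) [RHS]big_seq.
    by apply: eq_bigr => u /h3 [_ u2 _ _]; rewrite xvE.
  case: ifP => // hc1 /flattenP[s' /mapP[v' /mapP[c' hc' ->] ->]] /=.
  exact: rows_zero.
apply/allpairsPdep; exists (a, wcls nu a), l; split=> //; first by apply: map_f.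
by rewrite mem_filter mem_iota /= add0n hl andbT /nu; apply/Z.eqb_spec; rewrite Z.sub_add.
Qed.
End Derivation.

Theorem model_inner d : int_of_Z dmin <= d ->
  @DerInner K model _ bI (fun j => dg (ix j)) (fun j => par (ix j)) cfI d.
Proof.
move=> d_ge p Z hZ der.
have d0 : 0 <= d by case/andP: ck => _ /andP[h _]; apply: le_trans d_ge; rewrite int_of_Z_ge0.
pose zz a := if insub (index a neg) is Some j then Z j else 0.
have zzE j : zz (ix j) = Z j.
  by rewrite /zz /ix index_uniq // insubT // => h; congr Z; apply: val_inj.
have zz_hom a : a \in neg -> homT (d + dg a) (p (+) par a) (zz a).
  by move=> /ix_ex [j ->]; rewrite zzE; apply: hZ.
have zz_der a a' : a \in neg -> a' \in neg -> \sum_(u <- t a a') zK u.2 *: zz u.1 =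
    br (zz a) (b a') + sgn K p (par a) *: br (b a) (zz a').
  move=> ha ha'; have [i ei] := ix_ex ha; have [j ej] := ix_ex ha'; subst a a'.
  rewrite !zzE -[RHS](der i j) /gl_br /=.
  have [hi _] := negD ha; have [hj _] := negD ha'.
  under [RHS]eq_bigr => l _ do rewrite -zzE /cfI.
  rewrite (sum_ix (fun a => cf a (br (bI i) (bI j)) *: zz a)) /bI.
  have hu_neg u : u \in t (ix i) (ix j) -> u.1 \in neg.
    move=> hu; have [h1 _ _ _] := tabP hi hj hu; apply: negI => //.
    rewrite (dgD hi hj hu) -[0]addr0; have [_ da] := negD ha; have [_ da'] := negD ha'.
    exact: ltrD.
  have -> : \sum_(a <- neg) cf a (br (b (ix i)) (b (ix j))) *: zz a =
      \sum_(a <- neg) \sum_(u <- t (ix i) (ix j)) (if a == u.1 then zK u.2 *: zz a else 0).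
    rewrite big_seq [RHS]big_seq; apply: eq_bigr => a /negD [ha0 _].
    rewrite cf_tab // zK_vcoef scaler_suml big_mkcond; apply: eq_bigr => u _.
    by rewrite eq_sym.
  rewrite exchange_big /= big_seq [RHS]big_seq; apply: eq_bigr => u /hu_neg hu.
  rewrite (bigD1_seq u.1) //= eqxx big1 ?addr0 // => a /negPf ->.
  by [].
(* The inner part: [ad X] has the same gauge values as the cocycle, so the difference is gauge-fixed
   and vanishes by [der_gauge_zero]. *)
pose X := \sum_(k < n | Z.leb Z0 (zdg dgl k))
  ((\sum_(u <- gauge k) zK u.2 * cf u.1.2 (zz u.1.1)) / zK (gauge_ad k k)) *: b k.
have cfX k : (k < n)%N -> cf k X = if Z.leb Z0 (zdg dgl k) then
    (\sum_(u <- gauge k) zK u.2 * cf u.1.2 (zz u.1.1)) / zK (gauge_ad k k) else 0.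
  move=> hk; rewrite /X cf_sum big_mkcond (bigD1 (Ordinal hk)) //= [X in _ + X]big1 => [|i ne].
    by case: (Z.leb _ _); rewrite addr0 //= cfZ cf_dual // eqxx mulr1.
  case: ifP => // _; rewrite cfZ cf_dual // (_ : (k == i) = false) ?mulr0 //.
  by apply: contraNF ne => /eqP e; apply/eqP/val_inj.
have hX : homT d p X.
  move=> k hk ne; rewrite cfX //; case: ifP => // k0.
  have [_ _ h3] := gaugeP hk k0.
  rewrite big_seq big1 ?mul0r // => u /h3 [u1 u2 u3 u4].
  rewrite (zz_hom _ u1) ?mulr0 // u3 u4; apply: contraNneq ne => -[/addIr -> /addIb ->].
  by [].
have Xneg i : (i < n)%N -> Z.ltb (zdg dgl i) Z0 -> cf i X = 0.
  by move=> hi di; rewrite cfX // Z.leb_antisym di.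
exists X; split=> // i; rewrite /gl_br /= -zzE; apply/eqP; rewrite -subr_eq0; apply/eqP.
apply: (@der_gauge_zero d p (fun a => zz a - br X (b a))) => //.
- move=> a ha; rewrite [zz a + _]addrC -scaleN1r; apply: homT_lin; last exact: zz_hom.
  by apply: homT_br => //; apply: homT_b; case: (negD ha).
- move=> a a' ha ha'; under eq_bigr => u _ do rewrite scalerBr.
  rewrite big_split /= sumrN zz_der // (ad_der hX) // (lsa_brBr hg).
  have -> : br (zz a - br X (b a)) (b a') = br (zz a) (b a') - br (br X (b a)) (b a').
    by rewrite addrC -scaleN1r (lsa_brPl hg) scaleN1r addrC.
  by rewrite scalerBr opprD addrACA.
- move=> k hk k0; under eq_bigr => u _ do rewrite addrC -scaleN1r cfP mulN1r mulrDr mulrN.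
  rewrite big_split /= sumrN (gauge_br hk k0 Xneg) cfX // k0.
  have [g0 _ _] := gaugeP hk k0.
  by rewrite mulrC divfK // addNr.
Qed.

Local Notation pro := (prolong model_glsa model_negbasis).

Lemma model_InfDim_even : check_even T pl neg neg1 -> InfDim pro.
Proof.
case/hasP=> a ha /hasP[c hc /and4P[pa pc /allP h1 /allP h2]].
have [han da] := neg1D ha; have [hcn dc] := neg1D hc.
have [i ei] := ix_ex (neg1_neg ha); have [j ej] := ix_ex (neg1_neg hc); subst a c.
apply: (@InfDim_even _ _ _ _ _ _ _ model_glsa model_negbasis model_dual i j) => //.
- exact: negbTE.
- exact: negbTE.
- move=> s ne; have := h1 _ (ix_neg s); rewrite (inj_eq ix_inj) (negPf ne) => /eqP e0.
  have [hs _] := negD (ix_neg s).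
  by rewrite /gl_br /= /bI tab // e0 big_nil.
- move=> s; have [hs _] := negD (ix_neg s); rewrite /gl_br /= /bI (tab han hcn) (lsa_br_suml hg).
  rewrite big_seq big1 // => u hu; rewrite (lsa_brZl hg) tab //; last by have [] := tabP han hcn hu.
  by have := allP (h2 u hu) _ (ix_neg s) => /eqP ->; rewrite big_nil scaler0.
Qed.

Lemma model_InfDim_odd z e lam w : check_odd T n dgl pl neg neg1 z e lam w -> InfDim pro.
Proof.
pose wv a c := flatten [seq u.2 | u <- w & u.1 == (a, c)].
case/andP => /and5P[/allP h1 hz hz1 he /andP[/Z.eqb_spec de pe]].
case/and5P => lam0 /allP hh /allP hw /allP hcyc /hasP[a0 ha0 /hasP[c0 hc0 hnz]].
have hw' a c : a \in neg -> c \in neg -> [/\ forall u, u \in wv a c -> u.1 \in neg1,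
    a \notin neg1 \/ c \notin neg1 -> wv a c = [::]
    & svec b (wv a c) = sgn K (par a) (par c) *: svec b (wv c a)].
  move=> ha hc; have /and3P[/allP w1 w2 w3] := allP (hw a ha) c hc; split=> //.
    by move=> hn; case/orP: w2 => [/andP[x1 x2]|/eqP //]; case: hn => /negP.
  rewrite (vec_veq b w3) vec_scale; congr (_ *: _).
  by rewrite /sgn /zsgn; case: ifP; rewrite ?expr1 ?expr0.
have adrE v c : c \in neg -> (forall u, u \in v -> (u.1 < n)%N) ->
    br (svec b v) (b c) = svec b (adr T v c).
  move=> /negD [hc _]; elim: v => [|u v IH] hv; first by rewrite !vec_nil (lsa_br0l hg).
  rewrite /svec big_cons (lsa_brPl hg) -/(svec b v) IH => [|x hx]; last by apply: hv; rewrite inE hx orbT.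
  rewrite /adr /= -/(svec b _) vec_cat vec_scale tab // hv // mem_head //.
have wlt a c u : a \in neg -> c \in neg -> u \in wv a c -> (u.1 < n)%N.
  by move=> ha hc hu; have [h _ _] := hw' a c ha hc; have [] := neg1D (h u hu).
have n1 i : ix i \in neg1 <-> dg (ix i) = -1.
  split=> [/neg1D []//|di]; apply: neg1I => //; by case: (negD (ix_neg i)).
have n2 i : ix i \notin neg1 -> dg (ix i) = -2 /\ par (ix i) = false.
  move=> hn; have := h1 _ (ix_neg i); rewrite (negPf hn) => /andP[/Z.eqb_spec di pi].
  by split; [rewrite /dg di|apply: negbTE].
have n2' i : dg (ix i) = -2 -> ix i \notin neg1.
  by move=> di; apply/negP => /n1; rewrite di.
have [iz ez] := ix_ex hz; subst z.
have [hzn _] := negD (ix_neg iz).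
have hom_e : gl_hom 2 false (b e : model).
  by have := homT_b he; rewrite /dg de (negPf pe).
apply: (@InfDim_odd_contact _ _ _ _ _ _ _ model_glsa model_negbasis model_dual model_gen
  (fun i j => svec b (wv (ix i) (ix j)) : model) _ _ _ _ _ _ _ iz (b e) (zK lam)).
- by move=> i; have [/n1 ->|/n2 [-> _]] := boolP (ix i \in neg1); [left|right].
- by move=> i /n1 hi; have := h1 _ (ix_neg i); rewrite hi.
- by move=> i /n2' /n2 [].
- move=> i j; have [w1 _ _] := hw' _ _ (ix_neg i) (ix_neg j).
  rewrite /svec big_seq; apply: (big_ind (fun x : g => homT (-1) true x)).
  + exact: homT0.
  + by move=> x y hx hy; rewrite -[x]scale1r; apply: homT_lin.
  + move=> u /w1 hu; rewrite -[_ *: _]addr0; apply: homT_lin; last exact: homT0.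
    have [hun du] := neg1D hu; have := h1 _ (neg1_neg hu); rewrite hu => pu.
    by have := homT_b hun; rewrite du pu.
- move=> i j hij; have [_ w2 _] := hw' _ _ (ix_neg i) (ix_neg j); rewrite w2 ?vec_nil //.
  by case: hij => /n2'; [left|right].
- by move=> i j; have [_ _] := hw' _ _ (ix_neg i) (ix_neg j).
- move=> k i j; have := allP (allP (hcyc _ (ix_neg k)) _ (ix_neg i)) _ (ix_neg j).
  move=> ve; rewrite /gl_br /= /bI !adrE //; first last.
  + by move=> u; apply: wlt.
  + by move=> u; apply: wlt.
  rewrite (vec_veq b ve) vec_scale; congr (_ *: _).
  by rewrite /sgn /zsgn; case: ifP; rewrite ?expr1 ?expr0.
- exact: model_transitive.
- by case: (n2 iz hz1).
- by rewrite zK_eq0.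
- exact: hom_e.
- move=> i; rewrite /gl_br /= /bI (tab he hzn) -/(svec b _) adrE //; last first.
    by move=> u hu; have [] := tabP he hzn hu.
  by rewrite (vec_veq b (hh _ (ix_neg i))) /svec big_seq1 /= zKM.
- have [i ei] := ix_ex ha0; have [j ej] := ix_ex hc0; subst a0 c0; exists i, j.
  move: hnz; rewrite -/(wv _ _); case ew: (wv _ _) => [//|[l x] [|//]] x0.
  have hl : (l < n)%N by apply: (wlt _ _ (l, x) ha0 hc0); rewrite ew mem_head.
  apply: contraNneq x0 => /(congr1 (cf l)); rewrite /svec big_seq1 /= cf0 cfZ cf_dual // eqxx mulr1.
  by move=> /eqP; rewrite zK_eq0.
Qed.

Theorem model_IsPr : dmin = Z0 -> @IsPr K model model id.
Proof.
move=> d0; apply: (IsPr_of_inner model_glsa model_negbasis model_transitive) => d hd.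
by apply: model_inner; rewrite d0.
Qed.

Theorem model_IsPr0 : dmin = Zpos 1 -> @IsPr0 K model model id.
Proof.
move=> d0; apply: (IsPr0_of_inner model_glsa model_negbasis model_transitive) => d hd.
by apply: model_inner; rewrite d0.
Qed.

Theorem model_prolong : InfDim pro ->
  exists (P : gLSA K) (phi : model -> P), IsPr phi /\ InfDim P.
Proof.
by move=> hinf; exists pro, (phiP model_glsa model_negbasis); split=> //; apply: prolong_IsPr;
  [exact: model_dual|exact: model_gen].
Qed.
End Model.

(** * From roots to gradings *)

Lemma lin_on_sum (K : fieldType) (V : vectType K) (h : {vspace V}) (f : V -> K) (J : Type)
    (s : seq J) (c : J -> K) (x : J -> V) : lin_on h f -> (forall j, x j \in h) ->
  f (\sum_(j <- s) c j *: x j) = \sum_(j <- s) c j * f (x j).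
Proof.
move=> lf hx; have f0 : f 0 = 0.
  by have := lf (-1) 0 0 (mem0v h) (mem0v h); rewrite scaler0 addr0 mulN1r addNr.
elim: s => [|j s IH]; first by rewrite !big_nil.
by rewrite !big_cons lf ?IH //; apply: memv_suml => i _; apply: memvZ.
Qed.

(** The matrix of the functionals on a basis of [h] is square, and independence of the functionals
    makes its rows independent, so it can be inverted. *)
Lemma dual_basis (K : fieldType) (V : vectType K) (h : {vspace V}) (r : nat) (a : 'I_r -> V -> K) :
  (forall i, lin_on h (a i)) -> \dim h = r ->
  (forall v : 'I_r -> K, (forall x, x \in h -> \sum_i v i * a i x = 0) -> forall i, v i = 0) ->
  exists H : 'I_r -> V, [/\ forall j, H j \in h, forall i j, a i (H j) = (i == j)%:R
    & forall x, x \in h -> x = \sum_j a j x *: H j].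
Proof.
move=> la dh; rewrite -dh in a la *; move=> ind.
pose X := vbasis h; have hX j : X`_j \in h.
  have [hj|hj] := ltnP j (\dim h); last by rewrite nth_default ?mem0v // size_tuple.
  by apply: vbasis_mem; apply: mem_nth; rewrite size_tuple.
have bX : basis_of h X := vbasisP h.
pose M := \matrix_(i < \dim h, j < \dim h) a i X`_j.
have uM : M \in unitmx.
  rewrite -row_free_unit; apply/inj_row_free => v vM; apply/rowP => i; rewrite mxE.
  apply: (ind (fun i => v 0 i)) => x hx; rewrite (coord_basis bX hx).
  under eq_bigr => k _ do rewrite (lin_on_sum _ _ (la k) (fun j : 'I_(\dim h) => hX j)) mulr_sumr.
  rewrite exchange_big big1 //= => j _.
  have := congr1 (fun N : 'rV_(\dim h) => N 0 j) vM; rewrite !mxE => e.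
  under eq_bigr => k _ do rewrite mulrCA.
  rewrite -mulr_sumr; apply/eqP; rewrite mulf_eq0; apply/orP; right; apply/eqP.
  by rewrite -[RHS]e; apply: eq_bigr => k _; rewrite mxE.
pose H j := \sum_k (invmx M) k j *: X`_k.
have hH j : H j \in h by apply: memv_suml => k _; apply/memvZ/hX.
have dual i j : a i (H j) = (i == j)%:R.
  rewrite (lin_on_sum _ _ (la i) (fun k : 'I_(\dim h) => hX k)).
  have := congr1 (fun N : 'M_(\dim h) => N i j) (mulmxV uM); rewrite !mxE => <-.
  by apply: eq_bigr => k _; rewrite mxE mulrC.
exists H; split=> // x hx; apply/eqP; rewrite -subr_eq0; apply/eqP.
set y := x - _; have hy : y \in h by apply: memvB => //; apply: memv_suml => k _; apply/memvZ.
have ay i : a i y = 0.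
  rewrite /y addrC -scaleN1r la //; last by apply: memv_suml => k _; apply/memvZ.
  rewrite (lin_on_sum _ _ (la i) hH) (bigD1 i) //= dual eqxx mulr1 big1 ?addr0 => [|k ne].
    by rewrite mulN1r addNr.
  by rewrite dual eq_sym (negPf ne) mulr0.
have : M *m \col_j coord X j y = 0.
  apply/colP => i; rewrite !mxE -[RHS](ay i) {2}(coord_basis bX hy).
  rewrite (lin_on_sum _ _ (la i) (fun k : 'I_(\dim h) => hX k)); apply: eq_bigr => j _.
  by rewrite !mxE mulrC.
move=> /(congr1 (mulmx (invmx M))); rewrite mulKmx // mulmx0 => c0.
rewrite (coord_basis bX hy) big1 // => j _.
by have := congr1 (fun N : 'cV_(\dim h) => N j 0) c0; rewrite !mxE => ->; rewrite scale0r.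
Qed.

Definition zcol (M : seq (seq Z)) k : seq Z := [seq nth Z0 q k | q <- M].
Definition zcomb (r : nat) (w : seq Z) (M : seq (seq Z)) : seq Z := [seq zdot w (zcol M k) | k <- iota 0 r].

(** [FI] and [Fphi] hold the doubled coordinates of the simple roots of system I and of all listed
    roots; [pi] matches the order of the table with that of the list. The elimination certifies that
    the rows of [FI] are independent. *)
Definition check_frame d (FI Fphi : seq (seq Z)) (pi : seq nat) (pars : seq bool) : bool :=
  [&& size FI == rk d, size pi == (np d).*2, perm_eq pi (iota 0 (size pi)),
   all (fun t => (zcomb (rk d) (rwt d (rk d + t)%N) FI == nth [::] Fphi (nth 0%N pi t)) &&
      (nth false pars (nth 0%N pi t) == rpar d (rk d + t)%N)) (iota 0 (np d).*2)
   & elim_rows [seq zrow (rk d) (zcol FI k) | k <- iota 0 (rk d)] (map Z.of_nat (iota 0 (rk d)))].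

Definition bits (r : nat) (S : {set 'I_r}) : seq bool := [seq i \in S | i <- enum 'I_r].
Lemma size_bits r (S : {set 'I_r}) : size (bits S) = r.
Proof. by rewrite size_map size_enum_ord. Qed.
Lemma nth_bits r (S : {set 'I_r}) (i : 'I_r) : nth false (bits S) i = (i \in S).
Proof. by rewrite (nth_map i) ?size_enum_ord // nth_ord_enum. Qed.
(** The degrees of the simple roots of system I: [B] writes them in the simple roots of the given
    system, and the bits of [S] select the coefficients to be added. *)
Definition gvec (B : seq (seq Z)) (bs : seq bool) : seq Z :=
  [seq zdot q [seq if x then Zpos 1 else Z0 | x <- bs] | q <- B].
Definition degrees d B bs : seq Z := [seq zdot (gvec B bs) w | w <- rwts d].
Definition zinv (r : nat) (P Q : seq (seq Z)) := all (fun i => all (fun j =>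
  zdot (nth [::] P i) (zcol Q j) == if i == j then Zpos 1 else Z0) (iota 0 r)) (iota 0 r).
(** A linear code, so that codes add when weights do, negative coordinates included. *)
Definition wcodes d : seq Z := [seq foldr (fun z a => Z.add z (Z.mul (Zpos 64) a)) Z0 w | w <- rwts d].
(** For an exceptional grading cohomology is tested from degree 1 on, and one of the two criteria
    certifies the infinite dimension of the full prolongation. *)
Definition check_one d T we (ow : nat * nat * Z * seq (nat * nat * seq (nat * Z))) (se : seq Z * bool) :=
  let n := rdim d in let pl := rpars d in let dgl := [seq zdot se.1 w | w <- rwts d] in
  if se.2 then check_grading T n we dgl pl (rk d) (np d) (Zpos 1) &&
    (check_even T pl (negl n dgl) (neg1l n dgl) ||
     check_odd T n dgl pl (negl n dgl) (neg1l n dgl) ow.1.1.1 ow.1.1.2 ow.1.2 ow.2)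
  else check_grading T n we dgl pl (rk d) (np d) Z0.
Definition check_base d (FI FX A B : seq (seq Z)) : bool :=
  [&& size A == rk d, size B == rk d, all (fun q => size q == rk d) A, all (fun q => size q == rk d) B
   & [&& all (fun i => zcomb (rk d) (nth [::] A i) FI == nth [::] FX i) (iota 0 (rk d)),
      zinv (rk d) A B & zinv (rk d) B A]].

(** * A basis of the algebra adapted to the table *)

Section Frame.
Variables (K : numFieldType) (g : LSA K).
Hypothesis hg : IsLSA g.
Hypothesis simple : IsSimpleLSA g.
Variables (h : {vspace g}) (ev : wt -> g -> K) (Phi : seq (wt * bool)) (d : rdata).
Local Notation r := (rk d).
Local Notation n := (rdim d).
Local Notation br := (@lsa_br K g).
Variable f : nat -> g -> K.
Hypothesis f_lin : forall k, (k < r)%N -> lin_on h (f k).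
Hypothesis dim_h : \dim h = r.
Hypothesis f_ind : forall v : nat -> K, (forall H, H \in h -> \sum_(k < r) v k * f k H = 0) ->
  forall k, (k < r)%N -> v k = 0.
Hypothesis dim_g : (\dim (lsa_par g false) + \dim (lsa_par g true))%N = n.
Hypothesis RD : RootData h ev Phi.

(* [c]: twice the coordinates of the weight [w]. *)
Definition Ev (w : wt) (c : seq Z) : Prop :=
  forall H, H \in h -> ev w H = (\sum_(k < r) zK (nth Z0 c k) * f k H) / 2.

Variables (FI Fphi : seq (seq Z)) (pi : seq nat).
Hypothesis size_Phi : size Phi = (np d).*2.
Hypothesis ev_phi : forall q, (q < size Phi)%N -> Ev (nth (W0, false) Phi q).1 (nth [::] Fphi q).
Hypothesis ck : check_frame d FI Fphi pi (map snd Phi).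
Hypothesis ckd : check_all d.

Definition af j H : K := (\sum_(k < r) zK (nth Z0 (nth [::] FI j) k) * f k H) / 2.
Definition rootw t : wt * bool := nth (W0, false) Phi (nth 0%N pi t).

Let size_FI : size FI = r. Proof. by case/and5P: ck => /eqP. Qed.
Let size_pi : size pi = (np d).*2. Proof. by case/and5P: ck => _ /eqP. Qed.
Let pi_lt t : (t < (np d).*2)%N -> (nth 0%N pi t < size Phi)%N.
Proof.
move=> ht; case/and5P: ck => _ _ hp _ _; rewrite size_Phi.
have : nth 0%N pi t \in pi by apply: mem_nth; rewrite size_pi.
by rewrite (perm_mem hp) mem_iota size_pi.
Qed.
Let ckw : check_wts d. Proof. by case/and4P: ckd. Qed.
Let size_wt i : (i < n)%N -> size (rwt d i) = r.
Proof.
by case/and5P: ckw => _ /eqP h1 h2 _ _ hi; apply/eqP/(allP h2)/mem_nth; rewrite h1.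
Qed.
Let rt_lt t : (t < (np d).*2)%N -> (r + t < n)%N. Proof. by rewrite ltn_add2l. Qed.

Lemma sum_zcomb (w : seq Z) (M : seq (seq Z)) (v : nat -> K) : size w = r -> size M = r ->
  \sum_(k < r) zK (nth Z0 (zcomb r w M) k) * v k =
  \sum_(j < r) zK (nth Z0 w j) * \sum_(k < r) zK (nth Z0 (nth [::] M j) k) * v k.
Proof.
move=> sw sM; under [RHS]eq_bigr => j _ do rewrite mulr_sumr.
rewrite exchange_big; apply: eq_bigr => k _ /=.
rewrite (nth_map 0%N) ?size_iota // nth_iota // add0n (@zdotE _ _ r) ?size_map //.
rewrite (big_morph zK (@zKD K) (zK0 K)) mulr_suml; apply: eq_bigr => j _.
by rewrite zKM (nth_map [::]) ?sM // mulrA.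
Qed.

Lemma af_lin j : lin_on h (af j).
Proof.
move=> a x y hx hy; rewrite /af mulrA -mulrDl; congr (_ / _).
rewrite mulr_sumr -big_split; apply: eq_bigr => k _ /=.
by rewrite f_lin // mulrDr mulrCA.
Qed.

Lemma af_ind (v : nat -> K) : (forall H, H \in h -> \sum_(j < r) v j * af j H = 0) ->
  forall j, (j < r)%N -> v j = 0.
Proof.
move=> hv.
have hc k : (k < r)%N -> \sum_(j < r) v j * zK (nth Z0 (nth [::] FI j) k) = 0.
  apply: (f_ind (v := fun k => \sum_(j < r) v j * zK (nth Z0 (nth [::] FI j) k))) => H hH.
  under eq_bigr => i _ do rewrite mulr_suml.
  rewrite exchange_big /= -[RHS](mul0r (2 : K)) -[in RHS](hv H hH) mulr_suml; apply: eq_bigr => j _.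
  by rewrite -mulrA /af divfK ?pnatr_eq0 // mulr_sumr; apply: eq_bigr => k0 _; rewrite mulrA.
case/and5P: ck => _ _ _ _ hel.
have := elim_rowsP (x := fun z => v (Z.to_nat z)) hel => hx j hj.
have := hx _ (Z.of_nat j); rewrite Nat2Z.id; apply; last by apply: map_f; apply: mem_iota0.
move=> q /mapP[k]; rewrite mem_iota add0n => /andP[_ hk] ->; rewrite rval_zrow -[RHS](hc k hk).
by apply: eq_bigr => i _; rewrite Nat2Z.id mulrC (nth_map [::]) ?size_FI.
Qed.

Lemma ev_root t H : (t < (np d).*2)%N -> H \in h ->
  ev (rootw t).1 H = \sum_(j < r) zK (nth Z0 (rwt d (r + t)%N) j) * af j H.
Proof.
move=> ht hH; rewrite /rootw (ev_phi (pi_lt ht)) //.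
case/and5P: ck => _ _ _ h4 _; have /andP[/eqP <- _] := allP h4 t (mem_iota0 ht).
rewrite (@sum_zcomb _ _ (fun k => f k H)) ?size_wt ?rt_lt // mulr_suml; apply: eq_bigr => j _.
by rewrite -mulrA.
Qed.

Lemma rootw_mem t : (t < (np d).*2)%N -> rootw t \in Phi.
Proof. by move=> ht; apply/mem_nth/pi_lt. Qed.
Lemma rootw_par t : (t < (np d).*2)%N -> (rootw t).2 = rpar d (r + t)%N.
Proof.
move=> ht; case/and5P: ck => _ _ _ h4 _; have /andP[_ /eqP <-] := allP h4 t (mem_iota0 ht).
by rewrite (nth_map (W0, false)) ?pi_lt.
Qed.
Lemma perm_Phi : perm_eq [seq rootw t | t <- iota 0 (np d).*2] Phi.
Proof.
have -> : [seq rootw t | t <- iota 0 (np d).*2] = [seq nth (W0, false) Phi q | q <- pi].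
  by rewrite -[X in _ = map _ X](mkseq_nth 0%N pi) size_pi -map_comp.
case/and5P: ck => _ _ hp _ _; rewrite -[X in perm_eq _ X](mkseq_nth (W0, false) Phi) /mkseq; apply: perm_map.
by rewrite (perm_trans hp) // size_pi size_Phi.
Qed.

Definition is_frame (b : nat -> g) (cf : nat -> g -> K) : Prop :=
  [/\ [/\ forall i a x y, cf i (a *: x + y) = a * cf i x + cf i y,
          forall v, v = \sum_(i < n) cf i v *: b i
        & forall i j, (i < n)%N -> (j < n)%N -> cf i (b j) = (i == j)%:R],
      forall i, (i < n)%N -> b i \in lsa_par g (rpar d i),
      forall i j, (i < n)%N -> (j < n)%N -> br (b i) (b j) = \sum_(u <- tb (rtab d) i j) zK u.2 *: b u.1,
      (forall j, (j < r)%N -> b j \in h) /\ forall H, H \in h -> exists a : nat -> K, H = \sum_(j < r) a j *: b j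
    & (forall t, (t < (np d).*2)%N -> rootspace h (ev (rootw t).1) (b (r + t)%N)) /\
      (forall t x, (t < (np d).*2)%N -> rootspace h (ev (rootw t).1) x -> exists c, x = c *: b (r + t)%N)].

Theorem frame_exists : exists (b : nat -> g) (cf : nat -> g -> K), is_frame b cf.
Proof.
(* The Cartan basis is dual to the simple roots of system I, so that it acts on a root vector by the
   coordinates stored in the table. *)
have [|H [hH dualH spanH]] := @dual_basis _ _ h r (fun j => af j) (fun j => af_lin j) dim_h.
  move=> v hv j; pose v' k := if insub k is Some k0 then v k0 else 0.
  have v'E (k : 'I_r) : v' k = v k by rewrite /v' valK.
  rewrite -v'E; apply: af_ind => // x hx; rewrite -[RHS](hv x hx).
  by apply: eq_bigr => k _; rewrite v'E.
case: (RD) => hpar hab roots span.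
have exR t : exists e : g, (t < (np d).*2)%N -> [/\ e != 0, e \in lsa_par g (rpar d (r + t)%N) &
    forall x, rootspace h (ev (rootw t).1) x <-> exists c : K, x = c *: e].
  have [ht|ht] := ltnP t (np d).*2; last by exists 0.
  by have [e] := roots _ (rootw_mem ht); rewrite rootw_par // => he; exists e.
pose rv t := projT1 (cid (exR t)).
have rvP t : (t < (np d).*2)%N -> [/\ rv t != 0, rv t \in lsa_par g (rpar d (r + t)%N) &
    forall x, rootspace h (ev (rootw t).1) x <-> exists c : K, x = c *: rv t].
  by rewrite /rv; case: cid.
pose e i := if insub i is Some j then H j else rv (i - r)%N.
have eH (j : 'I_r) : e j = H j by rewrite /e valK.
have eR t : e (r + t)%N = rv t.
  by rewrite /e insubF ?addKn // ltnNge leq_addr.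
have idx i : (i < n)%N -> (exists j : 'I_r, i = j) \/ exists2 t, (t < (np d).*2)%N & i = (r + t)%N.
  move=> hi; have [ir|ir] := ltnP i r; first by left; exists (Ordinal ir).
  by right; exists (i - r)%N; rewrite ?subnKC // -(ltn_add2l r) subnKC.
have e_par i : (i < n)%N -> e i \in lsa_par g (rpar d i).
  case/idx => [[j ->]|[t ht ->]]; last by rewrite eR; case: (rvP t ht).
  rewrite eH /rpar /rpars nth_cat size_nseq ltn_ord nth_nseq ltn_ord.
  exact: (subvP hpar).
have rs_e t : (t < (np d).*2)%N -> rootspace h (ev (rootw t).1) (rv t).
  by move=> ht; case: (rvP t ht) => _ _ hx; apply/hx; exists 1; rewrite scale1r.
have e_wt j i : (j < r)%N -> (i < n)%N -> br (e j) (e i) = zK (nth Z0 (rwt d i) j) *: e i.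
  move=> hj; have -> : e j = H (Ordinal hj) by rewrite -eH.
  case/idx => [[k ->]|[t ht ->]].
    rewrite eH hab // /rwt /rwts nth_cat size_nseq ltn_ord nth_nseq ltn_ord nth_nseq hj.
    by rewrite zK0 scale0r.
  rewrite eR (rs_e t ht) // ev_root // (bigD1 (Ordinal hj)) //= (dualH (Ordinal hj)) eqxx mulr1.
  rewrite big1 ?addr0 // => k ne; by rewrite dualH (negPf ne) mulr0.
(* [RootData] gives spanning, and the dimension count turns this into a basis. *)
have e_basis : basis_of fullv (mkseq e n).
  rewrite basisEdim size_mkseq; apply/andP; split; last first.
    case: (hg) => _ [h1 h2] _ _ _; rewrite -h1 dimv_disjoint_sum ?dim_g //.
  apply/subvP => v _; have [H0 [xs [hH0 hxs ->]]] := span v; apply: memvD.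
    rewrite (spanH _ hH0); apply: memv_suml => j _; apply/memvZ/memv_span.
    by rewrite -eH; apply: map_f; apply: mem_iota0; apply: leq_trans (ltn_ord j) (leq_addr _ _).
  rewrite big_seq; apply: memv_suml => q hq.
  have : q \in [seq rootw t | t <- iota 0 (np d).*2] by rewrite (perm_mem perm_Phi).
  case/mapP=> t; rewrite mem_iota add0n => /andP[_ ht] eq.
  have [_ _ hx] := rvP t ht; have := hxs _ hq; rewrite {1}eq => /hx [c ->].
  by apply/memvZ/memv_span; rewrite -eR; apply: map_f; apply: mem_iota0; apply: rt_lt.
have [cf [cfP cfE cf_dual]] := basis_coords e_basis.
have /and4P[_ ck2 ck3 ck4] := ckd.
have [b [hb1 hb2 hb3]] := structure_constants_cf hg simple e_basis e_par e_wt ckw cfP cfE cf_dual ck2 ck3 ck4.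
have exc i : exists c : K, (i < n)%N -> c != 0 /\ b i = c *: e i.
  have [hi|hi] := ltnP i n; last by exists 0.
  by have [c c0 ec] := hb1 i hi; exists c.
pose c i := projT1 (cid (exc i)).
have cP i : (i < n)%N -> c i != 0 /\ b i = c i *: e i by rewrite /c; case: cid.
exists b, (fun i v => (c i)^-1 * cf i v); split.
- split.
  + by move=> i a x y; rewrite cfP mulrDr mulrCA.
  + move=> v; rewrite {1}(cfE v); apply: eq_bigr => i _; have [c0 ->] := cP i (ltn_ord i).
    by rewrite scalerA mulrAC mulVf // mul1r.
  + move=> i j hi hj; have [c0 ->] := cP j hj; rewrite -[c j *: _]addr0 cfP cf_dual //.
    have cf0 : cf i 0 = 0 by have := cfP i (-1) 0 0; rewrite scaler0 addr0 mulN1r addNr.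
    rewrite cf0 addr0; have [->|ne] := eqVneq i j; last by rewrite !mulr0.
    by rewrite mulr1 mulVf.
- by move=> i hi; have [_ ->] := cP i hi; apply/memvZ/e_par.
- exact: hb3.
- split=> [j hj|H0 hH0]; first by rewrite hb2 //; have -> : e j = H (Ordinal hj) by rewrite -eH.
  by exists (fun j => af j H0); rewrite {1}(spanH _ hH0); apply: eq_bigr => j _; rewrite hb2 // eH.
- split=> [t ht|t x ht hx].
    have [_ ->] := cP _ (rt_lt ht); rewrite eR => H0 hH0.
    by rewrite (lsa_brZr hg) (rs_e t ht) // !scalerA mulrC.
  have [_ _ h3] := rvP t ht; have [c0 ec] := cP _ (rt_lt ht); have [a ->] := (h3 x).1 hx.
  by exists (a / c (r + t)%N); rewrite ec eR scalerA divfK.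
Qed.

(** * The root grading in coordinates *)

Section Grading.
Variables (b : nat -> g) (cf : nat -> g -> K).
Hypothesis fr : is_frame b cf.
Variables (sr : 'I_r -> wt) (S : {set 'I_r}) (FX A B : seq (seq Z)).
Hypothesis ev_sr : forall i : 'I_r, Ev (sr i) (nth [::] FX i).
Hypothesis cks : check_base d FI FX A B.

Local Notation dgl := (degrees d B (bits S)).
Local Notation dgS i := (int_of_Z (nth Z0 dgl i)).

Lemma zK_dg t : (t < (np d).*2)%N ->
  (dgS (r + t)%N)%:~R = \sum_(i in S) \sum_(j < r)
     zK (nth Z0 (rwt d (r + t)%N) j) * zK (nth Z0 (nth [::] B j) i) :> K.
Proof.
move=> ht; case/and5P: cks => _ /eqP sB _ /allP sBr _.
have s1 : size (rwts d) = n by case/and5P: ckw => _ /eqP.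
rewrite (nth_map [::]) ?s1 ?rt_lt // -/(rwt d _) -/(zK _) (@zdotE _ _ r) ?size_map //; last by rewrite size_wt ?rt_lt.
rewrite (big_morph zK (@zKD K) (zK0 K)) exchange_big; apply: eq_bigr => j _ /=.
rewrite zKM mulrC -mulr_sumr; congr (_ * _).
rewrite (nth_map [::]) ?sB // (@zdotE _ _ r) 1?size_map ?size_bits //; last first.
  by apply/eqP; apply: sBr; apply: mem_nth; rewrite sB.
rewrite (big_morph zK (@zKD K) (zK0 K)) [RHS]big_mkcond; apply: eq_bigr => i _ /=.
rewrite zKM (nth_map false) ?size_bits // nth_bits.
by case: (i \in S); rewrite ?mulr1 ?mulr0.
Qed.

Lemma ev_sr_af i H : H \in h ->
  ev (sr i) H = \sum_(j < r) zK (nth Z0 (nth [::] A i) j) * af j H.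
Proof.
move=> hH; case/and5P: cks => /eqP sA _ /allP sAr _ /and3P[/allP h1 _ _].
rewrite (ev_sr i) //; have /eqP <- := h1 _ (mem_iota0 (ltn_ord i)).
rewrite (@sum_zcomb _ _ (fun k => f k H)) // ?mulr_suml; last first.
  by apply/eqP; apply: sAr; apply: mem_nth; rewrite sA.
by apply: eq_bigr => j _; rewrite -mulrA.
Qed.

Lemma check_inv (P Q : seq (seq Z)) (i j : nat) : size P = r -> size Q = r ->
  (forall q, q \in P -> size q = r) -> zinv r P Q -> (i < r)%N -> (j < r)%N ->
  \sum_(k < r) zK (nth Z0 (nth [::] P i) k) * zK (nth Z0 (nth [::] Q k) j) = (i == j)%:R :> K.
Proof.
move=> sP sQ sPr /allP hc hi hj.
have /eqP e := allP (hc i (mem_iota0 hi)) j (mem_iota0 hj).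
have -> : (i == j)%:R = zK (if i == j then Zpos 1 else Z0) :> K by case: (i == j).
rewrite -e (@zdotE _ _ r) ?size_map //; last by apply: sPr; apply: mem_nth; rewrite sP.
rewrite (big_morph zK (@zKD K) (zK0 K)); apply: eq_bigr => k _.
by rewrite zKM (nth_map [::]) ?sQ.
Qed.

(** [A] and [B] are inverse integer matrices between the given simple roots and those of system I.
    This provides integral coefficients for every root; their uniqueness comes from the independence
    of the functionals [af]. *)
Lemma rdegP t k : (t < (np d).*2)%N -> rdeg h ev sr S (rootw t).1 k <-> k = dgS (r + t)%N.
Proof.
move=> ht; case/and5P: (cks) => /eqP sA /eqP sB /allP sAr /allP sBr /and3P[_ hAB hBA].
have AB i j := check_inv sA sB (fun q hq => eqP (sAr q hq)) hAB (i := i) (j := j).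
have BA i j := check_inv sB sA (fun q hq => eqP (sBr q hq)) hBA (i := i) (j := j).
split=> [[m [hm <-]]|->].
  have mw j : (j < r)%N -> zK (nth Z0 (rwt d (r + t)%N) j) =
      \sum_(i < r) (m i)%:~R * zK (nth Z0 (nth [::] A i) j) :> K.
    move=> hj; apply/eqP; rewrite -subr_eq0; apply/eqP; move: j hj.
    apply: af_ind => H hH; under eq_bigr => j _ do rewrite mulrBl mulr_suml.
    rewrite sumrB -ev_root // hm // exchange_big /=; apply/eqP; rewrite subr_eq0; apply/eqP.
    by apply: eq_bigr => i _; rewrite ev_sr_af // mulr_sumr; apply: eq_bigr => j _; rewrite mulrA.
  apply: (@intr_inj K); rewrite zK_dg // rmorph_sum /=; apply: eq_bigr => i _.
  under eq_bigr => j _ do rewrite mw // mulr_suml.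
  rewrite exchange_big /= (bigD1 i) //= [X in _ + X]big1 => [|i' ne].
    by under eq_bigr => j _ do rewrite -mulrA; rewrite -mulr_sumr AB // eqxx mulr1 addr0.
  by under eq_bigr => j _ do rewrite -mulrA; rewrite -mulr_sumr AB // (inj_eq val_inj) (negPf ne) mulr0.
pose m (i : 'I_r) := int_of_Z (zdot (rwt d (r + t)%N) (zcol B i)).
have mE i : (m i)%:~R = \sum_(j < r) zK (nth Z0 (rwt d (r + t)%N) j) * zK (nth Z0 (nth [::] B j) i) :> K.
  rewrite -/(zK _) (@zdotE _ _ r) ?size_map ?size_wt ?rt_lt //.
  rewrite (big_morph zK (@zKD K) (zK0 K)); apply: eq_bigr => l _.
  by rewrite zKM (nth_map [::]) ?sB.
exists m; split=> [H hH|]; last first.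
  by apply: (@intr_inj K); rewrite zK_dg // rmorph_sum /=; apply: eq_bigr => i _; rewrite mE.
rewrite ev_root //; under [RHS]eq_bigr => i _ do rewrite ev_sr_af // mulr_sumr.
rewrite [RHS]exchange_big /=; apply: eq_bigr => j _.
under eq_bigr => i _ do rewrite mulrA; rewrite -mulr_suml; congr (_ * _).
under eq_bigr => i _ do rewrite mE mulr_suml.
rewrite exchange_big /= (bigD1 j) //= [X in _ + X]big1 => [|l ne].
  by under eq_bigr => i _ do rewrite -mulrA; rewrite -mulr_sumr BA // eqxx mulr1 addr0.
by under eq_bigr => i _ do rewrite -mulrA; rewrite -mulr_sumr BA // (inj_eq val_inj) (negPf ne) mulr0.
Qed.

Hypothesis uniq_Phi : uniq Phi.

Lemma gpieceP k p x : gpiece h ev Phi sr S k p x <-> homT n dgl (rpars d) cf k p x.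
Proof.
case: fr => -[cfP cfE cf_dual] _ _ [b_h h_b] [rs rs_ex].
have cf0 i : cf i 0 = 0 by have := cfP i (-1) 0 0; rewrite scaler0 addr0 mulN1r addNr.
have cfZ i a v : cf i (a *: v) = a * cf i v by rewrite -[a *: v]addr0 cfP cf0 addr0.
have cfD i u v : cf i (u + v) = cf i u + cf i v by rewrite -[u]scale1r cfP mul1r scale1r.
have cf_sum i := big_morph (cf i) (cfD i) (cf0 i).
have s1 : size (rwts d) = n by case/and5P: ckw => _ /eqP.
have dg0 j : (j < r)%N -> dgS j = 0 /\ rpar d j = false.
  move=> hj; rewrite (nth_map [::]) ?s1 //; last by apply: leq_trans hj (leq_addr _ _).
  rewrite /rpar /rpars /rwts !nth_cat !size_nseq hj !nth_nseq hj; split=> //.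
  rewrite (@zdotE _ _ r) ?size_map ?size_nseq //; last by case/and5P: cks => _ /eqP.
  have -> // : \big[Z.add/Z0]_(l < r) Z.mul (nth Z0 (gvec B (bits S)) l) (nth Z0 (nseq r Z0) l) = Z0.
  apply: (big_ind (fun z => z = Z0)) => // [x1 y1 -> -> //|l _]; by rewrite nth_nseq ltn_ord Z.mul_0_r.
have sum_Phi (xs : wt * bool -> g) : \sum_(q <- Phi) xs q = \sum_(t < (np d).*2) xs (rootw t).
  by rewrite -(perm_big _ perm_Phi) big_map -{1}(subn0 (np d).*2) big_mkord.
have sum_n (F : nat -> g) : \sum_(i < n) F i = \sum_(j < r) F j + \sum_(t < (np d).*2) F (r + t)%N.
  by rewrite big_split_ord.
have idx i : (i < n)%N -> (i < r)%N \/ exists2 t, (t < (np d).*2)%N & i = (r + t)%N.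
  move=> hi; have [ir|ir] := ltnP i r; first by left.
  by right; exists (i - r)%N; rewrite ?subnKC // -(ltn_add2l r) subnKC.
split=> [[H [xs [hH H0 hxs ->]]]|hx].
  have exc t : exists c : K, (t < (np d).*2)%N -> xs (rootw t) = c *: b (r + t)%N.
    have [ht|ht] := ltnP t (np d).*2; last by exists 0.
    have [h1 _] := hxs _ (rootw_mem ht); by have [c ec] := rs_ex t _ ht h1; exists c.
  have [c hc] := choice exc.
  have [a ea] := h_b H hH.
  have -> : H + \sum_(q <- Phi) xs q = \sum_(i < n) (if (i < r)%N then a i else c (i - r)%N) *: b i.
    rewrite (sum_n (fun i => (if (i < r)%N then a i else c (i - r)%N) *: b i)) sum_Phi {1}ea.
    congr (_ + _); apply: eq_bigr => t _; first by rewrite ltn_ord.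
    by rewrite hc // ltnNge leq_addr addKn.
  have cfv i : (i < n)%N -> cf i (\sum_(i < n) (if (i < r)%N then a i else c (i - r)%N) *: b i) =
      if (i < r)%N then a i else c (i - r)%N.
    move=> hi; rewrite cf_sum (bigD1 (Ordinal hi)) //= cfZ cf_dual // eqxx mulr1 big1 ?addr0 // => l ne.
    rewrite cfZ cf_dual // (_ : (i == l) = false) ?mulr0 //; apply: contraNF ne => /eqP e.
    by apply/eqP/val_inj.
  move=> i hi ne; rewrite cfv //; case: (idx i hi) ne => [ir|[t ht ->]].
    have [d0 p0] := dg0 i ir; rewrite ir /dg /zdg d0 /pcode -/(rpar d i) p0 => ne.
    have : (k != 0) || p by move: ne; rewrite xpair_eqE negb_and eq_sym; case: (p) => /=; rewrite ?orbT ?orbF.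
    move=> /H0 hH0; have ir' : (i < n)%N by [].
    have := congr1 (cf i) ea; rewrite hH0 cf0 cf_sum (bigD1 (Ordinal ir)) //= cfZ cf_dual //.
    rewrite eqxx mulr1 big1 ?addr0 // => l ne'.
    rewrite cfZ cf_dual //; last by apply: leq_trans (ltn_ord l) (leq_addr _ _).
    rewrite (_ : (i == l) = false) ?mulr0 //; apply: contraNF ne' => /eqP e.
    by apply/eqP/val_inj.
  rewrite ltnNge leq_addr addKn /= => ne; apply/eqP; apply: contraNT ne => c0.
  have [_] := hxs _ (rootw_mem ht); rewrite hc // => h1.
  have bn0 : c t *: b (r + t)%N != 0.
    apply: contraNneq c0 => /(congr1 (cf (r + t)%N)); rewrite cfZ cf0 cf_dual ?rt_lt // eqxx mulr1.
    by move=> ->.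
  have [<- /(rdegP _ ht) ->] := h1 bn0.
  by rewrite /dg /zdg /pcode -/(rpar d _) -rootw_par.
pose RL := [seq rootw t | t <- iota 0 (np d).*2].
have uRL : uniq RL by rewrite (perm_uniq perm_Phi).
have iRL t : (t < (np d).*2)%N -> index (rootw t) RL = t.
  move=> ht; have {1}-> : rootw t = nth (W0, false) RL t.
    by rewrite (nth_map 0%N) ?size_iota // nth_iota.
  by rewrite index_uniq // size_map size_iota.
(* [gpiece] wants a family indexed by the roots themselves; a root is translated into its basis
   index through its position in [RL], where it occurs once. *)
exists (\sum_(j < r) cf j x *: b j), (fun q => cf (r + index q RL)%N x *: b (r + index q RL)%N).
split.
- by apply: memv_suml => j _; apply/memvZ/b_h.
- move=> kp; rewrite big1 // => j _; have [d0 p0] := dg0 j (ltn_ord j).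
  rewrite hx ?scale0r //; first by apply: leq_trans (ltn_ord j) (leq_addr _ _).
  rewrite /dg /zdg d0 /pcode -/(rpar d j) p0; apply: contraL kp => /eqP [<- <-].
  by rewrite eqxx.
- move=> q; rewrite -(perm_mem perm_Phi) => /mapP[t]; rewrite mem_iota add0n => /andP[_ ht] ->.
  rewrite iRL //; split=> [H hH|].
    by rewrite (lsa_brZr hg) (rs t ht) // !scalerA mulrC.
  move=> ne; have /eqP : (dg dgl (r + t)%N, pcode (rpars d) (r + t)%N) == (k, p).
    by apply: contraNT ne => ne; rewrite hx ?scale0r ?rt_lt.
  rewrite /dg /zdg /pcode -/(rpar d _) => -[<- <-]; rewrite rootw_par //; split=> //.
  exact/rdegP.
rewrite {1}(cfE x) (sum_n (fun i => cf i x *: b i)) sum_Phi; congr (_ + _).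
by apply: eq_bigr => t _; rewrite iRL.
Qed.

(** Functional and propositional extensionality turn the pointwise equivalence into an equality of
    structures, so the results on [model] transfer by rewriting. *)
Lemma gradedG_model : gradedG h ev Phi sr S = model n dgl (rpars d) cf.
Proof.
rewrite /gradedG /model; congr MkG; apply/funext => k; apply/funext => p; apply/funext => x.
exact/propext/gpieceP.
Qed.
End Grading.

Theorem graded_prolongation (sr : 'I_r -> wt) (S : {set 'I_r}) (FX A B : seq (seq Z)) ow exc :
  (forall i : 'I_r, Ev (sr i) (nth [::] FX i)) -> check_base d FI FX A B -> uniq Phi ->
  check_one d (rtab d) (wcodes d) ow (gvec B (bits S), exc) ->
  let G := gradedG h ev Phi sr S in
  (~~ exc -> @IsPr _ G G id) /\
  (exc -> (exists (P : gLSA K) (phi : G -> P), IsPr phi /\ InfDim P) /\ @IsPr0 _ G G id).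
Proof.
move=> ev_sr cks uPhi; have [b [cf fr]] := frame_exists.
rewrite (gradedG_model fr S ev_sr cks uPhi) /check_one /= -/(degrees d B (bits S)).
case: fr => -[cfP cfE cf_dual] b_par tab _ _.
case: exc => [/andP[ck1 inf]|ck0]; split=> // _; last first.
  have /and5P[_ _ homog _ _] := ck0.
  exact: (model_IsPr hg cfP cfE cf_dual b_par tab homog ck0).
have /and5P[_ _ homog _ _] := ck1; split; last first.
  exact: (model_IsPr0 hg cfP cfE cf_dual b_par tab homog ck1).
apply: (model_prolong (hg := hg) (cfP := cfP) (cfE := cfE) (cf_dual := cf_dual) (b_par := b_par)
  (tab := tab) (homog := homog) ck1).
case/orP: inf => inf; first exact: model_InfDim_even.
exact: (model_InfDim_odd hg cfP cfE cf_dual b_par tab homog ck1 inf).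
Qed.
End Frame.

(** * The algebras G(3) and F(4) *)

(** The odd roots of F(4) have half-integral coordinates; doubling makes all data integral. *)
Definition dbl (q : rat) : Z := Z_of_int (numq (2 * q)).
Definition half_integral (q : rat) : bool := 2 * q == (numq (2 * q))%:~R.

Lemma ratr_dbl (K : numFieldType) q : half_integral q -> ratr q = zK (dbl q) / 2 :> K.
Proof.
move=> /eqP e; rewrite /zK /dbl Z_of_intK -ratr_int -e rmorphM /= ratr_nat.
by rewrite mulrAC divff ?pnatr_eq0 // mul1r.
Qed.

Fixpoint allbits (r : nat) : seq (seq bool) :=
  if r is r'.+1 then [seq x :: s | x <- [:: true; false], s <- allbits r'] else [:: [::]].
Definition nzbits r := [seq s <- allbits r | has id s].
Definition unitbits (r i : nat) : seq bool := [seq j == i | j <- iota 0 r].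

Lemma mem_allbits s : s \in allbits (size s).
Proof. by elim: s => //= x s IH; rewrite cats0 mem_cat; apply/orP; case: x; [left|right]; apply: map_f. Qed.

Lemma bits_inj r : injective (@bits r).
Proof. by move=> S S' e; apply/setP => i; rewrite -!nth_bits e. Qed.

Lemma bits_set1 r (i : 'I_r) : bits [set i] = unitbits r i.
Proof.
apply: (@eq_from_nth _ false); rewrite ?size_bits ?size_map ?size_iota // => j hj.
by rewrite (nth_bits _ (Ordinal hj)) (nth_map 0%N) ?size_iota // nth_iota // in_set1 -(inj_eq val_inj).
Qed.

Lemma eq_set1_bits r (S : {set 'I_r}) i : (S == [set i]) = (bits S == unitbits r i).
Proof. by rewrite -bits_set1 (inj_eq (@bits_inj r)). Qed.

Lemma mem_nzbits r (S : {set 'I_r}) : S != set0 -> bits S \in nzbits r.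
Proof.
case/set0Pn=> i iS; rewrite mem_filter -[X in allbits X](size_bits S) mem_allbits andbT.
by apply/hasP; exists true => //; rewrite -iS -nth_bits; apply: mem_nth; rewrite size_bits.
Qed.

Definition find_pi d FI Fphi : seq nat :=
  [seq index (zcomb (rk d) (rwt d (rk d + t)%N) FI) Fphi | t <- iota 0 (np d).*2].
Definition find_A d FI FX : seq (seq Z) :=
  let rows := [seq zcomb (rk d) w FI | w <- rwts d] in [seq rwt d (index q rows) | q <- FX].
(** The vectors are normalised by [[e_s, f_s]] being the coroot of the simple root [s] and by every
    other vector being the bracket of its parents, with no further rescaling; this accounts for
    entries as large as 144. *)
Definition G3_rd : rdata := RData 3 14
  ([:: [:: 1; 0; 0];
    [:: 0; 1; 0];
    [:: 0; 0; 1];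
    [:: 1; 1; 0];
    [:: 0; 1; 1];
    [:: 1; 1; 1];
    [:: 0; 2; 1];
    [:: 1; 2; 1];
    [:: 0; 3; 1];
    [:: 1; 3; 1];
    [:: 0; 3; 2];
    [:: 1; 3; 2];
    [:: 1; 4; 2];
    [:: 2; 4; 2]])%zz
  [:: true; false; false; true; false; true; false; true; false; true; false; true; true; false]
  ([:: [:: 0; 1; 0]; [:: 1; -2; 3]; [:: 0; 3; -6]])%zz
  ([:: [:: 0; -1; 0; 0; -1; 0; -2; 0; -3; 0; -3; 0; 1; 0; 1; 0; 0; 1; 0; 1; 0; 1; 0; 1; 0; 1; 0; -4];
    [:: 1; 0; -1; 0; 1; 1; 1; 1; 0; 0; 0; 1; 0; 0; 0; 1; 0; -1; 3; 0; -4; -2; -3; -2; 0; 0; -1; 0];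
    [:: 0; 1; 0; 1; 0; 0; 0; 0; 1; 1; 0; 0; 0; 0; 0; 0; 1; 0; -3; -3; 0; 0; 0; 0; -3; -3; 0; 0];
    [:: 0; 0; -1; 0; 1; 0; 1; 0; 0; 0; -3; -1; 0; 0; -1; 1; 0; 1; 0; 3; 0; -2; 0; -1; 0; 0; 1; 4];
    [:: 1; -1; 0; -1; 0; 0; 1; 1; 0; -1; 0; 0; 0; 0; 0; -3; 3; 0; 3; -3; 12; 6; 0; 0; -9; -6; 3; 0];
    [:: 0; -1; 0; 0; 0; 0; 1; 0; 3; 1; 0; 0; 0; 0; -1; 0; 3; -3; 3; 3; 0; 6; 0; 0; 0; -3; -3; -12];
    [:: 2; -1; 0; -1; -1; -1; 0; 2; 0; 0; 0; 0; 0; 0; 0; 4; 0; 0; -12; 0; 12; -12; 36; 12; 36; 12; -12; 0];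
    [:: 0; -1; 0; 0; -1; 0; -2; -1; 0; 0; 0; 0; 0; 0; -1; 2; 0; 2; -6; -6; 12; 6; 0; 12; 0; 12; 6; 24];
    [:: 3; 0; -1; 0; 0; -3; 0; 0; 0; 0; 0; 0; 0; 0; 0; 3; 0; 0; 0; 0; -36; 0; 36; -36; 108; 0; 36; 0];
    [:: 0; 0; -1; 0; 1; 1; 0; 0; 0; 0; 0; 0; 0; 0; -1; 2; 0; 1; 0; 0; -12; -12; 36; 12; 0; 36; -12; -48];
    [:: 3; 0; 0; 3; 0; 0; 0; 0; 0; 0; 0; 0; 0; 0; 0; 0; 3; 0; 9; 0; -36; 0; -108; 0; 108; -108; -108; 0];
    [:: 0; -1; 0; -1; 0; 0; 0; 0; 0; 0; 0; 0; 0; 0; -1; 0; 3; 0; 6; 3; -12; -12; 0; -36; 108; 36; 36; 144];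
    [:: 1; 0; 0; 0; 0; 0; 0; 0; 0; 0; 0; 0; 0; 0; 0; 1; 0; -1; -3; 3; 12; -6; -36; 12; 108; -36; 36; -144];
    [:: 0; 0; 0; 0; 0; 0; 0; 0; 0; 0; 0; 0; 0; 0; -4; 0; 0; 4; 0; -12; 0; 24; 0; -48; 0; 144; -144; -144];
    [:: -1; 0; 0; -1; 0; -1; 0; -1; 0; -1; 0; -1; 0; 4; 0; -1; 0; 0; -1; 0; -2; 0; -3; 0; -3; 0; 1; 0];
    [:: 0; 1; 0; -1; 3; 0; -4; -2; -3; -2; 0; 0; -1; 0; 1; 0; -1; 0; 1; 1; 1; 1; 0; 0; 0; 1; 0; 0];
    [:: 0; 0; 1; 0; -3; -3; 0; 0; 0; 0; -3; -3; 0; 0; 0; 1; 0; 1; 0; 0; 0; 0; 1; 1; 0; 0; 0; 0];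
    [:: 1; 1; 0; -1; 0; -3; 0; 2; 0; 1; 0; 0; -1; -4; 0; 0; -1; 0; 1; 0; 1; 0; 0; 0; -3; -1; 0; 0];
    [:: 0; -3; 3; 0; 3; -3; 12; 6; 0; 0; -9; -6; 3; 0; 1; -1; 0; -1; 0; 0; 1; 1; 0; -1; 0; 0; 0; 0];
    [:: 1; 0; 3; 3; 3; -3; 0; -6; 0; 0; 0; 3; 3; 12; 0; -1; 0; 0; 0; 0; 1; 0; 3; 1; 0; 0; 0; 0];
    [:: 0; 4; 0; 0; -12; 0; 12; -12; 36; 12; 36; 12; -12; 0; 2; -1; 0; -1; -1; -1; 0; 2; 0; 0; 0; 0; 0; 0];
    [:: 1; 2; 0; -2; -6; 6; 12; -6; 0; -12; 0; -12; -6; -24; 0; -1; 0; 0; -1; 0; -2; -1; 0; 0; 0; 0; 0; 0];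
    [:: 0; 3; 0; 0; 0; 0; -36; 0; 36; -36; 108; 0; 36; 0; 3; 0; -1; 0; 0; -3; 0; 0; 0; 0; 0; 0; 0; 0];
    [:: 1; 2; 0; -1; 0; 0; -12; 12; 36; -12; 0; -36; 12; 48; 0; 0; -1; 0; 1; 1; 0; 0; 0; 0; 0; 0; 0; 0];
    [:: 0; 0; 3; 0; 9; 0; -36; 0; -108; 0; 108; -108; -108; 0; 3; 0; 0; 3; 0; 0; 0; 0; 0; 0; 0; 0; 0; 0];
    [:: 1; 0; 3; 0; 6; -3; -12; 12; 0; 36; 108; -36; -36; -144; 0; -1; 0; -1; 0; 0; 0; 0; 0; 0; 0; 0; 0; 0];
    [:: 0; 1; 0; 1; -3; -3; 12; 6; -36; -12; 108; 36; -36; 144; 1; 0; 0; 0; 0; 0; 0; 0; 0; 0; 0; 0; 0; 0];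
    [:: 4; 0; 0; -4; 0; 12; 0; -24; 0; 48; 0; -144; 144; -144; 0; 0; 0; 0; 0; 0; 0; 0; 0; 0; 0; 0; 0; 0]])%zz
  [:: (0, 0); (0, 0); (0, 0); (4, 3); (5, 4); (5, 6); (4, 7); (4, 8); (4, 9); (4, 10); (5, 11); (5, 12); (4, 14); (3, 15); (0, 0); (0, 0); (0, 0); (18, 17); (19, 18); (19, 20); (18, 21); (18, 22); (18, 23); (18, 24); (19, 25); (19, 26); (18, 28); (17, 29)].

Definition F4_rd : rdata := RData 4 18
  ([:: [:: 1; 0; 0; 0];
    [:: 0; 1; 0; 0];
    [:: 0; 0; 1; 0];
    [:: 0; 0; 0; 1];
    [:: 1; 1; 0; 0];
    [:: 0; 1; 1; 0];
    [:: 0; 0; 1; 1];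
    [:: 1; 1; 1; 0];
    [:: 0; 2; 1; 0];
    [:: 0; 1; 1; 1];
    [:: 1; 2; 1; 0];
    [:: 1; 1; 1; 1];
    [:: 0; 2; 1; 1];
    [:: 1; 2; 1; 1];
    [:: 0; 2; 2; 1];
    [:: 1; 2; 2; 1];
    [:: 1; 3; 2; 1];
    [:: 2; 3; 2; 1]])%zz
  [:: true; false; false; false; true; false; false; true; false; false; true; true; false; true; false; true; true; false]
  ([:: [:: 0; -1; 0; 0]; [:: -1; 2; -2; 0]; [:: 0; -2; 4; -2]; [:: 0; 0; -2; 4]])%zz
  ([:: [:: 0; -1; 0; 0; 0; -1; 0; 0; -2; -1; 0; 0; -2; 0; -2; 0; 1; 0; 1; 0; 0; 0; -1; 0; 0; -1; 0; 0; -1; -1; 0; -1; 0; -1; 0; 3];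
    [:: 1; 0; -1; 0; 0; 1; -1; 1; 0; 1; 0; 1; 0; 0; 0; 1; 0; 0; 0; 1; 0; 0; 1; -2; 0; 0; 2; -2; 1; 0; 2; 1; 0; 0; 1; 0];
    [:: 0; 1; 0; -1; 1; 0; 0; 0; 0; 0; 0; 0; 1; 1; 0; 0; 0; 0; 0; 0; 1; 0; 0; 2; -2; 2; 0; 0; 0; 0; 0; 0; 2; 2; 0; 0];
    [:: 0; 0; 1; 0; 0; 1; 0; 1; 1; 0; 1; 0; 0; 0; 0; 0; 0; 0; 0; 0; 0; 1; 0; 0; 2; 0; 0; 2; 0; 2; 2; 2; 0; 0; 0; 0];
    [:: 0; 0; -1; 0; 0; 1; -1; 0; 0; 1; 0; 0; 0; 0; -2; -1; 0; 0; 1; -1; 0; 0; -1; 0; 0; 2; 0; 0; -1; 2; 0; -1; 0; 0; 1; 3];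
    [:: 1; -1; 0; -1; -1; 0; 0; 0; 0; 1; 0; 1; 0; -1; 0; 0; 0; 0; 0; 2; -2; 0; 0; -2; 0; -2; 4; 4; 2; 0; 0; 0; -4; -2; 2; 0];
    [:: 0; 1; 0; 0; 1; 0; 0; 0; -1; 0; -1; 0; 0; 0; 0; 0; 0; 0; 0; 0; 2; -2; 0; 0; -2; 0; 0; -4; 0; -4; 0; 0; 4; 4; 0; 0];
    [:: 0; -1; 0; -1; 0; 0; 0; 0; 0; 1; 0; 0; 2; 1; 0; 0; 0; 0; 1; 0; -2; 0; -2; 2; 0; 2; 0; 0; -2; -4; 0; 0; 0; 2; 2; 6];
    [:: 2; 0; 0; -1; 0; 0; 1; 0; 0; 0; 0; 2; 0; 0; 0; 0; 0; 0; 0; -2; 0; 0; 0; -4; 0; 0; 4; 0; 4; 0; -8; 0; 8; 0; 4; 0];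
    [:: 1; -1; 0; 0; -1; -1; 0; -1; 0; 0; 1; 0; 0; 0; 0; 0; 0; 0; 0; 2; 0; -2; 0; -4; 4; 0; 0; 4; 0; 4; -8; -4; -8; -4; 4; 0];
    [:: 0; 0; 0; -1; 0; 0; 1; 0; 0; -1; 0; -1; 0; 0; 0; 0; 0; 0; 1; -1; 0; 0; 1; -2; 0; 2; -4; 0; -2; 0; 0; 4; 0; -4; 2; 6];
    [:: 0; -1; 0; 0; 0; -1; 0; 0; -2; 0; -1; 0; 0; 0; 0; 0; 0; 0; 1; 0; 0; -2; -2; 0; 4; 4; 0; -4; 0; -4; 0; 4; 0; 4; 4; 12];
    [:: 2; 0; -1; 0; 0; 0; 0; -2; 0; 0; 0; 0; 0; 0; 0; 0; 0; 0; 0; -2; 0; -2; 0; 0; 0; 0; 8; 8; 0; 0; -8; -8; 16; 0; 8; 0];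
    [:: 0; 0; -1; 0; 0; 1; 0; 1; 0; 0; 0; 0; 0; 0; 0; 0; 0; 0; 1; -1; 0; -2; 1; 0; 0; 0; 0; 4; -4; -4; 8; 4; 0; -8; 4; 12];
    [:: 2; 0; 0; 0; 2; 0; 0; 0; 0; 0; 0; 0; 0; 0; 0; 0; 0; 0; 0; 0; -2; 0; 0; 4; -4; 0; -8; 8; 0; 0; -16; 0; 16; 16; 16; 0];
    [:: 0; -1; 0; 0; -1; 0; 0; 0; 0; 0; 0; 0; 0; 0; 0; 0; 0; 0; 1; 0; -2; 0; 0; 2; -4; -2; 0; 4; 4; -4; 0; 8; -16; -8; 8; 24];
    [:: 1; 0; 0; 0; 0; 0; 0; 0; 0; 0; 0; 0; 0; 0; 0; 0; 0; 0; 0; -1; 0; 0; -1; -2; 0; -2; -4; -4; -2; -4; -8; -4; -16; -8; 8; 24];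
    [:: 0; 0; 0; 0; 0; 0; 0; 0; 0; 0; 0; 0; 0; 0; 0; 0; 0; 0; 3; 0; 0; 0; 3; 0; 0; 6; 0; 0; 6; 12; 0; 12; 0; 24; 24; 24];
    [:: -1; 0; 0; 0; 1; 0; 0; 1; 0; 0; 1; 1; 0; 1; 0; 1; 0; -3; 0; -1; 0; 0; 0; -1; 0; 0; -2; -1; 0; 0; -2; 0; -2; 0; 1; 0];
    [:: 0; 1; 0; 0; 1; -2; 0; 0; 2; -2; 1; 0; 2; 1; 0; 0; 1; 0; 1; 0; -1; 0; 0; 1; -1; 1; 0; 1; 0; 1; 0; 0; 0; 1; 0; 0];
    [:: 0; 0; 1; 0; 0; 2; -2; 2; 0; 0; 0; 0; 0; 0; 2; 2; 0; 0; 0; 1; 0; -1; 1; 0; 0; 0; 0; 0; 0; 0; 1; 1; 0; 0; 0; 0];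
    [:: 0; 0; 0; 1; 0; 0; 2; 0; 0; 2; 0; 2; 2; 2; 0; 0; 0; 0; 0; 0; 1; 0; 0; 1; 0; 1; 1; 0; 1; 0; 0; 0; 0; 0; 0; 0];
    [:: -1; -1; 0; 0; 1; 0; 0; -2; 0; 0; 1; -2; 0; 1; 0; 0; -1; -3; 0; 0; -1; 0; 0; 1; -1; 0; 0; 1; 0; 0; 0; 0; -2; -1; 0; 0];
    [:: 0; 2; -2; 0; 0; -2; 0; -2; 4; 4; 2; 0; 0; 0; -4; -2; 2; 0; 1; -1; 0; -1; -1; 0; 0; 0; 0; 1; 0; 1; 0; -1; 0; 0; 0; 0];
    [:: 0; 0; 2; -2; 0; 0; -2; 0; 0; -4; 0; -4; 0; 0; 4; 4; 0; 0; 0; 1; 0; 0; 1; 0; 0; 0; -1; 0; -1; 0; 0; 0; 0; 0; 0; 0];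
    [:: -1; 0; -2; 0; 2; 2; 0; -2; 0; 0; 2; 4; 0; 0; 0; -2; -2; -6; 0; -1; 0; -1; 0; 0; 0; 0; 0; 1; 0; 0; 2; 1; 0; 0; 0; 0];
    [:: 0; -2; 0; 0; 0; -4; 0; 0; 4; 0; 4; 0; -8; 0; 8; 0; 4; 0; 2; 0; 0; -1; 0; 0; 1; 0; 0; 0; 0; 2; 0; 0; 0; 0; 0; 0];
    [:: 0; 2; 0; -2; 0; -4; 4; 0; 0; 4; 0; 4; -8; -4; -8; -4; 4; 0; 1; -1; 0; 0; -1; -1; 0; -1; 0; 0; 1; 0; 0; 0; 0; 0; 0; 0];
    [:: -1; -1; 0; 0; -1; -2; 0; -2; -4; 0; 2; 0; 0; -4; 0; 4; -2; -6; 0; 0; 0; -1; 0; 0; 1; 0; 0; -1; 0; -1; 0; 0; 0; 0; 0; 0];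
    [:: -1; 0; 0; -2; 2; 0; 4; -4; 0; -4; 0; 4; 0; -4; 0; -4; -4; -12; 0; -1; 0; 0; 0; -1; 0; 0; -2; 0; -1; 0; 0; 0; 0; 0; 0; 0];
    [:: 0; -2; 0; -2; 0; 0; 0; 0; 8; 8; 0; 0; -8; -8; 16; 0; 8; 0; 2; 0; -1; 0; 0; 0; 0; -2; 0; 0; 0; 0; 0; 0; 0; 0; 0; 0];
    [:: -1; -1; 0; -2; -1; 0; 0; 0; 0; 4; 4; 4; 8; -4; 0; 8; -4; -12; 0; 0; -1; 0; 0; 1; 0; 1; 0; 0; 0; 0; 0; 0; 0; 0; 0; 0];
    [:: 0; 0; -2; 0; 0; 4; -4; 0; -8; 8; 0; 0; -16; 0; 16; 16; 16; 0; 2; 0; 0; 0; 2; 0; 0; 0; 0; 0; 0; 0; 0; 0; 0; 0; 0; 0];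
    [:: -1; 0; -2; 0; 0; 2; -4; 2; 0; 4; -4; 4; 0; -8; -16; 8; -8; -24; 0; -1; 0; 0; -1; 0; 0; 0; 0; 0; 0; 0; 0; 0; 0; 0; 0; 0];
    [:: 0; -1; 0; 0; 1; -2; 0; 2; -4; -4; 2; 4; -8; 4; -16; 8; -8; -24; 1; 0; 0; 0; 0; 0; 0; 0; 0; 0; 0; 0; 0; 0; 0; 0; 0; 0];
    [:: -3; 0; 0; 0; -3; 0; 0; -6; 0; 0; -6; -12; 0; -12; 0; -24; -24; 24; 0; 0; 0; 0; 0; 0; 0; 0; 0; 0; 0; 0; 0; 0; 0; 0; 0; 0]])%zz
  [:: (0, 0); (0, 0); (0, 0); (0, 0); (5, 4); (6, 5); (7, 6); (6, 8); (5, 9); (7, 9); (5, 11); (7, 11); (7, 12); (7, 14); (6, 16); (6, 17); (5, 19); (4, 20); (0, 0); (0, 0); (0, 0); (0, 0); (23, 22); (24, 23); (25, 24); (24, 26); (23, 27); (25, 27); (23, 29); (25, 29); (25, 30); (25, 32); (24, 34); (24, 35); (23, 37); (22, 38)].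

Lemma G3_check_all : check_all G3_rd. Proof. by vm_compute. Qed.
Lemma F4_check_all : check_all F4_rd. Proof. by vm_compute. Qed.

(* The simple roots of system I in terms of those of the given system. *)
Definition G3_inv (X : g3sys) : seq (seq Z) := (match X with
  | G3I => [:: [:: 1; 0; 0]; [:: 0; 1; 0]; [:: 0; 0; 1]]
  | G3II => [:: [:: -1; 0; 0]; [:: 1; 1; 0]; [:: 0; 0; 1]]
  | G3III => [:: [:: -1; 0; -1]; [:: 0; 0; 1]; [:: 1; 1; 0]]
  | G3IV => [:: [:: -1; -2; -1]; [:: 0; 1; 1]; [:: 1; 0; 0]]
  end)%zz.
Definition F4_inv (X : f4sys) : seq (seq Z) := (match X with
  | F4I => [:: [:: 1; 0; 0; 0]; [:: 0; 1; 0; 0]; [:: 0; 0; 1; 0]; [:: 0; 0; 0; 1]]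
  | F4II => [:: [:: -1; 0; 0; 0]; [:: 1; 1; 0; 0]; [:: 0; 0; 1; 0]; [:: 0; 0; 0; 1]]
  | F4III => [:: [:: 0; 0; -1; -1]; [:: 0; 0; 0; 1]; [:: 0; 1; 1; 0]; [:: 1; 0; 0; 0]]
  | F4IV => [:: [:: 0; -1; -2; -1]; [:: 0; 1; 1; 0]; [:: 0; 0; 0; 1]; [:: 1; 0; 1; 0]]
  | F4V => [:: [:: 0; -1; -2; -1]; [:: 0; 0; 1; 0]; [:: 0; 0; 0; 1]; [:: 1; 2; 1; 0]]
  | F4VI => [:: [:: -1; -3; -2; -1]; [:: 1; 2; 1; 0]; [:: 0; 0; 0; 1]; [:: 0; 0; 1; 0]]
  end)%zz.

(** Coordinates in [d], [e1], [e2] after eliminating [e3] by [e1 + e2 + e3 = 0]. *)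
Definition g3_coords (w : wt) : seq rat := [:: w.1.1.1; w.1.1.2 - w.2; w.1.2 - w.2].
Definition f4_coords (w : wt) : seq rat := [:: w.1.1.1; w.1.1.2; w.1.2; w.2].
Definition g3_srs X : seq wt := [:: g3simple X (@Ordinal 3 0 isT); g3simple X (@Ordinal 3 1 isT);
  g3simple X (@Ordinal 3 2 isT)].
Definition f4_srs X : seq wt := [:: f4simple X (@Ordinal 4 0 isT); f4simple X (@Ordinal 4 1 isT);
  f4simple X (@Ordinal 4 2 isT); f4simple X (@Ordinal 4 3 isT)].
Definition G3_F (s : seq wt) : seq (seq Z) := [seq map dbl (g3_coords w) | w <- s].
Definition F4_F (s : seq wt) : seq (seq Z) := [seq map dbl (f4_coords w) | w <- s].

Lemma G3_half : all (fun w => all half_integral (g3_coords w))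
  (map fst G3roots ++ flatten (map g3_srs [:: G3I; G3II; G3III; G3IV])).
Proof. by vm_compute. Qed.
Lemma F4_half : all (fun w => all half_integral (f4_coords w))
  (map fst F4roots ++ flatten (map f4_srs [:: F4I; F4II; F4III; F4IV; F4V; F4VI])).
Proof. by vm_compute. Qed.

Lemma G3_check_frame : check_frame G3_rd (G3_F (g3_srs G3I)) (G3_F (map fst G3roots))
  (find_pi G3_rd (G3_F (g3_srs G3I)) (G3_F (map fst G3roots))) (map snd G3roots).
Proof. by vm_compute. Qed.
Lemma F4_check_frame : check_frame F4_rd (F4_F (f4_srs F4I)) (F4_F (map fst F4roots))
  (find_pi F4_rd (F4_F (f4_srs F4I)) (F4_F (map fst F4roots))) (map snd F4roots).
Proof. by vm_compute. Qed.

Lemma G3_check_base X : check_base G3_rd (G3_F (g3_srs G3I)) (G3_F (g3_srs X))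
  (find_A G3_rd (G3_F (g3_srs G3I)) (G3_F (g3_srs X))) (G3_inv X).
Proof. by case: X; vm_compute. Qed.
Lemma F4_check_base X : check_base F4_rd (F4_F (f4_srs F4I)) (F4_F (f4_srs X))
  (find_A F4_rd (F4_F (f4_srs F4I)) (F4_F (f4_srs X))) (F4_inv X).
Proof. by case: X; vm_compute. Qed.

Definition G3_excb (X : g3sys) (bs : seq bool) : bool :=
  if X is G3II then false else bs == unitbits 3 0.
Definition F4_excb (X : f4sys) (bs : seq bool) : bool :=
  match X with
  | F4I | F4IV | F4V => (bs == unitbits 4 0) || (bs == unitbits 4 3)
  | F4III => (bs == unitbits 4 0) || (bs == unitbits 4 2)
  | F4II | F4VI => bs == unitbits 4 3
  end.

Lemma G3_excE X S : g3exc X S = G3_excb X (bits S).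
Proof. by case: X => //=; rewrite eq_set1_bits. Qed.
Lemma F4_excE X S : f4exc X S = F4_excb X (bits S).
Proof. by case: X; rewrite /= !eq_set1_bits // inordK. Qed.

(* The cubic form is the product of three odd coordinates dual to an isotropic triple. *)
Definition G3_odd : nat * nat * Z * seq (nat * nat * seq (nat * Z)) := (30%N, 16%N, (-576)%zz,
  [:: (29, 28, [:: (22, 1%zz)]); (29, 26, [:: (20, 1%zz)]); (28, 29, [:: (22, (-1)%zz)]);
    (28, 26, [:: (17, 1%zz)]); (26, 29, [:: (20, (-1)%zz)]); (26, 28, [:: (17, (-1)%zz)])]%N).
(** The scalar is the table entry for the vectors of degree 2 and -2 times the coefficient of their
    coroot, which is a multiple of the first Cartan vector, the grading element here. This gives
    [24 * (-3) = -72], and [-144 * 4 = -576] for G(3). *)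
Definition F4_odd : nat * nat * Z * seq (nat * nat * seq (nat * Z)) := (39%N, 21%N, (-72)%zz,
  [:: (38, 37, [:: (29, 1%zz)]); (38, 35, [:: (26, 1%zz)]); (37, 38, [:: (29, (-1)%zz)]);
    (37, 35, [:: (22, 1%zz)]); (35, 38, [:: (26, (-1)%zz)]); (35, 37, [:: (22, (-1)%zz)])]%N).

(* Different systems often give the same grading, which is checked only once. *)
Definition G3_gradings := undup [seq (gvec (G3_inv X) bs, G3_excb X bs)
  | X <- [:: G3I; G3II; G3III; G3IV], bs <- nzbits 3].
Definition F4_gradings := undup [seq (gvec (F4_inv X) bs, F4_excb X bs)
  | X <- [:: F4I; F4II; F4III; F4IV; F4V; F4VI], bs <- nzbits 4].

Lemma G3_check_gradings : all (check_one G3_rd (rtab G3_rd) (wcodes G3_rd) G3_odd) G3_gradings.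
Proof. by vm_compute. Qed.
Lemma F4_check_gradings : all (check_one F4_rd (rtab F4_rd) (wcodes F4_rd) F4_odd) F4_gradings.
Proof. by vm_compute. Qed.

(** The types of systems carry no decidable equality, so membership of a system is expressed with
    [List.In] and only its image lies in an [eqType]. *)
Lemma mem_map_In (T : Type) (U : eqType) (f : T -> U) s x : List.In x s -> f x \in map f s.
Proof. by elim: s => //= y s IH [->|/IH ?]; rewrite inE ?eqxx //; apply/orP; right. Qed.

(** * Application to G(3) and F(4) *)

Section Family.
Variables (K : numFieldType) (g : LSA K) (h : {vspace g}) (d e1 e2 e3 : g -> K).

Lemma G3_Ev w : (forall H, H \in h -> e1 H + e2 H + e3 H = 0) -> all half_integral (g3_coords w) ->
  Ev h (weval d e1 e2 e3) G3_rd (fun k => nth d [:: d; e1; e2] k) w (map dbl (g3_coords w)).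
Proof.
move=> he /and4P[w0 w1 w2 _] H /he hH; rewrite /weval 3!big_ord_recl big_ord0 /=.
have := ratr_dbl K w1; have := ratr_dbl K w2; rewrite !rmorphB /= (ratr_dbl K w0).
move=> /eqP; rewrite subr_eq => /eqP -> /eqP; rewrite subr_eq => /eqP ->.
have -> : e3 H = - (e1 H + e2 H) by apply/eqP; rewrite -addr_eq0 addrC hH.
by rewrite /bump /=; field.
Qed.

Lemma F4_Ev w : all half_integral (f4_coords w) ->
  Ev h (weval d e1 e2 e3) F4_rd (fun k => nth d [:: d; e1; e2; e3] k) w (map dbl (f4_coords w)).
Proof.
move=> /and5P[w0 w1 w2 w3 _] H hH; rewrite /weval 4!big_ord_recl big_ord0 /=.
rewrite (ratr_dbl K w0) (ratr_dbl K w1) (ratr_dbl K w2) (ratr_dbl K w3).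
by rewrite /bump /=; field.
Qed.

Theorem G3_prolongation (X : g3sys) (S : {set 'I_3}) : G3data h d e1 e2 e3 -> S != set0 ->
  let G := gradedG h (weval d e1 e2 e3) G3roots (g3simple X) S in
  (~~ g3exc X S -> @IsPr _ G G id) /\
  (g3exc X S -> (exists (P : gLSA K) (phi : G -> P), IsPr phi /\ InfDim P) /\ @IsPr0 _ G G id).
Proof.
move=> [[hg simple] [dim0 dim1] [dim_h [ld l1 l2 l3]] [he hind] RD] S0; rewrite G3_excE.
have half w : w \in map fst G3roots ++ flatten (map g3_srs [:: G3I; G3II; G3III; G3IV]) ->
  Ev h (weval d e1 e2 e3) G3_rd (fun k => nth d [:: d; e1; e2] k) w (map dbl (g3_coords w)).
  by move=> hw; apply: G3_Ev => //; apply: (allP G3_half).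
apply: (@graded_prolongation K g hg simple h (weval d e1 e2 e3) G3roots G3_rd
  (fun k => nth d [:: d; e1; e2] k) _ dim_h _ _ RD _ _ _ _ _ G3_check_frame G3_check_all
  (g3simple X) S (G3_F (g3_srs X)) _ (G3_inv X) G3_odd _ _ (G3_check_base X)).
- by case=> [|[|[|]]].
- move=> v hv; have [] := hind (v 0%N) (v 1%N) (v 2%N).
    by move=> H /hv; rewrite 3!big_ord_recl big_ord0 /= addr0 addrA.
  by move=> v0 v1 v2 [|[|[|]]].
- by rewrite dim0 dim1.
- by [].
- move=> q hq; rewrite (nth_map W0) ?size_map // (nth_map (W0, false)) //; apply: half.
  by rewrite mem_cat map_f ?mem_nth.
- have sub : {subset g3_srs X <= map fst G3roots ++ flatten (map g3_srs [:: G3I; G3II; G3III; G3IV])}.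
    move=> w hw; rewrite mem_cat; apply/orP; right; apply/flattenP; exists (g3_srs X) => //.
    by apply: mem_map_In; case: (X) => /=; tauto.
  case=> -[|[|[|//]]] hi; apply: half; apply: sub; rewrite !inE.
  + by rewrite eqxx.
  + by rewrite eqxx orbT.
  + by rewrite eqxx !orbT.
- by vm_compute.
apply: (allP G3_check_gradings); rewrite mem_undup; apply/flattenP.
exists [seq (gvec (G3_inv X) bs, G3_excb X bs) | bs <- nzbits 3].
  by apply: (mem_map_In (fun Y => [seq (gvec (G3_inv Y) bs, G3_excb Y bs) | bs <- nzbits 3]));
    case: (X) => /=; tauto.
by apply: (map_f (fun bs => (gvec (G3_inv X) bs, G3_excb X bs))); apply: mem_nzbits.
Qed.

Theorem F4_prolongation (X : f4sys) (S : {set 'I_4}) : F4data h d e1 e2 e3 -> S != set0 ->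
  let G := gradedG h (weval d e1 e2 e3) F4roots (f4simple X) S in
  (~~ f4exc X S -> @IsPr _ G G id) /\
  (f4exc X S -> (exists (P : gLSA K) (phi : G -> P), IsPr phi /\ InfDim P) /\ @IsPr0 _ G G id).
Proof.
move=> [[hg simple] [dim0 dim1] [dim_h [ld l1 l2 l3]] hind RD] S0; rewrite F4_excE.
have half w : w \in map fst F4roots ++ flatten (map f4_srs [:: F4I; F4II; F4III; F4IV; F4V; F4VI]) ->
  Ev h (weval d e1 e2 e3) F4_rd (fun k => nth d [:: d; e1; e2; e3] k) w (map dbl (f4_coords w)).
  by move=> hw; apply: F4_Ev => //; apply: (allP F4_half).
apply: (@graded_prolongation K g hg simple h (weval d e1 e2 e3) F4roots F4_rd
  (fun k => nth d [:: d; e1; e2; e3] k) _ dim_h _ _ RD _ _ _ _ _ F4_check_frame F4_check_all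
  (f4simple X) S (F4_F (f4_srs X)) _ (F4_inv X) F4_odd _ _ (F4_check_base X)).
- by case=> [|[|[|[|]]]].
- move=> v hv; have [] := hind (v 0%N) (v 1%N) (v 2%N) (v 3%N).
    by move=> H /hv; rewrite 4!big_ord_recl big_ord0 /= addr0 !addrA.
  by move=> v0 v1 v2 v3 [|[|[|[|]]]].
- by rewrite dim0 dim1.
- by [].
- move=> q hq; rewrite (nth_map W0) ?size_map // (nth_map (W0, false)) //; apply: half.
  by rewrite mem_cat map_f ?mem_nth.
- have sub : {subset f4_srs X <= map fst F4roots ++ flatten (map f4_srs [:: F4I; F4II; F4III; F4IV; F4V; F4VI])}.
    move=> w hw; rewrite mem_cat; apply/orP; right; apply/flattenP; exists (f4_srs X) => //.
    by apply: mem_map_In; case: (X) => /=; tauto.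
  case=> -[|[|[|[|//]]]] hi; apply: half; apply: sub; rewrite !inE.
  + by rewrite eqxx.
  + by rewrite eqxx orbT.
  + by rewrite eqxx !orbT.
  + by rewrite eqxx !orbT.
- by vm_compute.
apply: (allP F4_check_gradings); rewrite mem_undup; apply/flattenP.
exists [seq (gvec (F4_inv X) bs, F4_excb X bs) | bs <- nzbits 4].
  by apply: (mem_map_In (fun Y => [seq (gvec (F4_inv Y) bs, F4_excb Y bs) | bs <- nzbits 4]));
    case: (X) => /=; tauto.
by apply: (map_f (fun bs => (gvec (F4_inv X) bs, F4_excb X bs))); apply: mem_nzbits.
Qed.
End Family.

Theorem theorem1p1 (R : realType) :
  (forall (g : LSA R[i]) (h : {vspace g}) (d e1 e2 e3 : g -> R[i]),
     G3data h d e1 e2 e3 ->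
     forall (X : g3sys) (S : {set 'I_3}), S != set0 ->
     let G := gradedG h (weval d e1 e2 e3) G3roots (g3simple X) S in
     (~~ g3exc X S -> @IsPr _ G G id) /\
     (g3exc X S ->
        (exists (P : gLSA R[i]) (phi : G -> P), IsPr phi /\ InfDim P) /\
        @IsPr0 _ G G id)) /\
  (forall (g : LSA R[i]) (h : {vspace g}) (d e1 e2 e3 : g -> R[i]),
     F4data h d e1 e2 e3 ->
     forall (X : f4sys) (S : {set 'I_4}), S != set0 ->
     let G := gradedG h (weval d e1 e2 e3) F4roots (f4simple X) S in
     (~~ f4exc X S -> @IsPr _ G G id) /\
     (f4exc X S ->
        (exists (P : gLSA R[i]) (phi : G -> P), IsPr phi /\ InfDim P) /\
        @IsPr0 _ G G id)).
Proof.
by split=> g h d e1 e2 e3 data X S S0; [apply: G3_prolongation|apply: F4_prolongation].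
Qed.
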